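(* Let $\alpha\in\mathbb{D}$, $\beta\in\mathbb{T}$, $\beta\neq1$, $\Psi_\alpha(z)=\frac{\alpha-z}{1-\overline{\alpha}z}$, $r_\beta(z)=\beta z$, and $\varphi=\Psi_\alpha\circ r_\beta\circ\Psi_\alpha$. Assume $\varphi$ is aperiodic, i.e. $\varphi_n\neq\mathrm{Id}$ for all $n\in\mathbb{N}$ where $\varphi_n=\varphi\circ\cdots\circ\varphi$ ($n$ times). Let $m\in\mathrm{Hol}(\mathbb{D})$, $m\not\equiv0$, and $T:\mathrm{Hol}(\mathbb{D})\to\mathrm{Hol}(\mathbb{D})$, $Tf=m\cdot(f\circ\varphi)$. (a) If $m(z)\neq0$ for all $z\in\mathbb{D}$, then $\sigma_W(T)=\{\lambda\in\mathbb{C}:|\lambda|=|m(\alpha)|\}$. (b) If there exists $z_0\in\mathbb{D}$ with $m(z_0)=0$, then there exists $0<R\leq\infty$ such that $\sigma_W(T)=\{\lambda\in\mathbb{C}:|\lambda|\leq R\}$ if $R<\infty$ and $\sigma_W(T)=\mathbb{C}$ otherwise.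
   Context: $\mathbb{D}$ is the open unit disc, $\mathbb{T}$ the unit circle, $\mathrm{Hol}(\mathbb{D})$ the Fréchet space of holomorphic functions on $\mathbb{D}$ with seminorms $\|f\|_{A(r\mathbb{D})}=\sup_{|z|\leq r}|f(z)|$, $0<r<1$. For a continuous linear $T$ on $\mathrm{Hol}(\mathbb{D})$, $\rho(T)$ is the set of $\lambda$ with $\lambda\mathrm{Id}-T$ bijective and $R_\lambda=(\lambda\mathrm{Id}-T)^{-1}$. The Waelbroeck resolvent set $\rho_W(T)$ is the set of $\lambda\in\rho(T)$ for which there is $\delta>0$ with $\overline{D}(\lambda,\delta)\subset\rho(T)$ and $\sup_{|\mu-\lambda|\leq\delta}\|R_\mu f\|_{A(r\mathbb{D})}<\infty$ for all $f\in\mathrm{Hol}(\mathbb{D})$, $0<r<1$; $\sigma_W(T)=\mathbb{C}\setminus\rho_W(T)$. *)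

(* Defs.v *)
From Stdlib Require Import Reals.
From Coquelicot Require Export Coquelicot.
Open Scope R_scope.

Definition inD (z : C) : Prop := Cmod z < 1.

(* f is holomorphic on D (values outside D are irrelevant) *)
Definition holD (f : C -> C) : Prop :=
  forall z, inD z -> ex_derive (K := C_AbsRing) (V := C_NormedModule) f z.

(* equality as elements of Hol(D) *)
Definition eqD (f g : C -> C) : Prop := forall z, inD z -> f z = g z.

Definition Psi (a z : C) : C := ((a - z) / (1 - Cconj a * z))%C.
Definition rot (b z : C) : C := (b * z)%C.
Definition phi (a b : C) : C -> C := fun z => Psi a (rot b (Psi a z)).

Definition aperiodic (p : C -> C) : Prop :=
  forall n : nat, (1 <= n)%nat -> exists z, inD z /\ Nat.iter n p z <> z.

Definition wcomp (m p : C -> C) (f : C -> C) : C -> C := fun z => (m z * f (p z))%C.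

Definition shiftop (T : (C -> C) -> (C -> C)) (l : C) (f : C -> C) : C -> C :=
  fun z => (l * f z - T f z)%C.

Definition in_rho (T : (C -> C) -> (C -> C)) (l : C) : Prop :=
  (forall g, holD g -> exists f, holD f /\ eqD (shiftop T l f) g) /\
  (forall f1 f2, holD f1 -> holD f2 ->
     eqD (shiftop T l f1) (shiftop T l f2) -> eqD f1 f2).

(* Waelbroeck resolvent set: R_mu f = the (unique on D) holomorphic h with
   (mu Id - T) h = f on D; the sup bound is stated for every such h. *)
Definition in_rhoW (T : (C -> C) -> (C -> C)) (l : C) : Prop :=
  in_rho T l /\
  exists d : R, 0 < d /\
    (forall mu : C, Cmod (mu - l)%C <= d -> in_rho T mu) /\
    (forall f, holD f -> forall r : R, 0 < r < 1 ->
       exists M : R, forall mu : C, Cmod (mu - l)%C <= d ->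
         forall h, holD h -> eqD (shiftop T mu h) f ->
           forall z, Cmod z <= r -> Cmod (h z) <= M).

Definition in_sigmaW (T : (C -> C) -> (C -> C)) (l : C) : Prop := ~ in_rhoW T l.

(* Main.v *)
(* Conjugating by the involution Psi_a reduces to the rotation z |-> b z about 0, with b not a
   root of unity. On Taylor coefficients T becomes a lower triangular operator S with diagonal
   m_0 b^k, so (mu - S) f = g is uniquely solvable as soon as |mu| <> |m_0|, and the coordinates
   of f are holomorphic in mu; the whole circle |mu| = |m_0| is spectral because the points
   m_0 b^k are dense in it.

   T (z f) = b z T f makes the Waelbroeck resolvent set invariant under mu |-> b mu, hence, by
   density of the b^j, bounds on the resolvent near mu hold on an annulus. Cauchy's estimates in
   the variable mu then propagate them outwards if |mu| > |m_0| (giving |S^n g| <= C |mu|^n), and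
   inwards to mu = 0 if |mu| < |m_0|, which is impossible when m has a zero as T is then not onto.
   So in case (b) the spectrum is closed and downward closed; R > 0 because the leading
   coefficient of T^n 1 is of modulus |m_N|^n, where m = m_N z^N + ....

   In case (a) the logarithmic derivative of the cocycle m(z) m(bz) ... m(b^(n-1) z) is a Birkhoff
   sum of z m'/m, a function vanishing at 0, so it is o(n) uniformly on compact sets. Hence the
   cocycle is bounded by C q^n for every q > |m_0|, and the same applies to T^-1. *)

Require Import Defs.
From Stdlib Require Import Reals Lra Lia Psatz Classical ClassicalEpsilon Compare_dec.
From Coquelicot Require Import Coquelicot.
Open Scope R_scope.

(** * Goursat's lemma on rectangles *)

(** [holD] asserts complex differentiability at each point and nothing more, so Taylor expansions
    and Cauchy's estimates are derived from Goursat's quartering argument. Rectangles are carried to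
    annuli by exp, and circles are parametrized by the angle, so that Cauchy's theorem becomes
    constancy of the mean over circles. Hol(D) is handled as the space of sequences a with |a_k| r^k
    bounded for each r < 1: such a bound at a larger radius controls the function on a smaller disc,
    and Cauchy's estimate gives the converse. The formal solution costs no analysis; the difficulty
    is whether it has this growth. No operator-valued holomorphic function occurs: estimates in the
    spectral parameter are applied to one scalar coordinate at a time, with constants uniform in the
    coordinate. Density is used through finitely many powers b^j, because each right-hand side z^j g
    has its own constant and dividing by z^j costs a factor r^-j. The pencil s - w S with two
    parameters lets the expansion at infinity and the inverse of T share their lemmas. *)

Lemma Rlt_Rmin (x a b : R) : x < Rmin a b -> x < a /\ x < b.
Proof.
  intros H. pose proof (Rmin_l a b). pose proof (Rmin_r a b). lra.
Qed.

Lemma norm_C_R (z : C_R_NormedModule) : norm z = Cmod z.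
Proof.
  unfold norm; simpl; unfold prod_norm, Cmod, norm; simpl; unfold abs; simpl.
  f_equal; rewrite !Rmult_1_r, <- !Rabs_mult, !Rabs_pos_eq; nra.
Qed.

Lemma Cmod_triangle_minus (x y : C) : Cmod (x - y)%C <= Cmod x + Cmod y.
Proof.
  replace (x - y)%C with (x + - y)%C by ring.
  rewrite <- (Cmod_opp y). apply Cmod_triangle.
Qed.

Lemma Cmod_minus_sym (x y : C) : Cmod (x - y)%C = Cmod (y - x)%C.
Proof. rewrite <- Cmod_opp. f_equal. ring. Qed.

Lemma Cmod_triangle_rev (x y : C) : Cmod x - Cmod y <= Cmod (x - y)%C.
Proof.
  pose proof (Cmod_triangle (x - y)%C y) as H.
  replace ((x - y) + y)%C with x in H by ring. lra.
Qed.

Lemma Cmod_le_abs (x : C) : Cmod x <= Rabs (fst x) + Rabs (snd x).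
Proof.
  unfold Cmod. apply Rsqr_incr_0_var.
  - rewrite Rsqr_sqrt; [|nra]. unfold Rsqr.
    pose proof (Rabs_pos (fst x)). pose proof (Rabs_pos (snd x)).
    rewrite <- (pow2_abs (fst x)), <- (pow2_abs (snd x)). nra.
  - pose proof (Rabs_pos (fst x)). pose proof (Rabs_pos (snd x)). lra.
Qed.

Lemma Rabs_fst_le (x : C) : Rabs (fst x) <= Cmod x.
Proof. eapply Rle_trans; [apply Rmax_l|apply Rmax_Cmod]. Qed.

Lemma Rabs_snd_le (x : C) : Rabs (snd x) <= Cmod x.
Proof. eapply Rle_trans; [apply Rmax_r|apply Rmax_Cmod]. Qed.

Definition contR (f : R -> C) (t : R) : Prop :=
  forall eps, 0 < eps -> exists d, 0 < d /\
    forall u, Rabs (u - t) < d -> Cmod (f u - f t)%C <= eps.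

Lemma contR_continuous (f : R -> C) (t : R) :
  contR f t -> continuous (U := C_R_CompleteNormedModule) f t.
Proof.
  intros H. apply filterlim_locally. intros eps.
  destruct (H (pos eps / 2)) as [d [Hd Hu]].
  { destruct eps; simpl; lra. }
  exists (mkposreal d Hd). intros u Hb.
  assert (Hm : Cmod (f u - f t)%C <= pos eps / 2) by (apply Hu; exact Hb).
  pose proof (cond_pos eps).
  split.
  - change (Rabs (fst (f u) - fst (f t)) < eps).
    eapply Rle_lt_trans; [apply (Rabs_fst_le (f u - f t)%C)|lra].
  - change (Rabs (snd (f u) - snd (f t)) < eps).
    eapply Rle_lt_trans; [apply (Rabs_snd_le (f u - f t)%C)|lra].
Qed.

(** Fixes C as a real normed module, the variable of integration being real. *)
Definition isI (f : R -> C) (a b : R) (l : C) : Prop :=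
  is_RInt (V := C_R_NormedModule) f a b l.

Lemma isI_ex (f : R -> C) (a b : R) :
  a <= b -> (forall t, a <= t <= b -> contR f t) -> exists l, isI f a b l.
Proof.
  intros Hab H. destruct (ex_RInt_continuous (V := C_R_CompleteNormedModule) f a b) as [l Hl].
  - rewrite Rmin_left, Rmax_right by assumption.
    intros z Hz. apply contR_continuous, H, Hz.
  - exists l. exact Hl.
Qed.

Lemma isI_unique (f : R -> C) (a b : R) (l l' : C) : isI f a b l -> isI f a b l' -> l = l'.
Proof.
  intros H H'.
  rewrite <- (is_RInt_unique (V := C_R_CompleteNormedModule) f a b l H).
  exact (is_RInt_unique (V := C_R_CompleteNormedModule) f a b l' H').
Qed.

Lemma isI_plus (f g : R -> C) (a b : R) (l l' : C) :
  isI f a b l -> isI g a b l' -> isI (fun t => f t + g t)%C a b (l + l')%C.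
Proof. exact (is_RInt_plus f g a b l l'). Qed.

Lemma isI_minus (f g : R -> C) (a b : R) (l l' : C) :
  isI f a b l -> isI g a b l' -> isI (fun t => f t - g t)%C a b (l - l')%C.
Proof. exact (is_RInt_minus f g a b l l'). Qed.

(** Complex numbers are not scalars of the real module, so the integral is split into its two real
    coordinates and reassembled. *)
Lemma isI_scal (c : C) (f : R -> C) (a b : R) (l : C) :
  isI f a b l -> isI (fun t => c * f t)%C a b (c * l)%C.
Proof.
  intros H.
  pose proof (is_RInt_fct_extend_fst f a b l H) as H1.
  pose proof (is_RInt_fct_extend_snd f a b l H) as H2.
  apply (is_RInt_fct_extend_pair (U := R_NormedModule) (V := R_NormedModule)).
  - exact (is_RInt_minus _ _ a b _ _ (is_RInt_scal _ a b (fst c) _ H1)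
             (is_RInt_scal _ a b (snd c) _ H2)).
  - exact (is_RInt_plus _ _ a b _ _ (is_RInt_scal _ a b (fst c) _ H2)
             (is_RInt_scal _ a b (snd c) _ H1)).
Qed.

Lemma isI_ext (f g : R -> C) (a b : R) (l : C) :
  a <= b -> (forall t, a <= t <= b -> f t = g t) -> isI f a b l -> isI g a b l.
Proof.
  intros Hab H. apply is_RInt_ext. intros t. rewrite Rmin_left, Rmax_right by assumption.
  intros Ht. apply H. lra.
Qed.

Lemma isI_const (c : C) (a b : R) : isI (fun _ => c) a b (RtoC (b - a) * c)%C.
Proof.
  pose proof (is_RInt_const (V := C_R_NormedModule) a b c) as H.
  rewrite scal_R_Cmult in H. exact H.
Qed.

Lemma isI_Chasles (f : R -> C) (a b c : R) (l l' : C) :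
  isI f a b l -> isI f b c l' -> isI f a c (l + l')%C.
Proof. exact (is_RInt_Chasles f a b c l l'). Qed.

Lemma isI_bound (f : R -> C) (a b M : R) (l : C) :
  a <= b -> (forall t, a <= t <= b -> Cmod (f t) <= M) -> isI f a b l ->
  Cmod l <= (b - a) * M.
Proof.
  intros Hab H Hl. rewrite <- norm_C_R.
  apply (norm_RInt_le_const (V := C_R_NormedModule) f a b l M Hab); [|exact Hl].
  intros t Ht. rewrite norm_C_R. apply H, Ht.
Qed.

(* Boundary integral of F(x,y) d(x + i y) over the rectangle with lower left
   corner (x,y), width h and height k. *)
Definition isW (F : R -> R -> C) (x y h k : R) (w : C) : Prop :=
  exists p q, isI (fun t => F t y - F t (y + k)%R)%C x (x + h) p /\
    isI (fun t => F (x + h)%R t - F x t)%C y (y + k) q /\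
    w = (p + Ci * q)%C.

(* Complex differentiability of [F] at the point x + i y, in real coordinates. *)
Definition cdiff (F : R -> R -> C) (x y : R) : Prop :=
  exists D : C, forall eps, 0 < eps -> exists d, 0 < d /\ forall u v,
    Rabs (u - x) < d -> Rabs (v - y) < d ->
    Cmod (F u v - F x y - D * (RtoC (u - x) + Ci * RtoC (v - y)))%C
      <= eps * (Rabs (u - x) + Rabs (v - y)).

Lemma cdiff_cont (F : R -> R -> C) (x y : R) : cdiff F x y ->
  forall eps, 0 < eps -> exists d, 0 < d /\ forall u v,
    Rabs (u - x) < d -> Rabs (v - y) < d -> Cmod (F u v - F x y)%C <= eps.
Proof.
  intros [D HD] eps He.
  destruct (HD 1 Rlt_0_1) as [d [Hd H]].
  pose proof (Cmod_ge_0 D) as HD0.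
  assert (Hp : 0 < eps / (2 * (1 + Cmod D))) by (apply Rdiv_lt_0_compat; lra).
  exists (Rmin d (eps / (2 * (1 + Cmod D)))). split; [apply Rmin_pos; lra|].
  intros u v Hu Hv.
  destruct (Rlt_Rmin _ _ _ Hu) as [Hu1 Hu2]. destruct (Rlt_Rmin _ _ _ Hv) as [Hv1 Hv2].
  specialize (H u v Hu1 Hv1).
  assert (Hb : Cmod (RtoC (u - x) + Ci * RtoC (v - y))%C <= Rabs (u - x) + Rabs (v - y)).
  { eapply Rle_trans; [apply Cmod_triangle|]. rewrite Cmod_mult, Cmod_Ci, !Cmod_R. lra. }
  replace (F u v - F x y)%C with
    ((F u v - F x y - D * (RtoC (u - x) + Ci * RtoC (v - y)))
      + D * (RtoC (u - x) + Ci * RtoC (v - y)))%C by ring.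
  eapply Rle_trans; [apply Cmod_triangle|]. rewrite Cmod_mult.
  assert (Cmod D * Cmod (RtoC (u - x) + Ci * RtoC (v - y))%C <= Cmod D * (Rabs (u - x) + Rabs (v - y)))
    by (apply Rmult_le_compat_l; assumption).
  assert (Hs : (1 + Cmod D) * (Rabs (u - x) + Rabs (v - y)) <= eps).
  { apply Rle_trans with ((1 + Cmod D) * (eps / (2 * (1 + Cmod D)) + eps / (2 * (1 + Cmod D)))).
    - apply Rmult_le_compat_l; lra.
    - right. field. lra. }
  lra.
Qed.

Lemma cdiff_contR_l (F : R -> R -> C) (x y : R) : cdiff F x y -> contR (fun t => F t y) x.
Proof.
  intros H eps He. destruct (cdiff_cont F x y H eps He) as [d [Hd Hc]].
  exists d; split; [exact Hd|]. intros u Hu. apply Hc; [exact Hu|].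
  rewrite Rminus_diag, Rabs_R0; exact Hd.
Qed.

Lemma cdiff_contR_r (F : R -> R -> C) (x y : R) : cdiff F x y -> contR (F x) y.
Proof.
  intros H eps He. destruct (cdiff_cont F x y H eps He) as [d [Hd Hc]].
  exists d; split; [exact Hd|]. intros u Hu. apply Hc; [|exact Hu].
  rewrite Rminus_diag, Rabs_R0; exact Hd.
Qed.

Lemma contR_minus (f g : R -> C) (t : R) :
  contR f t -> contR g t -> contR (fun u => f u - g u)%C t.
Proof.
  intros Hf Hg eps He.
  destruct (Hf (eps / 2)) as [d [Hd H]]; [lra|].
  destruct (Hg (eps / 2)) as [d' [Hd' H']]; [lra|].
  exists (Rmin d d'); split; [apply Rmin_pos; assumption|].
  intros u Hu.
  replace (f u - g u - (f t - g t))%C with ((f u - f t) - (g u - g t))%C by ring.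
  eapply Rle_trans; [apply Cmod_triangle_minus|].
  assert (Cmod (f u - f t)%C <= eps / 2)
    by (apply H; eapply Rlt_le_trans; [exact Hu|apply Rmin_l]).
  assert (Cmod (g u - g t)%C <= eps / 2)
    by (apply H'; eapply Rlt_le_trans; [exact Hu|apply Rmin_r]).
  lra.
Qed.

Definition cdiff_on (F : R -> R -> C) (x y h k : R) : Prop :=
  forall u v, x <= u <= x + h -> y <= v <= y + k -> cdiff F u v.

Lemma isW_ex (F : R -> R -> C) (x y h k : R) :
  0 <= h -> 0 <= k -> cdiff_on F x y h k -> exists w, isW F x y h k w.
Proof.
  intros Hh Hk H.
  destruct (isI_ex (fun t => F t y - F t (y + k)%R)%C x (x + h)) as [p Hp]; [lra| |].
  { intros t Ht. apply contR_minus.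
    - apply (cdiff_contR_l F t y), H; lra.
    - apply (cdiff_contR_l F t (y + k)%R), H; lra. }
  destruct (isI_ex (fun t => F (x + h)%R t - F x t)%C y (y + k)) as [q Hq]; [lra| |].
  { intros t Ht. apply contR_minus.
    - apply (cdiff_contR_r F (x + h)%R t), H; lra.
    - apply (cdiff_contR_r F x t), H; lra. }
  exists (p + Ci * q)%C, p, q. auto.
Qed.

Lemma isW_unique (F : R -> R -> C) (x y h k : R) (w w' : C) :
  isW F x y h k w -> isW F x y h k w' -> w = w'.
Proof.
  intros [p [q [Hp [Hq ->]]]] [p' [q' [Hp' [Hq' ->]]]].
  rewrite (isI_unique _ _ _ _ _ Hp Hp'), (isI_unique _ _ _ _ _ Hq Hq'). reflexivity.
Qed.

Lemma isW_hsplit (F : R -> R -> C) (x y h h' k : R) (w w' : C) :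
  0 <= k ->
  isW F x y h k w -> isW F (x + h) y h' k w' -> isW F x y (h + h') k (w + w')%C.
Proof.
  intros Hk [p [q [Hp [Hq ->]]]] [p' [q' [Hp' [Hq' ->]]]].
  exists (p + p')%C, (q + q')%C. split; [|split].
  - rewrite <- Rplus_assoc. exact (isI_Chasles _ _ _ _ _ _ Hp Hp').
  - eapply isI_ext; [lra| |exact (isI_plus _ _ _ _ _ _ Hq Hq')].
    intros t _. simpl. rewrite <- Rplus_assoc. ring.
  - ring.
Qed.

Lemma isW_vsplit (F : R -> R -> C) (x y h k k' : R) (w w' : C) :
  0 <= h ->
  isW F x y h k w -> isW F x (y + k) h k' w' -> isW F x y h (k + k') (w + w')%C.
Proof.
  intros Hh [p [q [Hp [Hq ->]]]] [p' [q' [Hp' [Hq' ->]]]].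
  exists (p + p')%C, (q + q')%C. split; [|split].
  - eapply isI_ext; [lra| |exact (isI_plus _ _ _ _ _ _ Hp Hp')].
    intros t _. simpl. rewrite <- Rplus_assoc. ring.
  - rewrite <- Rplus_assoc. exact (isI_Chasles _ _ _ _ _ _ Hq Hq').
  - ring.
Qed.

(** The affine part of [F] has boundary integral 0, since its contributions from the two pairs of
    opposite sides cancel. Only the remainder counts, at most [2 * eta] on each pair. *)
Lemma isW_local (F : R -> R -> C) (a b x y h k eta : R) (w D : C) :
  0 <= h -> 0 <= k ->
  (forall u v, x <= u <= x + h -> y <= v <= y + k ->
     Cmod (F u v - F a b - D * (RtoC (u - a) + Ci * RtoC (v - b)))%C <= eta) ->
  isW F x y h k w -> Cmod w <= 2 * eta * (h + k).
Proof.
  intros Hh Hk H [p [q [Hp [Hq ->]]]].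
  set (A := fun u v => (F u v - F a b - D * (RtoC (u - a) + Ci * RtoC (v - b)))%C) in H.
  assert (B1 : Cmod (p + RtoC h * (D * Ci * RtoC k))%C <= h * (2 * eta)).
  { replace h with (x + h - x) at 2 by ring.
    apply (isI_bound (fun t => (F t y - F t (y + k)%R) + D * Ci * RtoC k)%C x (x + h) (2 * eta)); [lra| |].
    - intros t Ht.
      replace (F t y - F t (y + k)%R + D * Ci * RtoC k)%C with (A t y - A t (y + k)%R)%C.
      + eapply Rle_trans; [apply Cmod_triangle_minus|].
        assert (Cmod (A t y) <= eta) by (apply H; lra).
        assert (Cmod (A t (y + k)) <= eta) by (apply H; lra). lra.
      + unfold A. rewrite !RtoC_minus, RtoC_plus. ring.
    - replace (RtoC h) with (RtoC (x + h - x)) by (f_equal; ring).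
      apply isI_plus; [exact Hp|apply isI_const]. }
  assert (B2 : Cmod (q - RtoC k * (D * RtoC h))%C <= k * (2 * eta)).
  { replace k with (y + k - y) at 2 by ring.
    apply (isI_bound (fun t => (F (x + h)%R t - F x t) - D * RtoC h)%C y (y + k) (2 * eta)); [lra| |].
    - intros t Ht.
      replace (F (x + h)%R t - F x t - D * RtoC h)%C with (A (x + h)%R t - A x t)%C.
      + eapply Rle_trans; [apply Cmod_triangle_minus|].
        assert (Cmod (A (x + h) t) <= eta) by (apply H; lra).
        assert (Cmod (A x t) <= eta) by (apply H; lra). lra.
      + unfold A. rewrite !RtoC_minus, RtoC_plus. ring.
    - replace (RtoC k) with (RtoC (y + k - y)) by (f_equal; ring).
      apply isI_minus; [exact Hq|apply isI_const]. }
  replace (p + Ci * q)%C with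
    ((p + RtoC h * (D * Ci * RtoC k)) + Ci * (q - RtoC k * (D * RtoC h)))%C by ring.
  eapply Rle_trans; [apply Cmod_triangle|]. rewrite Cmod_mult, Cmod_Ci. lra.
Qed.

Definition badW (F : R -> R -> C) (eps h k : R) (c : R * R) : Prop :=
  exists w, isW F (fst c) (snd c) h k w /\ eps * (h * k) < Cmod w.

(** Boundary integrals add up over the four quarters, common sides cancelling; were every quarter
    below [eps] times its area, so would be the whole. *)
Lemma badW_quarter (F : R -> R -> C) (eps h k : R) (c : R * R) :
  0 < h -> 0 < k -> cdiff_on F (fst c) (snd c) h k -> badW F eps h k c ->
  exists c', badW F eps (h / 2) (k / 2) c' /\
    fst c <= fst c' <= fst c + h / 2 /\ snd c <= snd c' <= snd c + k / 2.
Proof.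
  destruct c as [x y]; unfold badW; simpl. intros Hh Hk Hc [w [Hw Hbig]].
  apply NNPP. intros Hn.
  assert (Hsub : forall x' y', x <= x' <= x + h / 2 -> y <= y' <= y + k / 2 ->
    exists w', isW F x' y' (h / 2) (k / 2) w' /\ Cmod w' <= eps * (h / 2 * (k / 2))).
  { intros x' y' Hx Hy.
    destruct (isW_ex F x' y' (h / 2) (k / 2)) as [w' Hw']; [lra|lra| |].
    - intros u v Hu Hv. apply Hc; lra.
    - exists w'. split; [exact Hw'|]. apply Rnot_lt_le. intros Hlt. apply Hn.
      exists (x', y'). simpl. split; [exists w'; auto|]. auto. }
  destruct (Hsub x y) as [w1 [H1 B1]]; [lra|lra|].
  destruct (Hsub (x + h / 2) y) as [w2 [H2 B2]]; [lra|lra|].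
  destruct (Hsub x (y + k / 2)) as [w3 [H3 B3]]; [lra|lra|].
  destruct (Hsub (x + h / 2) (y + k / 2)) as [w4 [H4 B4]]; [lra|lra|].
  assert (K2 : 0 <= k / 2) by lra.
  pose proof (isW_hsplit F x y (h / 2) (h / 2) (k / 2) w1 w2 K2 H1 H2) as H12.
  pose proof (isW_hsplit F x (y + k / 2) (h / 2) (h / 2) (k / 2) w3 w4 K2 H3 H4) as H34.
  replace (h / 2 + h / 2) with h in * by field.
  assert (H0 : 0 <= h) by lra.
  pose proof (isW_vsplit F x y h (k / 2) (k / 2) _ _ H0 H12 H34) as H1234.
  replace (k / 2 + k / 2) with k in * by field.
  rewrite (isW_unique _ _ _ _ _ _ _ Hw H1234) in Hbig.
  pose proof (Cmod_triangle (w1 + w2)%C (w3 + w4)%C).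
  pose proof (Cmod_triangle w1 w2). pose proof (Cmod_triangle w3 w4).
  lra.
Qed.

Lemma half_pow_pos (h : R) (n : nat) : 0 < h -> 0 < h / 2 ^ n.
Proof. intros H. apply Rdiv_lt_0_compat; [exact H|apply pow_lt; lra]. Qed.

Lemma half_pow_S (h : R) (n : nat) : h / 2 ^ S n = h / 2 ^ n / 2.
Proof. simpl. field. apply pow_nonzero. lra. Qed.

Lemma half_pow_small (h d : R) : 0 < d -> exists n, h / 2 ^ n < d.
Proof.
  intros Hd. destruct (pow_lt_1_zero (/ 2)) with (y := d / (Rabs h + 1)) as [N HN].
  - rewrite Rabs_pos_eq; lra.
  - pose proof (Rabs_pos h). apply Rdiv_lt_0_compat; lra.
  - exists N. specialize (HN N (Nat.le_refl N)).
    rewrite pow_inv, Rabs_pos_eq in HN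
      by (left; apply Rinv_0_lt_compat, pow_lt; lra).
    pose proof (Rabs_pos h). pose proof (Rle_abs h).
    assert (0 < / 2 ^ N) by (apply Rinv_0_lt_compat, pow_lt; lra).
    apply Rle_lt_trans with ((Rabs h + 1) * / 2 ^ N).
    + unfold Rdiv. apply Rmult_le_compat_r; lra.
    + apply Rmult_lt_reg_l with (/ (Rabs h + 1)); [apply Rinv_0_lt_compat; lra|].
      rewrite <- Rmult_assoc, Rinv_l, Rmult_1_l by lra. unfold Rdiv in HN. lra.
Qed.

(** Left ends increase and right ends decrease, so the supremum of the left ends lies in every
    interval. *)
Lemma nested_limit (x : nat -> R) (h : R) :
  (forall n, x n <= x (S n) <= x n + h / 2 ^ n / 2) -> 0 < h ->
  exists l, forall n, x n <= l <= x n + h / 2 ^ n.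
Proof.
  intros Hx Hh.
  assert (Hinc : forall n p, x n <= x (n + p)%nat).
  { intros n p. induction p as [|p IH].
    - rewrite Nat.add_0_r. lra.
    - rewrite Nat.add_succ_r. specialize (Hx (n + p)%nat). lra. }
  assert (Hdec : forall n p, x (n + p)%nat + h / 2 ^ (n + p) <= x n + h / 2 ^ n).
  { intros n p. induction p as [|p IH].
    - rewrite Nat.add_0_r. lra.
    - rewrite Nat.add_succ_r, half_pow_S. specialize (Hx (n + p)%nat). lra. }
  assert (Hub : forall n p, x p <= x n + h / 2 ^ n).
  { intros n p. destruct (Nat.le_ge_cases n p) as [L|L].
    - replace p with (n + (p - n))%nat by lia.
      pose proof (Hdec n (p - n)%nat). pose proof (half_pow_pos h (n + (p - n)) Hh). lra.
    - pose proof (Hinc p (n - p)%nat). replace (p + (n - p))%nat with n in H by lia.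
      pose proof (half_pow_pos h n Hh). lra. }
  destruct (completeness (fun y => exists n, y = x n)) as [l [Hl1 Hl2]].
  - exists (x O + h / 2 ^ 0). intros y [n ->]. apply Hub.
  - exists (x O). exists O. reflexivity.
  - exists l. intros n. split.
    + apply Hl1. exists n. reflexivity.
    + apply Hl2. intros y [p ->]. apply Hub.
Qed.

(** Bad rectangles can be quartered for ever and shrink to a point. Differentiability there makes
    the boundary integral small compared with the square of the side lengths, that is, compared with
    the area, as the shape is preserved. *)
Lemma goursat_small (F : R -> R -> C) (x y h k eps : R) :
  0 < h -> 0 < k -> 0 < eps -> cdiff_on F x y h k -> ~ badW F eps h k (x, y).
Proof.
  intros Hh Hk He Hd Hbad.
  set (inv := fun (n : nat) (c : R * R) =>
    badW F eps (h / 2 ^ n) (k / 2 ^ n) c /\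
    x <= fst c /\ fst c + h / 2 ^ n <= x + h /\ y <= snd c /\ snd c + k / 2 ^ n <= y + k).
  set (step := fun (n : nat) (c c' : R * R) => inv (S n) c' /\
    fst c <= fst c' <= fst c + h / 2 ^ n / 2 /\ snd c <= snd c' <= snd c + k / 2 ^ n / 2).
  assert (Hstep : forall n c, inv n c -> exists c', step n c c').
  { intros n c [Hb [B1 [B2 [B3 B4]]]].
    pose proof (half_pow_pos h n Hh). pose proof (half_pow_pos k n Hk).
    destruct (badW_quarter F eps (h / 2 ^ n) (k / 2 ^ n) c) as [c' [Hb' [Hx Hy]]]; auto.
    - intros u v Hu Hv. apply Hd; lra.
    - exists c'. unfold step, inv. rewrite !half_pow_S. repeat split; try lra. exact Hb'. }
  (* The pair (0, 0) merely witnesses that the type is inhabited; a genuine successor exists as long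
     as the invariant holds. *)
  set (next := fun n c => epsilon (inhabits (0, 0)) (step n c)).
  set (s := fix s n := match n with O => (x, y) | S n => next n (s n) end).
  assert (Hinv : forall n, inv n (s n) /\ step n (s n) (s (S n))).
  { assert (Hn : forall n, inv n (s n) -> step n (s n) (s (S n))).
    { intros n Hi. apply epsilon_spec, Hstep, Hi. }
    induction n as [|n [IH1 IH2]].
    - assert (inv 0%nat (s 0%nat)).
      { unfold inv. simpl. rewrite !Rdiv_1_r. repeat split; try lra. exact Hbad. }
      auto.
    - destruct IH2 as [IH2 _]. auto. }
  destruct (nested_limit (fun n => fst (s n)) h) as [a Ha]; [|exact Hh|].
  { intros n. apply (Hinv n). }
  destruct (nested_limit (fun n => snd (s n)) k) as [b Hb]; [|exact Hk|].
  { intros n. apply (Hinv n). }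
  destruct (Hd a b) as [D HD].
  { specialize (Ha O). simpl in Ha. rewrite Rdiv_1_r in Ha. lra. }
  { specialize (Hb O). simpl in Hb. rewrite Rdiv_1_r in Hb. lra. }
  (* Chosen so that 2 e' (h + k)^2 = eps h k. Both sides scale by 4^-n, so the equality persists at
     every stage. *)
  set (e' := eps * (h * k) / (2 * (h + k) * (h + k))).
  assert (He' : 0 < e').
  { unfold e'. apply Rdiv_lt_0_compat; repeat apply Rmult_lt_0_compat; lra. }
  destruct (HD e' He') as [d [Hd0 Hloc]].
  destruct (half_pow_small (h + k) d Hd0) as [n Hn].
  destruct (Hinv n) as [[[w [Hw Hbig]] _] _].
  specialize (Ha n). specialize (Hb n). simpl in Ha, Hb.
  pose proof (half_pow_pos h n Hh) as Ph. pose proof (half_pow_pos k n Hk) as Pk.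
  assert (Hsum : (h + k) / 2 ^ n = h / 2 ^ n + k / 2 ^ n)
    by (field; apply pow_nonzero; lra).
  assert (Hw2 : Cmod w <= 2 * (e' * (h / 2 ^ n + k / 2 ^ n)) * (h / 2 ^ n + k / 2 ^ n)).
  { apply (isW_local F a b (fst (s n)) (snd (s n)) (h / 2 ^ n) (k / 2 ^ n) _ w D); [lra|lra| |exact Hw].
    intros u v Hu Hv.
    assert (Rabs (u - a) <= h / 2 ^ n) by (apply Rabs_le; lra).
    assert (Rabs (v - b) <= k / 2 ^ n) by (apply Rabs_le; lra).
    eapply Rle_trans; [apply Hloc; lra|]. apply Rmult_le_compat_l; lra. }
  assert (Heq : 2 * (e' * (h / 2 ^ n + k / 2 ^ n)) * (h / 2 ^ n + k / 2 ^ n)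
    = eps * (h / 2 ^ n * (k / 2 ^ n))).
  { unfold e'. field. split; [apply pow_nonzero; lra|lra]. }
  lra.
Qed.

Theorem goursat (F : R -> R -> C) (x y h k : R) :
  0 < h -> 0 < k -> cdiff_on F x y h k -> isW F x y h k 0%C.
Proof.
  intros Hh Hk Hd.
  destruct (isW_ex F x y h k) as [w Hw]; [lra|lra|exact Hd|].
  destruct (Req_dec (Cmod w) 0) as [E|E].
  - apply Cmod_eq_0 in E. rewrite <- E. exact Hw.
  - exfalso. pose proof (Cmod_ge_0 w).
    assert (0 < h * k) by (apply Rmult_lt_0_compat; assumption).
    apply (goursat_small F x y h k (Cmod w / (2 * (h * k)))); auto.
    + apply Rdiv_lt_0_compat; lra.
    + exists w. split; [exact Hw|]. simpl.
      replace (Cmod w / (2 * (h * k)) * (h * k)) with (Cmod w / 2) by (field; lra). lra.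
Qed.

(** * Complex derivatives and polar coordinates *)

(** The epsilon-delta form is a bridge between two normed structures on C: [C_NormedModule], which
    [holD] uses, and [AbsRing_NormedModule C_AbsRing], in which the product rule and the inner
    function of the chain rule are stated. *)
Definition Cder (f : C -> C) (z l : C) : Prop :=
  forall eps, 0 < eps -> exists d, 0 < d /\ forall y, Cmod (y - z)%C < d ->
    Cmod (f y - f z - l * (y - z))%C <= eps * Cmod (y - z)%C.

Definition Ccont (f : C -> C) (z : C) : Prop :=
  forall eps, 0 < eps -> exists d, 0 < d /\ forall y, Cmod (y - z)%C < d ->
    Cmod (f y - f z)%C <= eps.

Lemma Cder_is_derive (f : C -> C) (z l : C) :
  Cder f z l <-> is_derive (K := C_AbsRing) (V := C_NormedModule) f z l.
Proof.
  split.
  - intros H. split; [apply is_linear_scal_l|].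
    intros x Hx. pose proof (is_filter_lim_locally_unique (V := AbsRing_NormedModule C_AbsRing) z x Hx) as E.
    subst x.
    intros eps. destruct (H (pos eps) (cond_pos eps)) as [d [Hd Hy]].
    exists (mkposreal d Hd). intros y Hb.
    assert (Hm : Cmod (y - z)%C < d) by exact Hb.
    specialize (Hy y Hm).
    change (Cmod (f y - f z - (y - z) * l)%C <= eps * Cmod (y - z)%C).
    rewrite (Cmult_comm _ l). exact Hy.
  - intros [_ H] eps He.
    destruct (H z (fun P HP => HP) (mkposreal eps He)) as [d Hd].
    exists (pos d). split; [apply cond_pos|]. intros y Hy.
    specialize (Hd y Hy). 
    change (Cmod (f y - f z - (y - z) * l)%C <= eps * Cmod (y - z)%C) in Hd.
    rewrite (Cmult_comm _ l) in Hd. exact Hd.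
Qed.

Lemma Cder_is_derive_absring (f : C -> C) (z l : C) :
  Cder f z l <-> is_derive (K := C_AbsRing) (V := AbsRing_NormedModule C_AbsRing) f z l.
Proof.
  split.
  - intros H. split; [exact (is_linear_scal_l (V := AbsRing_NormedModule C_AbsRing) l)|].
    intros x Hx. pose proof (is_filter_lim_locally_unique (V := AbsRing_NormedModule C_AbsRing) z x Hx) as E.
    subst x.
    intros eps. destruct (H (pos eps) (cond_pos eps)) as [d [Hd Hy]].
    exists (mkposreal d Hd). intros y Hb.
    assert (Hm : Cmod (y - z)%C < d) by exact Hb.
    specialize (Hy y Hm).
    change (Cmod (f y - f z - (y - z) * l)%C <= eps * Cmod (y - z)%C).
    rewrite (Cmult_comm _ l). exact Hy.
  - intros [_ H] eps He.
    destruct (H z (fun P HP => HP) (mkposreal eps He)) as [d Hd].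
    exists (pos d). split; [apply cond_pos|]. intros y Hy.
    specialize (Hd y Hy). 
    change (Cmod (f y - f z - (y - z) * l)%C <= eps * Cmod (y - z)%C) in Hd.
    rewrite (Cmult_comm _ l) in Hd. exact Hd.
Qed.

Lemma Cder_cont (f : C -> C) (z l : C) : Cder f z l -> Ccont f z.
Proof.
  intros H eps He. destruct (H 1 Rlt_0_1) as [d [Hd Hy]].
  pose proof (Cmod_ge_0 l) as Hl.
  assert (Hp : 0 < eps / (1 + Cmod l)) by (apply Rdiv_lt_0_compat; lra).
  exists (Rmin d (eps / (1 + Cmod l))). split; [apply Rmin_pos; assumption|].
  intros y Hm.
  destruct (Rlt_Rmin _ _ _ Hm) as [H1 H2].
  replace (f y - f z)%C with ((f y - f z - l * (y - z)) + l * (y - z))%C by ring.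
  eapply Rle_trans; [apply Cmod_triangle|]. rewrite Cmod_mult.
  specialize (Hy y H1).
  assert (H0 : (1 + Cmod l) * Cmod (y - z)%C <= (1 + Cmod l) * (eps / (1 + Cmod l)))
    by (apply Rmult_le_compat_l; lra).
  replace ((1 + Cmod l) * (eps / (1 + Cmod l))) with eps in H0 by (field; lra). lra.
Qed.

Lemma Cder_const (c z : C) : Cder (fun _ => c) z 0%C.
Proof.
  intros eps He. exists 1. split; [lra|]. intros y _.
  replace (c - c - 0 * (y - z))%C with (RtoC 0) by ring. rewrite Cmod_0.
  apply Rmult_le_pos; [lra|apply Cmod_ge_0].
Qed.

Lemma Cder_id (z : C) : Cder (fun y => y) z 1%C.
Proof.
  intros eps He. exists 1. split; [lra|]. intros y _.
  replace (y - z - 1 * (y - z))%C with (RtoC 0) by ring. rewrite Cmod_0.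
  apply Rmult_le_pos; [lra|apply Cmod_ge_0].
Qed.

Lemma Cder_plus (f g : C -> C) (z l l' : C) :
  Cder f z l -> Cder g z l' -> Cder (fun y => f y + g y)%C z (l + l')%C.
Proof.
  rewrite !Cder_is_derive. intros Hf Hg.
  exact (is_derive_plus (K := C_AbsRing) (V := C_NormedModule) f g z l l' Hf Hg).
Qed.

Lemma Cder_minus (f g : C -> C) (z l l' : C) :
  Cder f z l -> Cder g z l' -> Cder (fun y => f y - g y)%C z (l - l')%C.
Proof.
  rewrite !Cder_is_derive. intros Hf Hg.
  exact (is_derive_minus (K := C_AbsRing) (V := C_NormedModule) f g z l l' Hf Hg).
Qed.

Lemma Cder_comp (f g : C -> C) (z l l' : C) :
  Cder f (g z) l -> Cder g z l' -> Cder (fun y => f (g y)) z (l * l')%C.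
Proof.
  rewrite Cder_is_derive, (Cder_is_derive_absring g), Cder_is_derive.
  intros Hf Hg. rewrite Cmult_comm.
  exact (is_derive_comp (K := C_AbsRing) (V := C_NormedModule) f g z l l' Hf Hg).
Qed.

Lemma Cder_mult (f g : C -> C) (z l l' : C) :
  Cder f z l -> Cder g z l' -> Cder (fun y => f y * g y)%C z (l * g z + f z * l')%C.
Proof.
  rewrite !Cder_is_derive_absring. intros Hf Hg.
  exact (is_derive_mult (K := C_AbsRing) f g z l l' Hf Hg Cmult_comm).
Qed.

Lemma Cder_inv (z : C) : z <> 0%C -> Cder (fun y => / y)%C z (- / (z * z))%C.
Proof.
  intros Hz eps He.
  assert (Hm : 0 < Cmod z) by (apply Cmod_gt_0; exact Hz).
  set (K := Cmod z * Cmod z * Cmod z).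
  assert (HK : 0 < K) by (unfold K; repeat apply Rmult_lt_0_compat; assumption).
  exists (Rmin (Cmod z / 2) (eps * K / 2)). split.
  { apply Rmin_pos; [lra|]. assert (0 < eps * K) by (apply Rmult_lt_0_compat; assumption). lra. }
  intros y Hy.
  destruct (Rlt_Rmin _ _ _ Hy) as [H1 H2].
  assert (Hym : Cmod z / 2 <= Cmod y).
  { pose proof (Cmod_triangle_rev z y). rewrite (Cmod_minus_sym z y) in H. lra. }
  assert (Hy0 : y <> 0%C) by (apply Cmod_gt_0; lra).
  replace (/ y - / z - - / (z * z) * (y - z))%C with
    ((y - z) * ((y - z) * (/ y * (/ z * / z))))%C by (field; auto).
  rewrite !Cmod_mult, !Cmod_inv by assumption.
  rewrite Rmult_comm. apply Rmult_le_compat_r; [apply Cmod_ge_0|].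
  assert (Hi : / Cmod y <= 2 * / Cmod z).
  { replace (2 * / Cmod z) with (/ (Cmod z / 2)) by (field; lra).
    apply Rinv_le_contravar; lra. }
  assert (Hz2 : 0 < / Cmod z) by (apply Rinv_0_lt_compat; assumption).
  apply Rle_trans with (eps * K / 2 * (2 * / Cmod z * (/ Cmod z * / Cmod z))).
  - apply Rmult_le_compat.
    + apply Cmod_ge_0.
    + apply Rmult_le_pos; [left; apply Rinv_0_lt_compat; lra|nra].
    + lra.
    + apply Rmult_le_compat_r; [nra|exact Hi].
  - right. unfold K. field. lra.
Qed.

Lemma Cder_ext_loc (f g : C -> C) (z l : C) (e : R) :
  0 < e -> (forall y, Cmod (y - z)%C < e -> f y = g y) -> Cder f z l -> Cder g z l.
Proof.
  intros He H Hf eps Heps. destruct (Hf eps Heps) as [d' [Hd' Hy]].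
  exists (Rmin e d'). split; [apply Rmin_pos; assumption|]. intros y Hm.
  rewrite <- !H.
  - apply Hy. eapply Rlt_le_trans; [exact Hm|apply Rmin_r].
  - replace (z - z)%C with (RtoC 0) by ring. rewrite Cmod_0. exact He.
  - eapply Rlt_le_trans; [exact Hm|apply Rmin_l].
Qed.

Lemma Cder_div (f g : C -> C) (z l l' : C) :
  Cder f z l -> Cder g z l' -> g z <> 0%C ->
  exists l'', Cder (fun y => f y / g y)%C z l''.
Proof.
  intros Hf Hg Hz. eexists. unfold Cdiv.
  apply Cder_mult; [exact Hf|]. apply (Cder_comp (fun y => / y)%C g); [|exact Hg].
  apply Cder_inv, Hz.
Qed.

Lemma holD_Cder (f : C -> C) (z : C) : holD f -> inD z -> exists l, Cder f z l.
Proof. intros H Hz. destruct (H z Hz) as [l Hl]. exists l. apply Cder_is_derive, Hl. Qed.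

Lemma Cder_holD (f : C -> C) : (forall z, inD z -> exists l, Cder f z l) -> holD f.
Proof. intros H z Hz. destruct (H z Hz) as [l Hl]. exists l. apply Cder_is_derive, Hl. Qed.

(** * The exponential map in polar coordinates *)

Definition cis (t : R) : C := (cos t, sin t).

Lemma Cmod_cis (t : R) : Cmod (cis t) = 1.
Proof.
  unfold Cmod, cis; simpl. rewrite !Rmult_1_r.
  replace (cos t * cos t + sin t * sin t) with 1; [apply sqrt_1|].
  pose proof (sin2_cos2 t). unfold Rsqr in H. lra.
Qed.

Lemma cis_plus (s t : R) : cis (s + t) = (cis s * cis t)%C.
Proof. unfold cis, Cmult; simpl. rewrite cos_plus, sin_plus. f_equal; ring. Qed.

Lemma cis_0 : cis 0 = 1%C.
Proof. unfold cis. rewrite cos_0, sin_0. reflexivity. Qed.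

Lemma cis_2PI : cis (2 * PI) = 1%C.
Proof. unfold cis. rewrite cos_2PI, sin_2PI. reflexivity. Qed.

Lemma cis_neq_0 (t : R) : cis t <> 0%C.
Proof. apply Cmod_gt_0. rewrite Cmod_cis. lra. Qed.

Lemma cis_inv (t : R) : (/ cis t)%C = cis (- t).
Proof.
  assert (H : (cis t * cis (- t))%C = 1%C) by (rewrite <- cis_plus, Rplus_opp_r; apply cis_0).
  replace (cis (- t)) with (/ cis t * (cis t * cis (- t)))%C by (field; apply cis_neq_0).
  rewrite H. ring.
Qed.

Lemma cis_pow (t : R) (n : nat) : (cis t ^ n)%C = cis (INR n * t).
Proof.
  induction n as [|n IH].
  - simpl. rewrite Rmult_0_l, cis_0. reflexivity.
  - rewrite Cpow_S, IH, <- cis_plus. f_equal. rewrite S_INR. ring.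
Qed.

Lemma deriv0_approx (f : R -> R) (l : R) : derivable_pt_lim f 0 l ->
  forall eps, 0 < eps -> exists d, 0 < d /\ forall h, Rabs h < d ->
    Rabs (f h - f 0 - l * h) <= eps * Rabs h.
Proof.
  intros H eps He. destruct (H eps He) as [d Hd].
  exists (pos d). split; [apply cond_pos|]. intros h Hh.
  destruct (Req_dec h 0) as [->|Hn].
  - replace (f 0 - f 0 - l * 0) with 0 by ring. rewrite Rabs_R0. lra.
  - specialize (Hd h Hn Hh). rewrite Rplus_0_l in Hd.
    replace (f h - f 0 - l * h) with (((f h - f 0) / h - l) * h) by (field; exact Hn).
    rewrite Rabs_mult. apply Rmult_le_compat_r; [apply Rabs_pos|lra].
Qed.

Lemma expcis_approx : forall eps, 0 < eps -> exists d, 0 < d /\ forall a b,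
  Rabs a < d -> Rabs b < d ->
  Cmod (RtoC (exp a) * cis b - 1 - (RtoC a + Ci * RtoC b))%C <= eps * (Rabs a + Rabs b).
Proof.
  intros eps He.
  (* The real part contributes at most e|a| + 3e|b| and the imaginary part at most 5e|b|, together
     at most 8e(|a| + |b|). *)
  set (e := Rmin 1 (eps / 8)).
  assert (He1 : 0 < e) by (apply Rmin_pos; lra).
  assert (He2 : e <= 1) by apply Rmin_l.
  assert (He3 : 8 * e <= eps) by (pose proof (Rmin_r 1 (eps / 8)); fold e in H; lra).
  destruct (deriv0_approx exp 1) with (eps := e) as [d1 [Hd1 H1]]; [|exact He1|].
  { pose proof (derivable_pt_lim_exp 0) as H. rewrite exp_0 in H. exact H. }
  destruct (deriv0_approx cos 0) with (eps := e) as [d2 [Hd2 H2]]; [|exact He1|].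
  { pose proof (derivable_pt_lim_cos 0) as H. rewrite sin_0, Ropp_0 in H. exact H. }
  destruct (deriv0_approx sin 1) with (eps := e) as [d3 [Hd3 H3]]; [|exact He1|].
  { pose proof (derivable_pt_lim_sin 0) as H. rewrite cos_0 in H. exact H. }
  exists (Rmin e (Rmin d1 (Rmin d2 d3))).
  split; [apply Rmin_pos; [|apply Rmin_pos; [|apply Rmin_pos]]; assumption|].
  intros a b Ha Hb.
  pose proof (Rmin_l e (Rmin d1 (Rmin d2 d3))). pose proof (Rmin_r e (Rmin d1 (Rmin d2 d3))).
  pose proof (Rmin_l d1 (Rmin d2 d3)). pose proof (Rmin_r d1 (Rmin d2 d3)).
  pose proof (Rmin_l d2 d3). pose proof (Rmin_r d2 d3).
  assert (A1 : Rabs (exp a - exp 0 - 1 * a) <= e * Rabs a) by (apply H1; lra).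
  assert (A2 : Rabs (cos b - cos 0 - 0 * b) <= e * Rabs b) by (apply H2; lra).
  assert (A3 : Rabs (sin b - sin 0 - 1 * b) <= e * Rabs b) by (apply H3; lra).
  rewrite exp_0 in A1. rewrite cos_0 in A2. rewrite sin_0 in A3.
  eapply Rle_trans; [apply Cmod_le_abs|].
  unfold cis, Cminus, Cplus, Copp, Cmult, RtoC, Ci; simpl.
  pose proof (Rabs_pos a). pose proof (Rabs_pos b).
  assert (B0 : Rabs (exp a - 1) <= 2 * Rabs a).
  { replace (exp a - 1) with ((exp a - 1 - 1 * a) + a) by ring.
    eapply Rle_trans; [apply Rabs_triang|]. nra. }
  assert (Bs : Rabs (sin b) <= 2 * Rabs b).
  { replace (sin b) with ((sin b - 0 - 1 * b) + b) by ring.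
    eapply Rle_trans; [apply Rabs_triang|]. nra. }
  assert (B1 : Rabs (exp a * cos b - 0 * sin b + - (1) + - (a + (0 * b - 1 * 0))) <= e * Rabs a + 3 * (e * Rabs b)).
  { replace (exp a * cos b - 0 * sin b + - (1) + - (a + (0 * b - 1 * 0)))
      with ((exp a - 1 - 1 * a) + (1 + (exp a - 1)) * (cos b - 1 - 0 * b)) by ring.
    eapply Rle_trans; [apply Rabs_triang|]. apply Rplus_le_compat; [exact A1|].
    rewrite Rabs_mult.
    assert (Rabs (1 + (exp a - 1)) <= 3).
    { eapply Rle_trans; [apply Rabs_triang|]. rewrite Rabs_R1. lra. }
    apply Rle_trans with (3 * (e * Rabs b)); [|lra].
    apply Rmult_le_compat; try apply Rabs_pos; assumption. }
  assert (B2 : Rabs (exp a * sin b + 0 * cos b + - (0) + - (0 + (0 * 0 + 1 * b))) <= 4 * (e * Rabs b) + e * Rabs b).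
  { replace (exp a * sin b + 0 * cos b + - (0) + - (0 + (0 * 0 + 1 * b)))
      with ((exp a - 1) * sin b + (sin b - 0 - 1 * b)) by ring.
    eapply Rle_trans; [apply Rabs_triang|]. apply Rplus_le_compat; [|exact A3].
    rewrite Rabs_mult.
    apply Rle_trans with ((2 * e) * (2 * Rabs b)); [|lra].
    apply Rmult_le_compat; try apply Rabs_pos; [lra|exact Bs]. }
  assert (8 * e * (Rabs a + Rabs b) <= eps * (Rabs a + Rabs b))
    by (apply Rmult_le_compat_r; lra).
  nra.
Qed.

Definition polar (r t : R) : C := (RtoC r * cis t)%C.

Lemma Cmod_polar (r t : R) : 0 <= r -> Cmod (polar r t) = r.
Proof. intros Hr. unfold polar. rewrite Cmod_mult, Cmod_cis, Cmod_R, Rabs_pos_eq; lra. Qed.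

(** [polar (exp u) v] is exp(u + i v), so this is the chain rule for G composed with exp, the
    derivative being [l * z]. It turns annuli into rectangles, where Goursat's theorem applies. *)
Lemma cdiff_polar (G : C -> C) (l : C) (x y : R) :
  Cder G (polar (exp x) y) l -> cdiff (fun u v => G (polar (exp u) v)) x y.
Proof.
  intros HG. set (z := polar (exp x) y) in *.
  exists (l * z)%C. intros eps He.
  assert (Hz : 0 < Cmod z).
  { unfold z. pose proof (exp_pos x). rewrite Cmod_polar; lra. }
  pose proof (Cmod_ge_0 l) as Hl.
  destruct (HG (eps / (4 * Cmod z))) as [d1 [Hd1 H1]]; [apply Rdiv_lt_0_compat; lra|].
  set (e2 := Rmin 1 (eps / (2 * (Cmod l + 1) * Cmod z))).
  assert (He2 : 0 < e2).
  { apply Rmin_pos; [lra|]. apply Rdiv_lt_0_compat; [lra|]. apply Rmult_lt_0_compat; lra. }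
  assert (He2a : e2 <= 1) by apply Rmin_l.
  assert (He2b : e2 * ((Cmod l + 1) * Cmod z) <= eps / 2).
  { apply Rle_trans with (eps / (2 * (Cmod l + 1) * Cmod z) * ((Cmod l + 1) * Cmod z)).
    - apply Rmult_le_compat_r; [apply Rmult_le_pos; lra|apply Rmin_r].
    - right. field. lra. }
  destruct (expcis_approx e2 He2) as [d2 [Hd2 H2]].
  exists (Rmin d2 (d1 / (4 * Cmod z))). split.
  { apply Rmin_pos; [exact Hd2|]. apply Rdiv_lt_0_compat; lra. }
  intros u v Hu Hv.
  pose proof (Rmin_l d2 (d1 / (4 * Cmod z))) as M1. pose proof (Rmin_r d2 (d1 / (4 * Cmod z))) as M2.
  set (a := u - x) in *. set (b := v - y) in *.
  specialize (H2 a b ltac:(lra) ltac:(lra)).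
  assert (Hfac : polar (exp u) v = (z * (RtoC (exp a) * cis b))%C).
  { unfold z, polar. replace u with (x + a) by (unfold a; ring).
    replace v with (y + b) at 1 by (unfold b; ring).
    rewrite exp_plus, cis_plus, RtoC_mult. ring. }
  set (q := (RtoC a + Ci * RtoC b)%C) in *.
  set (rm := (RtoC (exp a) * cis b - 1 - q)%C) in *.
  assert (Hq : Cmod q <= Rabs a + Rabs b).
  { unfold q. eapply Rle_trans; [apply Cmod_triangle|]. rewrite Cmod_mult, Cmod_Ci, !Cmod_R. lra. }
  assert (Hdz : (polar (exp u) v - z)%C = (z * (rm + q))%C) by (rewrite Hfac; unfold rm; ring).
  pose proof (Rabs_pos a) as Pa. pose proof (Rabs_pos b) as Pb.
  assert (Hn : Cmod (polar (exp u) v - z)%C <= Cmod z * (2 * (Rabs a + Rabs b))).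
  { rewrite Hdz, Cmod_mult. apply Rmult_le_compat_l; [lra|].
    eapply Rle_trans; [apply Cmod_triangle|].
    assert (e2 * (Rabs a + Rabs b) <= 1 * (Rabs a + Rabs b)) by (apply Rmult_le_compat_r; lra). lra. }
  assert (Hd : Cmod (polar (exp u) v - z)%C < d1).
  { eapply Rle_lt_trans; [exact Hn|].
    assert (Cmod z * (2 * (Rabs a + Rabs b)) < Cmod z * (2 * (d1 / (4 * Cmod z) + d1 / (4 * Cmod z))))
      by (apply Rmult_lt_compat_l; lra).
    replace (Cmod z * (2 * (d1 / (4 * Cmod z) + d1 / (4 * Cmod z)))) with d1 in H by (field; lra). exact H. }
  specialize (H1 _ Hd).
  match goal with |- Cmod ?X <= _ => replace X with
    ((G (polar (exp u) v) - G z - l * (polar (exp u) v - z)) + l * z * rm)%C end.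
  2: { rewrite Hdz. unfold z, q. ring. }
  eapply Rle_trans; [apply Cmod_triangle|]. rewrite !Cmod_mult.
  assert (T1 : eps / (4 * Cmod z) * Cmod (polar (exp u) v - z)%C <= eps / 2 * (Rabs a + Rabs b)).
  { apply Rle_trans with (eps / (4 * Cmod z) * (Cmod z * (2 * (Rabs a + Rabs b)))).
    - apply Rmult_le_compat_l; [left; apply Rdiv_lt_0_compat; lra|exact Hn].
    - right. field. lra. }
  assert (T2 : Cmod l * Cmod z * Cmod rm <= eps / 2 * (Rabs a + Rabs b)).
  { apply Rle_trans with ((Cmod l + 1) * Cmod z * (e2 * (Rabs a + Rabs b))).
    - apply Rmult_le_compat; [apply Rmult_le_pos; lra|apply Cmod_ge_0| |exact H2].
      apply Rmult_le_compat_r; lra.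
    - replace ((Cmod l + 1) * Cmod z * (e2 * (Rabs a + Rabs b))) with
        (e2 * ((Cmod l + 1) * Cmod z) * (Rabs a + Rabs b)) by ring.
      apply Rmult_le_compat_r; lra. }
  lra.
Qed.

(** * Integrals over circles *)

(** The integral is taken in the angle: it is the contour integral of G(z) / (i z) dz, hence
    independent of the radius across an annulus of holomorphy. *)
Definition circ (G : C -> C) (r : R) (l : C) : Prop :=
  isI (fun t => G (polar r t)) 0 (2 * PI) l.

Lemma two_PI_pos : 0 < 2 * PI.
Proof. pose proof PI_RGT_0. lra. Qed.

Lemma polar_lip (r s t u : R) : 0 <= r ->
  Cmod (polar r u - polar s t)%C <= r * (2 * Rabs (u - t)) + Rabs (r - s).
Proof.
  intros Hr. unfold polar.
  replace (RtoC r * cis u - RtoC s * cis t)%C with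
    (RtoC r * (cis u - cis t) + RtoC (r - s) * cis t)%C by (rewrite RtoC_minus; ring).
  eapply Rle_trans; [apply Cmod_triangle|].
  rewrite !Cmod_mult, Cmod_cis, !Cmod_R, (Rabs_pos_eq r Hr), Rmult_1_r.
  apply Rplus_le_compat_r, Rmult_le_compat_l; [exact Hr|].
  eapply Rle_trans; [apply Cmod_le_abs|]. simpl.
  assert (Hlip : forall f f' : R -> R, (forall x, derivable_pt_lim f x (f' x)) ->
    (forall x, Rabs (f' x) <= 1) -> Rabs (f u - f t) <= Rabs (u - t)).
  { intros f f' Hd Hb.
    destruct (MVT_gen f t u f') as [c [_ Hc]].
    - intros x _. apply is_derive_Reals, Hd.
    - intros x _. apply derivable_continuous_pt. exists (f' x). apply Hd.
    - rewrite Hc, Rabs_mult. rewrite <- (Rmult_1_l (Rabs (u - t))) at 2.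
      apply Rmult_le_compat_r; [apply Rabs_pos|apply Hb]. }
  pose proof (Hlip cos (fun x => - sin x) derivable_pt_lim_cos) as H1.
  pose proof (Hlip sin cos derivable_pt_lim_sin) as H2.
  assert (Rabs (cos u - cos t) <= Rabs (u - t)).
  { apply H1. intros x. rewrite Rabs_Ropp. apply Rabs_le. apply SIN_bound. }
  assert (Rabs (sin u - sin t) <= Rabs (u - t)).
  { apply H2. intros x. apply Rabs_le. apply COS_bound. }
  unfold Rminus in *. lra.
Qed.

Lemma contR_polar (G : C -> C) (r t : R) : 0 <= r ->
  Ccont G (polar r t) -> contR (fun u => G (polar r u)) t.
Proof.
  intros Hr H eps He. destruct (H eps He) as [d [Hd Hy]].
  exists (d / (2 * r + 1)). split; [apply Rdiv_lt_0_compat; lra|].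
  intros u Hu. apply Hy. eapply Rle_lt_trans; [apply polar_lip, Hr|].
  rewrite Rminus_diag, Rabs_R0.
  assert ((2 * r + 1) * Rabs (u - t) < (2 * r + 1) * (d / (2 * r + 1)))
    by (apply Rmult_lt_compat_l; lra).
  replace ((2 * r + 1) * (d / (2 * r + 1))) with d in H0 by (field; lra).
  pose proof (Rabs_pos (u - t)). lra.
Qed.

Lemma circ_ex (G : C -> C) (r : R) : 0 <= r ->
  (forall z, Cmod z = r -> Ccont G z) -> exists l, circ G r l.
Proof.
  intros Hr H. pose proof two_PI_pos. apply isI_ex; [lra|].
  intros t _. apply contR_polar; [exact Hr|]. apply H, Cmod_polar, Hr.
Qed.

Lemma circ_0 (G : C -> C) : circ G 0 (RtoC (2 * PI) * G 0)%C.
Proof.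
  pose proof two_PI_pos as Hp. unfold circ.
  replace (RtoC (2 * PI)) with (RtoC (2 * PI - 0)) by (f_equal; ring).
  apply (isI_ext (fun _ => G 0%C)); [lra| |apply isI_const].
  intros t _. unfold polar. rewrite Cmult_0_l. reflexivity.
Qed.

(** Continuity at each point of the circle gives a radius valid near one angle; compactness of
    [0, 2 pi] supplies a common one. *)
Lemma circ_uniform (G : C -> C) (r0 eps : R) : 0 <= r0 -> 0 < eps ->
  (forall z, Cmod z = r0 -> Ccont G z) ->
  exists d, 0 < d /\ forall r t, 0 <= r -> Rabs (r - r0) < d -> 0 <= t <= 2 * PI ->
    Cmod (G (polar r t) - G (polar r0 t))%C <= eps.
Proof.
  intros Hr0 He H.
  assert (Hloc : forall t, exists d : posreal, forall r u, 0 <= r -> Rabs (r - r0) < d ->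
    Rabs (u - t) < d -> Cmod (G (polar r u) - G (polar r0 t))%C <= eps / 2).
  { intros t. destruct (H (polar r0 t) (Cmod_polar r0 t Hr0) (eps / 2)) as [d [Hd Hy]]; [lra|].
    assert (Hp : 0 < Rmin 1 (d / (2 * (r0 + 1) + 1))).
    { apply Rmin_pos; [lra|]. apply Rdiv_lt_0_compat; lra. }
    exists (mkposreal _ Hp). simpl. intros r u Hr Hd1 Hd2. apply Hy.
    eapply Rle_lt_trans; [apply polar_lip, Hr|].
    pose proof (Rmin_l 1 (d / (2 * (r0 + 1) + 1))) as M1.
    pose proof (Rmin_r 1 (d / (2 * (r0 + 1) + 1))) as M2.
    set (e := d / (2 * (r0 + 1) + 1)) in *.
    assert (Hde : d = (2 * (r0 + 1) + 1) * e) by (unfold e; field; lra).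
    assert (r <= r0 + 1) by (apply Rabs_def2 in Hd1; lra).
    pose proof (Rabs_pos (u - t)).
    assert (r * (2 * Rabs (u - t)) <= (r0 + 1) * (2 * e)) by (apply Rmult_le_compat; lra).
    lra. }
  set (delta := fun t => proj1_sig (constructive_indefinite_description _ (Hloc t))).
  destruct (compactness_value_1d 0 (2 * PI) delta) as [d Hd].
  exists (pos d). split; [apply cond_pos|]. intros r t Hr Hrd Ht.
  specialize (Hd t Ht). apply NNPP in Hd. destruct Hd as [s [Hs [Hts Hds]]].
  revert Hts Hds. unfold delta. destruct (constructive_indefinite_description _ (Hloc s)) as [e He'].
  simpl. intros Hts Hds.
  pose proof (He' r t Hr (Rlt_le_trans _ _ _ Hrd Hds) Hts) as A1.
  assert (Z : Rabs (r0 - r0) < e) by (rewrite Rminus_diag, Rabs_R0; apply cond_pos).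
  pose proof (He' r0 t Hr0 Z Hts) as A2.
  replace (G (polar r t) - G (polar r0 t))%C with
    ((G (polar r t) - G (polar r0 s)) - (G (polar r0 t) - G (polar r0 s)))%C by ring.
  eapply Rle_trans; [apply Cmod_triangle_minus|]. lra.
Qed.

(** In the coordinates u = ln r and v = angle the annulus is a rectangle of height 2 pi. Its
    horizontal sides cancel by periodicity and its vertical sides carry the two circle integrals. *)
Lemma circ_annulus (G : C -> C) (r1 r2 : R) (l1 l2 : C) : 0 < r1 -> r1 < r2 ->
  (forall z, r1 <= Cmod z <= r2 -> exists l, Cder G z l) ->
  circ G r1 l1 -> circ G r2 l2 -> l1 = l2.
Proof.
  intros H1 H2 H C1 C2. pose proof two_PI_pos as Hpi.
  assert (Hln : ln r1 < ln r2) by (apply ln_increasing; assumption).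
  set (F := fun u v => G (polar (exp u) v)).
  destruct (goursat F (ln r1) 0 (ln r2 - ln r1) (2 * PI)) as [p [q [Hp [Hq E]]]]; [lra|exact Hpi| |].
  - intros u v Hu Hv.
    assert (Hb : r1 <= exp u <= r2).
    { split.
      - rewrite <- (exp_ln r1) by lra. destruct (Rle_lt_or_eq_dec (ln r1) u); [lra| |].
        + left. apply exp_increasing. lra.
        + subst. lra.
      - rewrite <- (exp_ln r2) by lra. destruct (Rle_lt_or_eq_dec u (ln r2)); [lra| |].
        + left. apply exp_increasing. lra.
        + subst. lra. }
    destruct (H (polar (exp u) v)) as [l Hl].
    { rewrite Cmod_polar; lra. }
    apply (cdiff_polar G l u v Hl).
  - assert (Ep : p = 0%C).
    { apply (isI_unique _ _ _ _ _ Hp).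
      replace (RtoC 0) with (RtoC (ln r1 + (ln r2 - ln r1) - ln r1) * 0)%C by ring.
      apply (isI_ext (fun _ => 0%C)); [lra| |apply isI_const].
      intros t _. unfold F, polar. rewrite Rplus_0_l, cis_0, cis_2PI. ring. }
    assert (Eq : q = (l2 - l1)%C).
    { apply (isI_unique _ _ _ _ _ Hq).
      apply (isI_ext (fun t => G (polar r2 t) - G (polar r1 t))%C); [lra| |].
      - intros t _. unfold F. replace (ln r1 + (ln r2 - ln r1)) with (ln r2) by ring.
        rewrite !exp_ln by lra. reflexivity.
      - rewrite Rplus_0_l. apply isI_minus; assumption. }
    rewrite Ep, Eq in E.
    assert (E' : (Ci * (Ci * (l2 - l1)))%C = 0%C).
    { replace (Ci * (l2 - l1))%C with (0 + Ci * (l2 - l1))%C by ring. rewrite <- E. ring. }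
    assert (Hii : (Ci * Ci)%C = (- (1))%C) by (unfold Ci, Cmult, Copp; simpl; f_equal; ring).
    replace l1 with (l2 + Ci * Ci * (l2 - l1))%C by (rewrite Hii; ring).
    replace (Ci * Ci * (l2 - l1))%C with (Ci * (Ci * (l2 - l1)))%C by ring.
    rewrite E'. ring.
Qed.

Lemma circ_close (G : C -> C) (r s eps : R) (l l' : C) :
  (forall t, 0 <= t <= 2 * PI -> Cmod (G (polar r t) - G (polar s t))%C <= eps) ->
  circ G r l -> circ G s l' -> Cmod (l - l')%C <= 2 * PI * eps.
Proof.
  intros H Hl Hl'. pose proof two_PI_pos.
  replace (2 * PI) with (2 * PI - 0) by ring.
  apply (isI_bound (fun t => G (polar r t) - G (polar s t))%C 0 (2 * PI)); [lra|exact H|].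
  apply isI_minus; assumption.
Qed.

Lemma Cmod_small_eq (x y : C) (K : R) :
  0 < K -> (forall eps, 0 < eps -> Cmod (x - y)%C <= K * eps) -> x = y.
Proof.
  intros HK H. apply Ceq_minus. apply Cmod_eq_0. apply Rle_antisym; [|apply Cmod_ge_0].
  apply Rnot_lt_le. intros Hlt.
  specialize (H (Cmod (x - y)%C / (2 * K)) ltac:(apply Rdiv_lt_0_compat; lra)).
  replace (K * (Cmod (x - y)%C / (2 * K))) with (Cmod (x - y)%C / 2) in H by (field; lra). lra.
Qed.

(* [s] is a boundary radius, at which the function is only continuous *)
Lemma circ_boundary (G : C -> C) (r s : R) (l l' : C) :
  0 < r -> 0 <= s -> r <> s ->
  (forall z, Cmod z = s -> Ccont G z) ->
  (forall z, Cmod z <> s -> Rmin r s <= Cmod z <= Rmax r s -> exists l, Cder G z l) ->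
  circ G r l -> circ G s l' -> l = l'.
Proof.
  intros Hr Hs Hrs Hc Hd Hl Hl'. pose proof two_PI_pos as Hpi.
  apply (Cmod_small_eq _ _ (2 * PI)); [exact Hpi|]. intros eps He.
  destruct (circ_uniform G s eps Hs He Hc) as [d [Hd0 Hu]].
  assert (Hex : exists r', 0 < r' /\ Rabs (r' - s) < d /\ r' <> s /\ r' <> r /\
    ((s < r' < r) \/ (r < r' < s))).
  { destruct (Rlt_or_le s r) as [L|L].
    - exists (s + Rmin (d / 2) ((r - s) / 2)).
      pose proof (Rmin_l (d / 2) ((r - s) / 2)). pose proof (Rmin_r (d / 2) ((r - s) / 2)).
      assert (0 < Rmin (d / 2) ((r - s) / 2)) by (apply Rmin_pos; lra).
      repeat split; try lra. rewrite Rabs_pos_eq; lra.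
    - exists (s - Rmin (d / 2) ((s - r) / 2)).
      pose proof (Rmin_l (d / 2) ((s - r) / 2)). pose proof (Rmin_r (d / 2) ((s - r) / 2)).
      assert (0 < Rmin (d / 2) ((s - r) / 2)) by (apply Rmin_pos; lra).
      repeat split; try lra. rewrite Rabs_left1; lra. }
  destruct Hex as [r' [P1 [P2 [P3 [P4 P5]]]]].
  assert (Hin : forall z, Rmin r r' <= Cmod z <= Rmax r r' -> exists l, Cder G z l).
  { intros z. destruct P5 as [P5|P5].
    - rewrite Rmin_right, Rmax_left by lra. intros Hz. apply Hd; [lra|].
      rewrite Rmin_right, Rmax_left; lra.
    - rewrite Rmin_left, Rmax_right by lra. intros Hz. apply Hd; [lra|].
      rewrite Rmin_left, Rmax_right; lra. }
  destruct (circ_ex G r') as [l'' Hl'']; [lra| |].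
  { intros z Hz. destruct (Hin z) as [dz Hdz].
    - rewrite Hz. split; [apply Rmin_r|apply Rmax_r].
    - apply (Cder_cont G z dz Hdz). }
  assert (E : l = l'').
  { destruct P5 as [P5|P5].
    - symmetry. apply (circ_annulus G r' r); auto; try lra.
      intros z Hz. apply Hin. rewrite Rmin_right, Rmax_left; lra.
    - apply (circ_annulus G r r'); auto; try lra.
      intros z Hz. apply Hin. rewrite Rmin_left, Rmax_right; lra. }
  rewrite E. apply (circ_close G r' s eps); auto.
  intros t Ht. apply Hu; auto; lra.
Qed.

(* [s] is the radius of a circle carrying the removable singularity of a difference quotient *)
Lemma circ_mean (G : C -> C) (r s : R) (l : C) :
  0 < r < 1 -> 0 <= s < 1 ->
  (forall z, inD z -> Ccont G z) ->
  (forall z, inD z -> Cmod z <> s -> z <> 0%C -> exists l, Cder G z l) ->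
  circ G r l -> l = (RtoC (2 * PI) * G 0)%C.
Proof.
  intros Hr Hs Hc Hd Hl. unfold inD in *.
  (* Below the singular radius [s] the circle shrinks to the centre; the circle of radius [s] itself
     is reached by continuity, from inside and then from outside. *)
  assert (Hsmall : forall r l, 0 < r -> r < s -> circ G r l -> l = (RtoC (2 * PI) * G 0)%C).
  { intros r' l' H1 H2 H3. apply (circ_boundary G r' 0); auto; try lra.
    - intros z Hz. apply Hc. lra.
    - intros z Hz. rewrite Rmin_right, Rmax_left by lra. intros Hb. apply Hd; try lra.
      apply Cmod_gt_0. lra.
    - apply circ_0. }
  assert (Hats : forall l, circ G s l -> l = (RtoC (2 * PI) * G 0)%C).
  { intros l' H'. destruct (Rle_lt_or_eq_dec 0 s) as [L|E]; [lra| |].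
    - destruct (circ_ex G (s / 2)) as [l2 Hl2]; [lra| |].
      { intros z Hz. apply Hc. lra. }
      rewrite <- (Hsmall (s / 2) l2); auto; try lra.
      symmetry. apply (circ_boundary G (s / 2) s); auto; try lra.
      + intros z Hz. apply Hc. lra.
      + intros z Hz. rewrite Rmin_left, Rmax_right by lra. intros Hb. apply Hd; try lra.
        apply Cmod_gt_0. lra.
    - subst s. apply (isI_unique _ _ _ _ _ H'). apply circ_0. }
  destruct (Rtotal_order r s) as [L|[E|L]].
  - apply (Hsmall r); auto; lra.
  - subst s. apply Hats, Hl.
  - destruct (circ_ex G s) as [l2 Hl2]; [lra| |].
    { intros z Hz. apply Hc. lra. }
    rewrite <- (Hats l2 Hl2).
    apply (circ_boundary G r s); auto; try lra.
    + intros z Hz. apply Hc. lra.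
    + intros z Hz. rewrite Rmin_right, Rmax_left by lra. intros Hb. apply Hd; try lra.
      apply Cmod_gt_0. lra.
Qed.

(** The factor [w] turns the angular integral into the contour integral of the difference quotient
    and makes the value at 0 vanish; the value at [w = z] removes the singularity. *)
Definition quot (f : C -> C) (z l w : C) : C :=
  match Ceq_dec w z with
  | left _ => (z * l)%C
  | right _ => (w * ((f w - f z) / (w - z)))%C
  end.

Lemma quot_ne (f : C -> C) (z l w : C) : w <> z ->
  quot f z l w = (w * ((f w - f z) / (w - z)))%C.
Proof. intros H. unfold quot. destruct (Ceq_dec w z); tauto. Qed.

Lemma quot_Cder (f : C -> C) (z l w : C) : holD f -> inD w -> w <> z ->
  exists d, Cder (quot f z l) w d.
Proof.
  intros Hf Hw Hn. destruct (holD_Cder f w Hf Hw) as [lw Hlw].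
  destruct (Cder_div (fun w => f w - f z)%C (fun w => w - z)%C w _ _
    (Cder_minus _ _ _ _ _ Hlw (Cder_const (f z) w))
    (Cder_minus _ _ _ _ _ (Cder_id w) (Cder_const z w))) as [d Hd].
  { apply Cminus_eq_contra, Hn. }
  eexists. apply (Cder_ext_loc (fun w => w * ((f w - f z) / (w - z)))%C _ w _ (Cmod (w - z)%C)).
  - apply Cmod_gt_0, Cminus_eq_contra, Hn.
  - intros y Hy. rewrite quot_ne; [reflexivity|]. intros ->.
    rewrite Cmod_minus_sym in Hy. lra.
  - apply Cder_mult; [apply Cder_id|exact Hd].
Qed.

Lemma quot_Ccont (f : C -> C) (z l : C) : Cder f z l -> Ccont (quot f z l) z.
Proof.
  intros H eps He. pose proof (Cmod_ge_0 z) as Pz. pose proof (Cmod_ge_0 l) as Pl.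
  destruct (H (Rmin 1 (eps / (2 * (Cmod z + 1))))) as [d [Hd Hy]].
  { apply Rmin_pos; [lra|apply Rdiv_lt_0_compat; lra]. }
  set (e := Rmin 1 (eps / (2 * (Cmod z + 1)))) in *.
  assert (E1 : e <= 1) by apply Rmin_l.
  assert (E0 : 0 < e) by (apply Rmin_pos; [lra|apply Rdiv_lt_0_compat; lra]).
  assert (E2 : (Cmod z + 1) * e <= eps / 2).
  { apply Rle_trans with ((Cmod z + 1) * (eps / (2 * (Cmod z + 1)))).
    - apply Rmult_le_compat_l; [lra|apply Rmin_r].
    - right. field. lra. }
  set (d2 := eps / (2 * (Cmod l + 2))).
  assert (Hd2 : 0 < d2) by (apply Rdiv_lt_0_compat; lra).
  exists (Rmin d d2). split; [apply Rmin_pos; assumption|].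
  intros y Hm.
  destruct (Rlt_Rmin _ _ _ Hm) as [Y1 Y2].
  unfold quot. destruct (Ceq_dec z z) as [_|n]; [|tauto].
  destruct (Ceq_dec y z) as [->|n].
  - replace (z * l - z * l)%C with (RtoC 0) by ring. rewrite Cmod_0. lra.
  - specialize (Hy y Y1).
    assert (Hn : (y - z)%C <> 0%C) by (apply Cminus_eq_contra, n).
    assert (Hp : 0 < Cmod (y - z)%C) by (apply Cmod_gt_0, Hn).
    set (q := ((f y - f z) / (y - z))%C).
    assert (Hq : Cmod (q - l)%C <= e).
    { apply Rmult_le_reg_r with (Cmod (y - z)%C); [exact Hp|].
      rewrite <- Cmod_mult. eapply Rle_trans; [|exact Hy]. right. f_equal.
      unfold q. field. exact Hn. }
    replace (y * q - z * l)%C with (z * (q - l) + (y - z) * ((q - l) + l))%C by ring.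
    eapply Rle_trans; [apply Cmod_triangle|]. rewrite !Cmod_mult.
    pose proof (Cmod_triangle (q - l)%C l) as T.
    assert (A1 : Cmod z * Cmod (q - l)%C <= Cmod z * e) by (apply Rmult_le_compat_l; assumption).
    assert (A2 : Cmod (y - z)%C * Cmod (q - l + l)%C <= d2 * (Cmod l + 2)).
    { apply Rmult_le_compat; try apply Cmod_ge_0; lra. }
    replace (d2 * (Cmod l + 2)) with (eps / 2) in A2 by (unfold d2; field; lra).
    lra.
Qed.

(** [quot] is continuous on the disc and holomorphic off [z], so its mean over the circle is its
    value at the centre, which is 0. This is Cauchy's integral formula with the f(z) term kept
    inside the integral. *)
Lemma cauchy_quot (f : C -> C) (z : C) (r : R) : holD f -> Cmod z < r -> r < 1 ->
  circ (fun w => w * ((f w - f z) / (w - z)))%C r 0%C.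
Proof.
  intros Hf Hz Hr. pose proof (Cmod_ge_0 z) as Pz.
  destruct (holD_Cder f z Hf) as [lz Hlz]; [unfold inD; lra|].
  assert (Hc : forall w, inD w -> Ccont (quot f z lz) w).
  { intros w Hw. destruct (Ceq_dec w z) as [->|n].
    - apply quot_Ccont, Hlz.
    - destruct (quot_Cder f z lz w Hf Hw n) as [d Hd]. apply (Cder_cont _ _ d Hd). }
  destruct (circ_ex (quot f z lz) r) as [c Hcirc]; [lra| |].
  { intros w Hw. apply Hc. unfold inD. lra. }
  assert (Hc0 : c = (RtoC (2 * PI) * quot f z lz 0)%C).
  { apply (circ_mean (quot f z lz) r (Cmod z)); auto; try lra.
    intros w Hw Hn _. apply quot_Cder; auto. intros ->. tauto. }
  assert (Hq0 : quot f z lz 0 = 0%C).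
  { unfold quot. destruct (Ceq_dec 0 z) as [<-|n]; ring. }
  rewrite Hq0, Cmult_0_r in Hc0. subst c.
  pose proof two_PI_pos.
  eapply isI_ext; [lra| |exact Hcirc].
  assert (0 <= r) by lra. intros t _. apply quot_ne. intros E. rewrite <- E, Cmod_polar in Hz; lra.
Qed.

Fixpoint psum (a : nat -> C) (n : nat) : C :=
  match n with O => 0%C | S n => (psum a n + a n)%C end.

Lemma circ_pow (r : R) (k : nat) : 0 < r ->
  circ (fun w => / w ^ k)%C r (match k with O => RtoC (2 * PI) | _ => 0%C end).
Proof.
  intros Hr. pose proof two_PI_pos as Hpi. destruct k as [|k].
  - replace (RtoC (2 * PI)) with (RtoC (2 * PI - 0) * 1)%C by (rewrite Rminus_0_r; ring).
    apply (isI_ext (fun _ => 1%C)); [lra| |apply isI_const].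
    intros t _. simpl. field.
  - set (x := INR (S k)).
    assert (Hx : x <> 0) by (apply not_0_INR; lia).
    assert (Hend : cis (- (x * (2 * PI))) = 1%C).
    { rewrite <- cis_inv. unfold x. rewrite <- cis_pow, cis_2PI, Cpow_1_l. field. }
    replace (RtoC 0) with (/ (RtoC r ^ S k) * 0)%C by ring.
    apply (isI_ext (fun t => / (RtoC r ^ S k) * cis (- (x * t)))%C); [lra| |].
    + intros t _. unfold polar. rewrite Cpow_mult_l, cis_pow, <- cis_inv. fold x. field.
      split; [apply cis_neq_0|]. apply Cpow_nz. intros E. apply RtoC_inj in E. lra.
    + apply isI_scal.
      injection Hend as E1 E2.
      apply (is_RInt_fct_extend_pair (U := R_NormedModule) (V := R_NormedModule)); simpl.
      * replace 0 with (minus (- sin (- (x * (2 * PI))) / x) (- sin (- (x * 0)) / x)) at 2.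
        -- apply (is_RInt_derive (fun t => - sin (- (x * t)) / x)).
           ++ intros t _. auto_derive; [trivial|]. field. exact Hx.
           ++ intros t _. apply (ex_derive_continuous (V := R_NormedModule)). auto_derive. trivial.
        -- rewrite E2, Rmult_0_r, Ropp_0, sin_0.
           unfold minus, plus, opp; simpl. field. exact Hx.
      * replace 0 with (minus (cos (- (x * (2 * PI))) / x) (cos (- (x * 0)) / x)) at 2.
        -- apply (is_RInt_derive (fun t => cos (- (x * t)) / x)).
           ++ intros t _. auto_derive; [trivial|]. field. exact Hx.
           ++ intros t _. apply (ex_derive_continuous (V := R_NormedModule)). auto_derive. trivial.
        -- rewrite E1, Rmult_0_r, Ropp_0, cos_0.
           unfold minus, plus, opp; simpl. field. exact Hx.
Qed.

(** * Power series in the unit disc *)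

Lemma psum_ext (a b : nat -> C) (n : nat) :
  (forall k, (k < n)%nat -> a k = b k) -> psum a n = psum b n.
Proof.
  intros H. induction n as [|n IH]; [reflexivity|]. simpl.
  rewrite IH by (intros; apply H; lia). rewrite H by lia. reflexivity.
Qed.

Lemma psum_plus (a b : nat -> C) (n : nat) :
  psum (fun k => a k + b k)%C n = (psum a n + psum b n)%C.
Proof. induction n as [|n IH]; simpl; [|rewrite IH]; ring. Qed.

Lemma psum_minus (a b : nat -> C) (n : nat) :
  psum (fun k => a k - b k)%C n = (psum a n - psum b n)%C.
Proof. induction n as [|n IH]; simpl; [|rewrite IH]; ring. Qed.

Lemma psum_scal (c : C) (a : nat -> C) (n : nat) :
  psum (fun k => c * a k)%C n = (c * psum a n)%C.
Proof. induction n as [|n IH]; simpl; [|rewrite IH]; ring. Qed.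

Lemma psum_0 (a : nat -> C) (n : nat) :
  (forall k, (k < n)%nat -> a k = 0%C) -> psum a n = 0%C.
Proof.
  intros H. induction n as [|n IH]; [reflexivity|]. simpl.
  rewrite IH by (intros; apply H; lia). rewrite H by lia. ring.
Qed.

Lemma psum_shift (a : nat -> C) (n : nat) :
  psum a (S n) = (a 0%nat + psum (fun k => a (S k)) n)%C.
Proof.
  induction n as [|n IH]; [simpl; ring|].
  change (psum a (S (S n))) with (psum a (S n) + a (S n))%C. rewrite IH. simpl. ring.
Qed.

Lemma geom_le (q : R) (n : nat) : 0 <= q < 1 ->
  sum_f_R0 (fun k => q ^ k) n <= / (1 - q).
Proof.
  intros Hq. rewrite tech3 by lra.
  assert (0 <= q ^ S n) by (apply pow_le; lra).
  apply Rmult_le_reg_r with (1 - q); [lra|].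
  unfold Rdiv. rewrite Rmult_assoc, Rinv_l by lra. lra.
Qed.

(** The exact geometric factor [1 - q ^ p] is what lets the induction on [p] close. *)
Lemma psum_tail_bound (a : nat -> C) (K q : R) (n p : nat) : 0 <= q < 1 ->
  (forall k, Cmod (a k) <= K * q ^ k) ->
  Cmod (psum a (n + p) - psum a n)%C <= K * q ^ n / (1 - q) * (1 - q ^ p).
Proof.
  intros Hq H. induction p as [|p IH].
  - rewrite Nat.add_0_r. replace (psum a n - psum a n)%C with (RtoC 0) by ring.
    rewrite Cmod_0. simpl. lra.
  - rewrite Nat.add_succ_r. simpl psum.
    replace (psum a (n + p) + a (n + p)%nat - psum a n)%C with
      ((psum a (n + p) - psum a n) + a (n + p)%nat)%C by ring.
    eapply Rle_trans; [apply Cmod_triangle|]. specialize (H (n + p)%nat).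
    rewrite pow_add in H.
    replace (K * q ^ n / (1 - q) * (1 - q ^ S p)) with
      (K * q ^ n / (1 - q) * (1 - q ^ p) + K * (q ^ n * q ^ p)) by (simpl; field; lra).
    lra.
Qed.

Definition sums (a : nat -> C) (l : C) : Prop :=
  forall eps, 0 < eps -> exists N, forall n, (N <= n)%nat -> Cmod (psum a n - l)%C <= eps.

Lemma sums_unique (a : nat -> C) (l l' : C) : sums a l -> sums a l' -> l = l'.
Proof.
  intros H H'. apply (Cmod_small_eq l l' 2); [lra|]. intros eps He.
  destruct (H eps He) as [N HN]. destruct (H' eps He) as [N' HN'].
  specialize (HN (max N N') (Nat.le_max_l _ _)). specialize (HN' (max N N') (Nat.le_max_r _ _)).
  replace (l - l')%C with ((psum a (max N N') - l') - (psum a (max N N') - l))%C by ring.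
  eapply Rle_trans; [apply Cmod_triangle_minus|]. lra.
Qed.

Lemma sums_ext (a b : nat -> C) (l : C) : (forall k, a k = b k) -> sums a l -> sums b l.
Proof.
  intros H Ha eps He. destruct (Ha eps He) as [N HN]. exists N. intros n Hn.
  rewrite (psum_ext b a) by (intros; symmetry; apply H). apply HN, Hn.
Qed.

Lemma sums_plus (a b : nat -> C) (l l' : C) :
  sums a l -> sums b l' -> sums (fun k => a k + b k)%C (l + l')%C.
Proof.
  intros H H' eps He.
  destruct (H (eps / 2)) as [N HN]; [lra|]. destruct (H' (eps / 2)) as [N' HN']; [lra|].
  exists (max N N'). intros n Hn. rewrite psum_plus.
  specialize (HN n ltac:(lia)). specialize (HN' n ltac:(lia)).
  replace (psum a n + psum b n - (l + l'))%C with ((psum a n - l) + (psum b n - l'))%C by ring.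
  eapply Rle_trans; [apply Cmod_triangle|]. lra.
Qed.

Lemma sums_scal (c : C) (a : nat -> C) (l : C) :
  sums a l -> sums (fun k => c * a k)%C (c * l)%C.
Proof.
  intros H eps He. pose proof (Cmod_ge_0 c).
  destruct (H (eps / (Cmod c + 1))) as [N HN]; [apply Rdiv_lt_0_compat; lra|].
  exists N. intros n Hn. rewrite psum_scal.
  replace (c * psum a n - c * l)%C with (c * (psum a n - l))%C by ring.
  rewrite Cmod_mult. specialize (HN n Hn).
  apply Rle_trans with ((Cmod c + 1) * (eps / (Cmod c + 1))).
  - apply Rmult_le_compat; try apply Cmod_ge_0; lra.
  - right. field. lra.
Qed.

Lemma sums_minus (a b : nat -> C) (l l' : C) :
  sums a l -> sums b l' -> sums (fun k => a k - b k)%C (l - l')%C.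
Proof.
  intros H H'.
  apply (sums_ext (fun k => a k + (- (1)) * b k)%C); [intros; ring|].
  replace (l - l')%C with (l + - (1) * l')%C by ring.
  apply sums_plus; [exact H|apply sums_scal, H'].
Qed.

Lemma sums_shift (a : nat -> C) (l : C) :
  sums (fun k => a (S k)) l -> sums a (a 0%nat + l)%C.
Proof.
  intros H eps He. destruct (H eps He) as [N HN]. exists (S N). intros n Hn.
  destruct n as [|n]; [lia|]. rewrite psum_shift. specialize (HN n ltac:(lia)).
  replace (a 0%nat + psum (fun k => a (S k)) n - (a 0%nat + l))%C with
    (psum (fun k => a (S k)) n - l)%C by ring. exact HN.
Qed.

Lemma sums_tail (a : nat -> C) (l : C) (K q : R) (n : nat) : 0 <= q < 1 ->
  (forall k, Cmod (a k) <= K * q ^ k) -> sums a l ->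
  Cmod (psum a n - l)%C <= K * q ^ n / (1 - q).
Proof.
  intros Hq H Hl. apply le_epsilon. intros eps He.
  destruct (Hl eps He) as [N HN]. specialize (HN (n + N)%nat ltac:(lia)).
  pose proof (psum_tail_bound a K q n N Hq H) as B.
  assert (HK : 0 <= K).
  { specialize (H 0%nat). pose proof (Cmod_ge_0 (a 0%nat)). simpl in H. lra. }
  replace (psum a n - l)%C with ((psum a (n + N) - l) - (psum a (n + N) - psum a n))%C by ring.
  eapply Rle_trans; [apply Cmod_triangle_minus|].
  assert (0 <= q ^ N) by (apply pow_le; lra). assert (0 <= q ^ n) by (apply pow_le; lra).
  assert (0 <= K * q ^ n / (1 - q)).
  { apply Rmult_le_pos; [apply Rmult_le_pos; assumption|].
    left. apply Rinv_0_lt_compat. lra. }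
  nra.
Qed.

Lemma sums_bound (a : nat -> C) (l : C) (K q : R) : 0 <= q < 1 ->
  (forall k, Cmod (a k) <= K * q ^ k) -> sums a l -> Cmod l <= K / (1 - q).
Proof.
  intros Hq H Hl. pose proof (sums_tail a l K q 0 Hq H Hl) as B. simpl in B.
  replace (0 - l)%C with (- l)%C in B by ring. rewrite Cmod_opp, Rmult_1_r in B. exact B.
Qed.

Lemma pow_small (q K eps : R) : 0 <= q < 1 -> 0 < eps ->
  exists N, forall n, (N <= n)%nat -> K * q ^ n <= eps.
Proof.
  intros Hq He. destruct (pow_lt_1_zero q) with (y := eps / (Rabs K + 1)) as [N HN].
  - rewrite Rabs_pos_eq; lra.
  - pose proof (Rabs_pos K). apply Rdiv_lt_0_compat; lra.
  - exists N. intros n Hn. specialize (HN n Hn).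
    assert (P : 0 <= q ^ n) by (apply pow_le; lra). rewrite Rabs_pos_eq in HN by exact P.
    pose proof (Rabs_pos K). pose proof (Rle_abs K).
    apply Rle_trans with ((Rabs K + 1) * (eps / (Rabs K + 1))).
    + apply Rle_trans with ((Rabs K + 1) * q ^ n).
      * apply Rmult_le_compat_r; lra.
      * apply Rmult_le_compat_l; lra.
    + right. field. lra.
Qed.

Lemma sums_of_rate (a : nat -> C) (l : C) (K q : R) : 0 <= q < 1 ->
  (forall n, Cmod (psum a n - l)%C <= K * q ^ n) -> sums a l.
Proof.
  intros Hq H eps He. destruct (pow_small q K eps Hq He) as [N HN].
  exists N. intros n Hn. eapply Rle_trans; [apply H|apply HN, Hn].
Qed.

Lemma psum_pair (a : nat -> C) (n : nat) :
  psum a (S n) = (sum_n (fun k => fst (a k)) n, sum_n (fun k => snd (a k)) n).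
Proof.
  induction n as [|n IH].
  - simpl. rewrite !sum_O. destruct (a 0%nat). unfold Cplus; simpl. f_equal; ring.
  - change (psum a (S (S n))) with (psum a (S n) + a (S n))%C. rewrite IH, !sum_Sn.
    reflexivity.
Qed.

Lemma real_series_eps (a : nat -> R) (l : R) : is_series a l ->
  forall eps, 0 < eps -> exists N, forall n, (N <= n)%nat -> Rabs (sum_n a n - l) <= eps.
Proof.
  intros H eps He.
  assert (L : is_lim_seq (sum_n a) l) by exact H.
  apply is_lim_seq_spec in L. destruct (L (mkposreal eps He)) as [N HN].
  exists N. intros n Hn. left. apply (HN n Hn).
Qed.

Lemma sums_ex (a : nat -> C) (K q : R) : 0 <= q < 1 ->
  (forall k, Cmod (a k) <= K * q ^ k) -> exists l, sums a l.
Proof.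
  intros Hq H.
  assert (Hg : ex_series (fun k => K * q ^ k)).
  { apply (ex_series_scal (V := R_NormedModule) K). exists (/ (1 - q)).
    apply is_series_geom. rewrite Rabs_pos_eq; lra. }
  destruct (ex_series_le (V := R_CompleteNormedModule) (fun k => fst (a k)) _
    (fun k => Rle_trans _ _ _ (Rabs_fst_le (a k)) (H k)) Hg) as [x Hx].
  destruct (ex_series_le (V := R_CompleteNormedModule) (fun k => snd (a k)) _
    (fun k => Rle_trans _ _ _ (Rabs_snd_le (a k)) (H k)) Hg) as [y Hy].
  exists (x, y). intros eps He.
  destruct (real_series_eps _ _ Hx (eps / 2)) as [N HN]; [lra|].
  destruct (real_series_eps _ _ Hy (eps / 2)) as [N' HN']; [lra|].
  exists (S (max N N')). intros n Hn. destruct n as [|n]; [lia|].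
  rewrite psum_pair. eapply Rle_trans; [apply Cmod_le_abs|].
  specialize (HN n ltac:(lia)). specialize (HN' n ltac:(lia)). simpl.
  unfold Rminus in *. lra.
Qed.

(** The powers x^0, ..., x^(k-1) are each at least x^k, so k x^k is at most a partial sum of the
    geometric series. *)
Lemma pow_linear_bound (x : R) (k : nat) : 0 <= x < 1 -> INR k * x ^ k <= / (1 - x).
Proof.
  intros Hx. destruct k as [|k].
  - simpl. rewrite Rmult_0_l. left. apply Rinv_0_lt_compat. lra.
  - eapply Rle_trans; [|apply (geom_le x k Hx)].
    assert (H : forall n, (n <= k)%nat -> INR (S n) * x ^ S k <= sum_f_R0 (fun j => x ^ j) n).
    { assert (Hm : forall j, (j <= k)%nat -> x ^ S k <= x ^ j).
      { intros j Hj. replace (S k) with (j + (S k - j))%nat by lia. rewrite pow_add.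
        rewrite <- (Rmult_1_r (x ^ j)) at 2. apply Rmult_le_compat_l; [apply pow_le; lra|].
        rewrite <- (pow1 (S k - j)). apply pow_incr. lra. }
      induction n as [|n IH]; intros Hn.
      - rewrite Rmult_1_l. simpl sum_f_R0. change (x ^ S k <= x ^ 0). apply Hm; lia.
      - rewrite S_INR, Rmult_plus_distr_r, Rmult_1_l. simpl sum_f_R0.
        apply Rplus_le_compat; [apply IH; lia|]. apply (Hm (S n) Hn). }
    apply H; lia.
Qed.

Definition conv (a b : nat -> C) (n : nat) : C := psum (fun j => a j * b (n - j)%nat)%C (S n).

Lemma psum_conv (a b : nat -> C) (N : nat) :
  psum (conv a b) N = psum (fun i => a i * psum b (N - i))%C N.
Proof.
  induction N as [|N IH]; [reflexivity|].
  change (psum (conv a b) (S N)) with (psum (conv a b) N + conv a b N)%C. rewrite IH.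
  unfold conv. rewrite (psum_ext (fun i => a i * psum b (S N - i))%C
    (fun i => a i * psum b (N - i) + a i * b (N - i)%nat)%C (S N)).
  - rewrite psum_plus. cbn [psum]. rewrite !Nat.sub_diag. simpl psum. ring.
  - intros i Hi. replace (S N - i)%nat with (S (N - i)) by lia. simpl. ring.
Qed.

(** By [psum_conv] the N-th partial sum of the product is the sum of a_i times a partial sum of b.
    Replacing each of these by [l'] costs at most N K2 q^N in all, which any ratio strictly between
    q and 1 absorbs; [x] is the midpoint. *)
Lemma sums_conv (a b : nat -> C) (l l' : C) (K q : R) : 0 <= q < 1 ->
  (forall k, Cmod (a k) <= K * q ^ k) -> (forall k, Cmod (b k) <= K * q ^ k) ->
  sums a l -> sums b l' -> sums (conv a b) (l * l')%C.
Proof.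
  intros Hq Ha Hb Hl Hl'.
  assert (HK : 0 <= K).
  { specialize (Ha 0%nat). pose proof (Cmod_ge_0 (a 0%nat)). simpl in Ha. lra. }
  set (x := (1 + q) / 2). assert (Hx : 0 < x < 1) by (unfold x; lra).
  assert (Hqx : 0 <= q / x < 1).
  { split; [apply Rmult_le_pos; [lra|left; apply Rinv_0_lt_compat; lra]|].
    apply Rmult_lt_reg_r with x; [lra|]. unfold Rdiv. rewrite Rmult_assoc, Rinv_l by lra.
    unfold x; lra. }
  set (K2 := K * (K / (1 - q))).
  assert (HK2 : 0 <= K2).
  { apply Rmult_le_pos; [exact HK|]. apply Rmult_le_pos; [exact HK|].
    left. apply Rinv_0_lt_compat. lra. }
  assert (Hdiff : sums (fun n => conv a b n - a n * l')%C 0%C).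
  { apply (sums_of_rate _ _ (K2 * / (1 - q / x)) x); [lra|]. intros N.
    replace (psum (fun n => conv a b n - a n * l')%C N - 0)%C with
      (psum (fun i => a i * (psum b (N - i) - l'))%C N).
    - assert (Hn : forall n, (n <= N)%nat ->
        Cmod (psum (fun i => a i * (psum b (N - i) - l'))%C n) <= INR n * (K2 * q ^ N)).
      { induction n as [|n IH]; intros Hn.
        - simpl. rewrite Cmod_0, Rmult_0_l. lra.
        - simpl psum. eapply Rle_trans; [apply Cmod_triangle|].
          rewrite S_INR, Rmult_plus_distr_r, Rmult_1_l.
          apply Rplus_le_compat; [apply IH; lia|]. rewrite Cmod_mult.
          apply Rle_trans with ((K * q ^ n) * (K * q ^ (N - n) / (1 - q))).
          + apply Rmult_le_compat; try apply Cmod_ge_0; [apply Ha|].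
            apply sums_tail; assumption.
          + right. unfold K2. replace (q ^ N) with (q ^ n * q ^ (N - n)).
            * field. lra.
            * rewrite <- pow_add. f_equal. lia. }
      eapply Rle_trans; [apply Hn, Nat.le_refl|].
      replace (INR N * (K2 * q ^ N)) with (K2 * (INR N * (q / x) ^ N) * x ^ N).
      + apply Rmult_le_compat_r; [apply pow_le; lra|]. apply Rmult_le_compat_l; [exact HK2|].
        apply pow_linear_bound, Hqx.
      + unfold Rdiv. rewrite Rpow_mult_distr, pow_inv. field. apply pow_nonzero. lra.
    - rewrite psum_minus, psum_conv.
      rewrite (psum_ext _ (fun i => a i * psum b (N - i) - l' * a i)%C) by (intros; ring).
      rewrite psum_minus.
      rewrite (psum_ext (fun n => a n * l')%C (fun i => l' * a i)%C) by (intros; ring). ring. }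
  apply (sums_ext (fun n => (conv a b n - a n * l') + l' * a n)%C); [intros; ring|].
  replace (l * l')%C with (0 + l' * l)%C by ring.
  apply sums_plus; [exact Hdiff|apply sums_scal, Hl].
Qed.

(* [a] is the coefficient sequence of a power series converging in the unit disc *)
Definition growth (a : nat -> C) : Prop :=
  forall r, 0 < r < 1 -> exists M, forall k, Cmod (a k) * r ^ k <= M.

Definition ps (a : nat -> C) (f : C -> C) : Prop :=
  growth a /\ forall z, inD z -> sums (fun k => a k * z ^ k)%C (f z).

Lemma growth_const_nonneg (a : nat -> C) (M r : R) :
  (forall k, Cmod (a k) * r ^ k <= M) -> 0 <= M.
Proof.
  intros H. specialize (H 0%nat). pose proof (Cmod_ge_0 (a 0%nat)). simpl in H. lra.
Qed.

Lemma geom_term (a : nat -> C) (M r R : R) (z : C) : 0 < R -> Cmod z <= r ->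
  (forall k, Cmod (a k) * R ^ k <= M) -> forall k, Cmod (a k * z ^ k)%C <= M * (r / R) ^ k.
Proof.
  intros HR Hz H k. rewrite Cmod_mult, Cmod_pow.
  pose proof (Cmod_ge_0 z). pose proof (Cmod_ge_0 (a k)).
  assert (P : 0 < R ^ k) by (apply pow_lt, HR).
  assert (Q : Cmod z ^ k <= r ^ k) by (apply pow_incr; lra).
  assert (Q0 : 0 <= r ^ k) by (apply pow_le; lra).
  apply Rle_trans with (Cmod (a k) * r ^ k); [apply Rmult_le_compat_l; assumption|].
  unfold Rdiv. rewrite Rpow_mult_distr, pow_inv.
  apply Rle_trans with ((Cmod (a k) * R ^ k) * (r ^ k * / R ^ k)).
  - right. field. lra.
  - apply Rmult_le_compat_r; [|apply H].
    apply Rmult_le_pos; [exact Q0|]. left. apply Rinv_0_lt_compat, P.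
Qed.

Lemma ratio_lt_1 (r R : R) : 0 <= r -> r < R -> 0 <= r / R < 1.
Proof.
  intros H0 H. split; [apply Rmult_le_pos; [lra|left; apply Rinv_0_lt_compat; lra]|].
  apply Rmult_lt_reg_r with R; [lra|]. unfold Rdiv. rewrite Rmult_assoc, Rinv_l by lra. lra.
Qed.

Lemma growth_geom (a : nat -> C) (z : C) : growth a -> inD z ->
  exists K q, 0 <= q < 1 /\ 0 <= K /\ forall k, Cmod (a k * z ^ k)%C <= K * q ^ k.
Proof.
  intros Ha Hz. unfold inD in Hz. pose proof (Cmod_ge_0 z).
  destruct (Ha ((1 + Cmod z) / 2)) as [M HM]; [lra|].
  exists M, (Cmod z / ((1 + Cmod z) / 2)). split; [apply ratio_lt_1; lra|]. split.
  - specialize (HM 0%nat). pose proof (Cmod_ge_0 (a 0%nat)). simpl in HM. lra.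
  - apply geom_term; [lra|lra|exact HM].
Qed.

Lemma ps_ex (a : nat -> C) : growth a -> exists f, ps a f.
Proof.
  intros Ha.
  assert (H : forall z, exists l, inD z -> sums (fun k => a k * z ^ k)%C l).
  { intros z. destruct (classic (inD z)) as [Hz|Hz].
    - destruct (growth_geom a z Ha Hz) as [K [q [Hq [_ HK]]]].
      destruct (sums_ex _ K q Hq HK) as [l Hl]. exists l. auto.
    - exists 0%C. tauto. }
  exists (fun z => proj1_sig (constructive_indefinite_description _ (H z))).
  split; [exact Ha|]. intros z Hz.
  exact (proj2_sig (constructive_indefinite_description _ (H z)) Hz).
Qed.

Lemma ps_bound (a : nat -> C) (f : C -> C) (M r R : R) (z : C) : ps a f ->
  0 <= r -> r < R -> R <= 1 -> Cmod z <= r ->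
  (forall k, Cmod (a k) * R ^ k <= M) -> Cmod (f z) <= M / (1 - r / R).
Proof.
  intros [_ Hf] H0 H1 H2 Hz HM.
  apply (sums_bound (fun k => a k * z ^ k)%C); [apply ratio_lt_1; lra| |].
  - apply geom_term; [lra|exact Hz|exact HM].
  - apply Hf. unfold inD. lra.
Qed.

Lemma sums_conv_ps (a b : nat -> C) (z l l' : C) : growth a -> growth b -> inD z ->
  sums (fun k => a k * z ^ k)%C l -> sums (fun k => b k * z ^ k)%C l' ->
  sums (fun k => conv a b k * z ^ k)%C (l * l')%C.
Proof.
  intros Ha Hb Hz Hl Hl'.
  destruct (growth_geom a z Ha Hz) as [K [q [Hq [HK0 HK]]]].
  destruct (growth_geom b z Hb Hz) as [K' [q' [Hq' [HK0' HK']]]].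
  apply (sums_ext (conv (fun k => a k * z ^ k)%C (fun k => b k * z ^ k)%C)).
  - intros k. unfold conv. rewrite Cmult_comm, <- psum_scal. apply psum_ext.
    intros j Hj. replace (z ^ k)%C with (z ^ j * z ^ (k - j))%C; [ring|].
    rewrite <- Cpow_add_r. f_equal. lia.
  - apply (sums_conv _ _ _ _ (K + K') (Rmax q q')); auto.
    + unfold Rmax; destruct (Rle_dec q q'); lra.
    + intros k. eapply Rle_trans; [apply HK|]. apply Rmult_le_compat; try lra.
      * apply pow_le; lra.
      * apply pow_incr. split; [lra|apply Rmax_l].
    + intros k. eapply Rle_trans; [apply HK'|]. apply Rmult_le_compat; try lra.
      * apply pow_le; lra.
      * apply pow_incr. split; [lra|apply Rmax_r].
Qed.

(** If the differences d_j vanish for j < n, then d_n z^n equals minus a tail of order |z|^(n+1),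
    and z tends to 0. Agreement on a small disc suffices, as is needed to compare expansions found
    at different radii. *)
Lemma ps_unique_local (a b : nat -> C) (rho M : R) : 0 < rho <= 1 ->
  (forall k, Cmod (a k) * rho ^ k <= M) -> (forall k, Cmod (b k) * rho ^ k <= M) ->
  (forall z, Cmod z < rho -> exists l,
     sums (fun k => a k * z ^ k)%C l /\ sums (fun k => b k * z ^ k)%C l) ->
  forall k, a k = b k.
Proof.
  intros Hrho Ha Hb H.
  set (d := fun k => (a k - b k)%C).
  assert (Hd : forall k, Cmod (d k) * rho ^ k <= 2 * M).
  { intros k. specialize (Ha k). specialize (Hb k). unfold d.
    assert (0 <= rho ^ k) by (apply pow_le; lra).
    apply Rle_trans with ((Cmod (a k) + Cmod (b k)) * rho ^ k); [|lra].
    apply Rmult_le_compat_r; [assumption|apply Cmod_triangle_minus]. }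
  assert (Hs : forall z, Cmod z < rho -> sums (fun k => d k * z ^ k)%C 0%C).
  { intros z Hz. destruct (H z Hz) as [l [H1 H2]].
    apply (sums_ext (fun k => a k * z ^ k - b k * z ^ k)%C); [intros; unfold d; ring|].
    replace (RtoC 0) with (l - l)%C by ring. apply sums_minus; assumption. }
  assert (Hz : forall n, d n = 0%C).
  { intros n. induction n as [n IH] using (well_founded_induction Nat.lt_wf_0).
    apply Ceq_minus. apply (Cmod_small_eq _ _ 1); [lra|]. intros eps He.
    replace (d n - 0 - 0)%C with (d n) by ring.
    assert (HM : 0 <= M) by exact (growth_const_nonneg _ _ _ Ha).
    assert (Prn : 0 < rho ^ n) by (apply pow_lt; lra).
    (* With t at most 1/2 the tail is at most 4 M t t^n; the second bound on t makes this at most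
       eps rho^n t^n. *)
    set (t := Rmin (1 / 2) (eps * rho ^ n / (4 * M + 1))).
    assert (Ht : 0 < t).
    { apply Rmin_pos; [lra|]. apply Rdiv_lt_0_compat; [|lra]. apply Rmult_lt_0_compat; assumption. }
    assert (Ht2 : t <= 1 / 2) by apply Rmin_l.
    assert (Ht3 : (4 * M + 1) * t <= eps * rho ^ n).
    { apply Rle_trans with ((4 * M + 1) * (eps * rho ^ n / (4 * M + 1))).
      - apply Rmult_le_compat_l; [lra|apply Rmin_r].
      - right. field. lra. }
    set (z := RtoC (t * rho)).
    assert (Hzm : Cmod z = t * rho) by (unfold z; rewrite Cmod_R, Rabs_pos_eq; nra).
    assert (Hgt : forall k, Cmod (d k * z ^ k)%C <= 2 * M * t ^ k).
    { intros k. replace t with (t * rho / rho) by (field; lra).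
      apply geom_term; [lra|lra|exact Hd]. }
    pose proof (sums_tail _ _ (2 * M) t (S n) ltac:(lra) Hgt (Hs z ltac:(rewrite Hzm; nra))) as B.
    simpl psum in B. rewrite (psum_0 _ n) in B.
    2: { intros k Hk. rewrite (IH k Hk). ring. }
    replace (0 + d n * z ^ n - 0)%C with (d n * z ^ n)%C in B by ring.
    rewrite Cmod_mult, Cmod_pow, Hzm, Rpow_mult_distr in B.
    assert (Ptn : 0 < t ^ n) by (apply pow_lt; lra).
    assert (B2 : 2 * M * t ^ S n / (1 - t) <= 4 * M * t * t ^ n).
    { simpl. unfold Rdiv.
      assert (/ (1 - t) <= 2).
      { replace 2 with (/ (1 / 2)) by field. apply Rinv_le_contravar; lra. }
      replace (4 * M * t * t ^ n) with (2 * M * (t * t ^ n) * 2) by ring.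
      apply Rmult_le_compat_l; [|assumption].
      repeat apply Rmult_le_pos; lra. }
    apply Rmult_le_reg_r with (rho ^ n * t ^ n); [apply Rmult_lt_0_compat; assumption|].
    rewrite Rmult_1_l.
    apply Rle_trans with (4 * M * t * t ^ n); [lra|].
    apply Rle_trans with (((4 * M + 1) * t) * t ^ n); [apply Rmult_le_compat_r; nra|].
    replace (eps * (rho ^ n * t ^ n)) with (eps * rho ^ n * t ^ n) by ring.
    apply Rmult_le_compat_r; lra. }
  intros k. apply Ceq_minus. apply Hz.
Qed.

Lemma ps_unique (a b : nat -> C) (f g : C -> C) : ps a f -> ps b g -> eqD f g ->
  forall k, a k = b k.
Proof.
  intros [Ha Hf] [Hb Hg] E.
  destruct (Ha (1 / 2)) as [M HM]; [lra|]. destruct (Hb (1 / 2)) as [M' HM']; [lra|].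
  apply (ps_unique_local a b (1 / 2) (Rmax M M')); [lra| | |].
  - intros k. eapply Rle_trans; [apply HM|apply Rmax_l].
  - intros k. eapply Rle_trans; [apply HM'|apply Rmax_r].
  - intros z Hz. assert (inD z) by (unfold inD; lra).
    exists (f z). split; [apply Hf; assumption|]. rewrite E by assumption. apply Hg; assumption.
Qed.

Lemma ps_ext (a b : nat -> C) (f g : C -> C) : (forall k, a k = b k) -> eqD f g ->
  ps a f -> ps b g.
Proof.
  intros E E' [Ha Hf]. split.
  - intros r Hr. destruct (Ha r Hr) as [M HM]. exists M. intros k. rewrite <- E. apply HM.
  - intros z Hz. rewrite <- E' by exact Hz.
    apply (sums_ext (fun k => a k * z ^ k)%C); [intros k; rewrite E; reflexivity|]. apply Hf, Hz.
Qed.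

Lemma ps_eqD (a : nat -> C) (f g : C -> C) : ps a f -> ps a g -> eqD f g.
Proof. intros [_ Hf] [_ Hg] z Hz. exact (sums_unique _ _ _ (Hf z Hz) (Hg z Hz)). Qed.

(** * Taylor expansion of holomorphic functions *)

Definition shift_deriv (a : nat -> C) (k : nat) : C := (RtoC (INR (S k)) * a (S k))%C.

Lemma growth_linear (a : nat -> C) : growth a -> growth (fun k => RtoC (INR k) * a k)%C.
Proof.
  intros Ha r Hr. set (R := (1 + r) / 2).
  destruct (Ha R) as [M HM]; [unfold R; lra|].
  exists (M * / (1 - r / R)). intros k.
  rewrite Cmod_mult, Cmod_R, Rabs_pos_eq by apply pos_INR.
  assert (Hq : 0 <= r / R < 1) by (apply ratio_lt_1; unfold R; lra).
  assert (PR : 0 < R ^ k) by (apply pow_lt; unfold R; lra).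
  replace (INR k * Cmod (a k) * r ^ k) with ((Cmod (a k) * R ^ k) * (INR k * (r / R) ^ k)).
  - assert (0 <= (r / R) ^ k) by (apply pow_le; lra).
    apply Rmult_le_compat.
    + apply Rmult_le_pos; [apply Cmod_ge_0|lra].
    + apply Rmult_le_pos; [apply pos_INR|assumption].
    + apply HM.
    + apply pow_linear_bound, Hq.
  - unfold Rdiv. rewrite Rpow_mult_distr, pow_inv. field. lra.
Qed.

Lemma growth_shift (a : nat -> C) : growth a -> growth (fun k => a (S k)).
Proof.
  intros Ha r Hr. destruct (Ha r Hr) as [M HM]. exists (M / r). intros k.
  apply Rmult_le_reg_r with r; [lra|]. specialize (HM (S k)). simpl in HM.
  replace (M / r * r) with M by (field; lra). lra.
Qed.

Lemma growth_shift_deriv (a : nat -> C) : growth a -> growth (shift_deriv a).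
Proof. intros Ha. apply (growth_shift (fun k => RtoC (INR k) * a k)%C), growth_linear, Ha. Qed.

(** Second-order remainder of w^n with n = k + 1, bounded by n^2 rho^(n-2) |y - z|^2. The factor
    [rho ^ 2] stands on the left because the exponent n - 2 may be negative. *)
Lemma pow_second_order (y z : C) (rho : R) (k : nat) : Cmod y <= rho -> Cmod z <= rho ->
  Cmod (y ^ S k - z ^ S k - RtoC (INR (S k)) * z ^ k * (y - z))%C * rho ^ 2
    <= INR (S k) * INR (S k) * rho ^ S k * (Cmod (y - z)%C * Cmod (y - z)%C).
Proof.
  intros Hy Hz. pose proof (Cmod_ge_0 y) as Py. pose proof (Cmod_ge_0 z) as Pz.
  set (D := Cmod (y - z)%C). assert (PD : 0 <= D) by apply Cmod_ge_0.
  induction k as [|k IH].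
  - replace (y ^ 1 - z ^ 1 - RtoC (INR 1) * z ^ 0 * (y - z))%C with (RtoC 0) by (simpl; ring).
    rewrite Cmod_0, Rmult_0_l. simpl. apply Rmult_le_pos; nra.
  - replace (y ^ S (S k) - z ^ S (S k) - RtoC (INR (S (S k))) * z ^ S k * (y - z))%C with
      (y * (y ^ S k - z ^ S k - RtoC (INR (S k)) * z ^ k * (y - z)) +
       RtoC (INR (S k)) * (z ^ k * ((y - z) * (y - z))))%C.
    + apply Rle_trans with
        ((Cmod y * Cmod (y ^ S k - z ^ S k - RtoC (INR (S k)) * z ^ k * (y - z))%C
          + INR (S k) * (Cmod z ^ k * (D * D))) * rho ^ 2).
      * apply Rmult_le_compat_r; [nra|]. eapply Rle_trans; [apply Cmod_triangle|].
        rewrite !Cmod_mult, Cmod_pow, Cmod_R, (Rabs_pos_eq (INR (S k))) by apply pos_INR.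
        unfold D. lra.
      * set (E := Cmod (y ^ S k - z ^ S k - RtoC (INR (S k)) * z ^ k * (y - z))%C) in *.
        assert (PE : 0 <= E) by apply Cmod_ge_0.
        assert (T1 : Cmod y * (E * rho ^ 2) <= rho * (INR (S k) * INR (S k) * rho ^ S k * (D * D))).
        { apply Rmult_le_compat; try lra. nra. }
        assert (T2 : Cmod z ^ k <= rho ^ k) by (apply pow_incr; lra).
        assert (T3 : INR (S k) * (D * D) * rho ^ 2 * Cmod z ^ k <= INR (S k) * (D * D) * rho ^ 2 * rho ^ k).
        { apply Rmult_le_compat_l; [|exact T2].
          repeat apply Rmult_le_pos; try apply pos_INR; simpl; lra. }
        assert (T4 : 0 <= (D * D) * (rho ^ 2 * rho ^ k)).
        { repeat apply Rmult_le_pos; try (apply pow_le); lra. }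
        replace (rho ^ S (S k)) with (rho ^ 2 * rho ^ k) by (simpl; ring).
        rewrite (S_INR (S k)).
        replace (rho * (INR (S k) * INR (S k) * rho ^ S k * (D * D))) with
          (INR (S k) * INR (S k) * ((D * D) * (rho ^ 2 * rho ^ k))) in T1 by (simpl; ring).
        pose proof (pos_INR (S k)).
        set (X := (D * D) * (rho ^ 2 * rho ^ k)) in *.
        replace ((INR (S k) + 1) * (INR (S k) + 1) * (rho ^ 2 * rho ^ k) * (D * D)) with
          (INR (S k) * INR (S k) * X + 2 * (INR (S k) * X) + X) by (unfold X; ring).
        replace (INR (S k) * (D * D) * rho ^ 2 * rho ^ k) with (INR (S k) * X) in T3 by (unfold X; ring).
        assert (0 <= INR (S k) * X) by (apply Rmult_le_pos; assumption).
        lra.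
    + rewrite (S_INR (S k)), RtoC_plus. rewrite !Cpow_S. ring.
Qed.

(** Termwise, the second-order remainder is at most |y - z|^2 times the general term of a series in
    k^2 |a_k| rho^k, which converges because k^2 a_k still has growth at a radius R > rho. Hence the
    remainder of f is at most K |y - z|^2. *)
Lemma ps_Cder (a : nat -> C) (f f' : C -> C) (z : C) :
  ps a f -> ps (shift_deriv a) f' -> inD z -> Cder f z (f' z).
Proof.
  intros [Ha Hf] [Ha' Hf'] Hz. unfold inD in *. pose proof (Cmod_ge_0 z) as Pz.
  set (rho := (1 + Cmod z) / 2). set (R := (1 + rho) / 2).
  assert (H1 : Cmod z < rho) by (unfold rho; lra).
  assert (H2 : rho < R) by (unfold R, rho; lra).
  assert (H3 : R < 1) by (unfold R, rho; lra).
  destruct (growth_linear _ (growth_linear _ Ha) R) as [M HM]; [lra|].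
  assert (HM0 : 0 <= M).
  { specialize (HM 0%nat). simpl in HM. rewrite Cmult_0_l, Cmod_0 in HM. lra. }
  assert (Hq : 0 <= rho / R < 1) by (apply ratio_lt_1; lra).
  set (K := M / rho ^ 2 / (1 - rho / R)).
  assert (HK : 0 <= K).
  { unfold K. repeat apply Rmult_le_pos; try lra; left; apply Rinv_0_lt_compat; [apply pow_lt|]; lra. }
  assert (Hest : forall y, Cmod y <= rho ->
    Cmod (f y - f z - f' z * (y - z))%C <= K * (Cmod (y - z)%C * Cmod (y - z)%C)).
  { intros y Hy.
    assert (S1 : forall w, Cmod w < 1 -> exists l,
      sums (fun k => a (S k) * w ^ S k)%C l /\ f w = (a 0%nat + l)%C).
    { intros w Hw. destruct (growth_geom (fun k => a (S k)) w (growth_shift a Ha) Hw) as [K' [q [Hq' [_ HK']]]].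
      destruct (sums_ex _ K' q Hq' HK') as [l Hl].
      assert (Hl2 : sums (fun k => a (S k) * w ^ S k)%C (w * l)%C).
      { apply (sums_ext (fun k => w * (a (S k) * w ^ k))%C); [intros k; rewrite Cpow_S; ring|].
        apply sums_scal, Hl. }
      exists (w * l)%C. split; [exact Hl2|].
      apply (sums_unique (fun k => a k * w ^ k)%C); [apply Hf, Hw|].
      replace (a 0%nat) with (a 0%nat * w ^ 0)%C by (simpl; ring).
      apply (sums_shift (fun k => a k * w ^ k)%C). exact Hl2. }
    destruct (S1 y) as [ly [Hly Ey]]; [lra|]. destruct (S1 z) as [lz [Hlz Ez]]; [lra|].
    pose proof (sums_scal (y - z)%C _ _ (Hf' z Hz)) as Hd.
    pose proof (sums_minus _ _ _ _ (sums_minus _ _ _ _ Hly Hlz) Hd) as Hall.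
    replace (f y - f z - f' z * (y - z))%C with (ly - lz - (y - z) * f' z)%C
      by (rewrite Ey, Ez; ring).
    replace (K * (Cmod (y - z)%C * Cmod (y - z)%C)) with
      ((M / rho ^ 2 * (Cmod (y - z)%C * Cmod (y - z)%C)) / (1 - rho / R))
      by (unfold K; field; lra).
    apply (sums_bound _ _ _ (rho / R) Hq) with (2 := Hall).
    intros k. unfold shift_deriv.
    replace (a (S k) * y ^ S k - a (S k) * z ^ S k - (y - z) * (RtoC (INR (S k)) * a (S k) * z ^ k))%C
      with (a (S k) * (y ^ S k - z ^ S k - RtoC (INR (S k)) * z ^ k * (y - z)))%C by ring.
    rewrite Cmod_mult.
    pose proof (pow_second_order y z rho k Hy ltac:(lra)) as B.
    set (E := Cmod (y ^ S k - z ^ S k - RtoC (INR (S k)) * z ^ k * (y - z))%C) in *.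
    set (D2 := Cmod (y - z)%C * Cmod (y - z)%C) in *.
    assert (PD2 : 0 <= D2) by (apply Rmult_le_pos; apply Cmod_ge_0).
    specialize (HM (S k)). rewrite !Cmod_mult, Cmod_R, (Rabs_pos_eq (INR (S k))) in HM by apply pos_INR.
    assert (Prho : 0 < rho ^ 2) by (apply pow_lt; lra).
    apply Rmult_le_reg_r with (rho ^ 2); [exact Prho|].
    apply Rle_trans with (Cmod (a (S k)) * (INR (S k) * INR (S k) * rho ^ S k * D2)).
    { rewrite Rmult_assoc. apply Rmult_le_compat_l; [apply Cmod_ge_0|exact B]. }
    replace (M / rho ^ 2 * D2 * (rho / R) ^ k * rho ^ 2) with (M * (rho / R) ^ k * D2) by (field; lra).
    assert (PR : 0 < R ^ S k) by (apply pow_lt; lra).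
    replace (Cmod (a (S k)) * (INR (S k) * INR (S k) * rho ^ S k * D2)) with
      ((INR (S k) * (INR (S k) * Cmod (a (S k))) * R ^ S k) * ((rho / R) ^ S k) * D2).
    2: { unfold Rdiv. rewrite Rpow_mult_distr, pow_inv. field. lra. }
    apply Rmult_le_compat_r; [exact PD2|].
    assert (Pq : 0 <= (rho / R) ^ k) by (apply pow_le; lra).
    apply Rle_trans with (M * (rho / R) ^ S k).
    - apply Rmult_le_compat_r; [apply pow_le; lra|exact HM].
    - apply Rmult_le_compat_l; [exact HM0|]. simpl. nra. }
  intros eps He.
  exists (Rmin (rho - Cmod z) (eps / (K + 1))). split.
  { apply Rmin_pos; [lra|]. apply Rdiv_lt_0_compat; lra. }
  intros y Hy.
  destruct (Rlt_Rmin _ _ _ Hy) as [Y1 Y2].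
  pose proof (Cmod_triangle_rev y z).
  eapply Rle_trans; [apply Hest; lra|]. rewrite <- Rmult_assoc.
  apply Rmult_le_compat_r; [apply Cmod_ge_0|].
  pose proof (Cmod_ge_0 (y - z)%C).
  apply Rle_trans with ((K + 1) * (eps / (K + 1))).
  - apply Rmult_le_compat; lra.
  - right. field. lra.
Qed.

Lemma ps_holD (a : nat -> C) (f : C -> C) : ps a f -> holD f.
Proof.
  intros H. destruct (ps_ex (shift_deriv a)) as [f' Hf'].
  - apply growth_shift_deriv, H.
  - apply Cder_holD. intros z Hz. exists (f' z). apply (ps_Cder a f f' z H Hf' Hz).
Qed.

Lemma circ_psum (g : nat -> C -> C) (r : R) (l : nat -> C) (N : nat) :
  (forall k, circ (g k) r (l k)) -> circ (fun w => psum (fun k => g k w) N) r (psum l N).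
Proof.
  intros H. induction N as [|N IH].
  - pose proof (isI_const 0%C 0 (2 * PI)) as E. rewrite Cmult_0_r in E. exact E.
  - apply isI_plus; [exact IH|apply H].
Qed.

Lemma geom_identity (x : C) (N : nat) :
  ((1 - x) * psum (fun k => x ^ k) N)%C = (1 - x ^ N)%C.
Proof.
  induction N as [|N IH]; [simpl; ring|]. cbn [psum].
  rewrite Cmult_plus_distr_l, IH, Cpow_S. ring.
Qed.

Lemma holD_Ccont (f : C -> C) (z : C) : holD f -> inD z -> Ccont f z.
Proof. intros H Hz. destruct (holD_Cder f z H Hz) as [l Hl]. apply (Cder_cont f z l Hl). Qed.

Lemma holD_circ_bounded (f : C -> C) (r : R) : holD f -> 0 < r < 1 ->
  exists M, forall t, 0 <= t <= 2 * PI -> Cmod (f (polar r t)) <= M.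
Proof.
  intros Hf Hr. pose proof two_PI_pos.
  destruct (continuity_ab_maj (fun t => Cmod (f (polar r t))) 0 (2 * PI)) as [t0 [Ht0 _]].
  - lra.
  - intros t _.
    assert (Hc : contR (fun t => f (polar r t)) t).
    { apply contR_polar; [lra|]. apply holD_Ccont; [exact Hf|].
      unfold inD. rewrite Cmod_polar; lra. }
    intros eps He. destruct (Hc (eps / 2)) as [d [Hd Hu]]; [lra|].
    exists d. split; [exact Hd|]. intros u [_ Hut]. simpl in *. unfold Rdist in *.
    specialize (Hu u Hut).
    pose proof (Cmod_triangle_rev (f (polar r u)) (f (polar r t))).
    pose proof (Cmod_triangle_rev (f (polar r t)) (f (polar r u))).
    rewrite Cmod_minus_sym in H1. apply Rabs_def1; lra.
  - exists (Cmod (f (polar r t0))). intros t Ht. apply Ht0, Ht.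
Qed.

(** Put x = z / w. The kernel of [cauchy_quot] is (f(w) - f(z)) / (1 - x), and its truncated
    geometric expansion differs from it by a term of order |x|^N. Since the kernel integrates to 0,
    integrating the truncation leaves the partial sums of the series minus f(z): only the power w^0
    has a nonzero mean, which isolates f(z). *)
Lemma cauchy_expansion (f : C -> C) (r : R) : holD f -> 0 < r < 1 ->
  exists a : nat -> C,
    (forall M, (forall z, Cmod z = r -> Cmod (f z) <= M) -> forall k, Cmod (a k) * r ^ k <= M) /\
    (exists M, forall k, Cmod (a k) * r ^ k <= M) /\
    forall z, Cmod z < r -> sums (fun k => a k * z ^ k)%C (f z).
Proof.
  intros Hf Hr. pose proof two_PI_pos as Hpi.
  assert (HI : forall k, exists l, circ (fun w => f w * / w ^ k)%C r l).
  { intros k. apply circ_ex; [lra|]. intros w Hw.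
    assert (Hw0 : w <> 0%C) by (apply Cmod_gt_0; lra).
    destruct (holD_Cder f w Hf) as [l Hl]; [unfold inD; lra|].
    assert (Hp : exists l', Cder (fun w => w ^ k)%C w l').
    { clear -k. induction k as [|k [l' IH]].
      - exists 0%C. exact (Cder_const 1%C w).
      - eexists. apply (Cder_ext_loc (fun w => w * w ^ k)%C _ w _ 1); [lra| |].
        + intros y _. rewrite Cpow_S. reflexivity.
        + apply Cder_mult; [apply Cder_id|exact IH]. }
    destruct Hp as [l' Hl'].
    destruct (Cder_div f (fun w => w ^ k)%C w l l' Hl Hl') as [d Hd].
    { apply Cpow_nz, Hw0. }
    apply (Cder_cont _ _ d Hd). }
  set (I := fun k => proj1_sig (constructive_indefinite_description _ (HI k))).
  assert (HIs : forall k, circ (fun w => f w * / w ^ k)%C r (I k)).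
  { intros k. exact (proj2_sig (constructive_indefinite_description _ (HI k))). }
  exists (fun k => / RtoC (2 * PI) * I k)%C.
  assert (Hpi0 : RtoC (2 * PI) <> 0%C) by (intros E; apply RtoC_inj in E; lra).
  assert (Hbd : forall M, (forall t, 0 <= t <= 2 * PI -> Cmod (f (polar r t)) <= M) ->
    forall k, Cmod (/ RtoC (2 * PI) * I k)%C * r ^ k <= M).
  { intros M HM k.
    assert (Prk : 0 < r ^ k) by (apply pow_lt; lra).
    assert (B : Cmod (I k) <= (2 * PI - 0) * (M * / r ^ k)).
    { apply (isI_bound (fun t => f (polar r t) * / polar r t ^ k)%C); [lra| |apply HIs].
      intros t Ht. rewrite Cmod_mult, Cmod_inv, Cmod_pow, Cmod_polar by
        (try lra; apply Cpow_nz, Cmod_gt_0; rewrite Cmod_polar; lra).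
      apply Rmult_le_compat_r; [left; apply Rinv_0_lt_compat, Prk|apply HM, Ht]. }
    rewrite Cmod_mult, Cmod_inv, Cmod_R, Rabs_pos_eq by (lra || assumption).
    apply Rle_trans with (/ (2 * PI) * ((2 * PI - 0) * (M * / r ^ k)) * r ^ k).
    - apply Rmult_le_compat_r; [lra|]. apply Rmult_le_compat_l; [|exact B].
      left. apply Rinv_0_lt_compat. exact Hpi.
    - right. field. lra. }
  destruct (holD_circ_bounded f r Hf Hr) as [M HM].
  split; [|split].
  - intros M' HM' k. apply Hbd. intros t _. apply HM', Cmod_polar. lra.
  - exists M. apply Hbd, HM.
  - intros z Hz. pose proof (Cmod_ge_0 z) as Pz.
    set (q := Cmod z / r).
    assert (Hq : 0 <= q < 1) by (apply ratio_lt_1; lra).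
    set (B := M + Cmod (f z)).
    assert (HM0 : 0 <= M) by (eapply Rle_trans; [apply Cmod_ge_0|apply (HM 0); lra]).
    assert (HB : 0 <= B) by (pose proof (Cmod_ge_0 (f z)); unfold B; lra).
    set (e := fun k : nat => match k with O => RtoC (2 * PI) | _ => 0%C end).
    assert (Hk : forall N, circ (fun w => psum (fun k => z ^ k * (f w * / w ^ k - f z * / w ^ k)) N)%C r
      (psum (fun k => z ^ k * (I k - f z * e k)) N)%C).
    { intros N. apply (circ_psum (fun k w => z ^ k * (f w * / w ^ k - f z * / w ^ k))%C).
      intros k. apply isI_scal, isI_minus; [apply HIs|]. apply isI_scal, circ_pow. lra. }
    assert (He : forall N, psum (fun k => z ^ k * (I k - f z * e k))%C (S N) =
      (psum (fun k => z ^ k * I k)%C (S N) - f z * RtoC (2 * PI))%C).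
    { intros N. rewrite (psum_ext _ (fun k => z ^ k * I k - f z * (z ^ k * e k))%C) by (intros; ring).
      rewrite psum_minus, psum_scal. f_equal. f_equal.
      rewrite psum_shift. rewrite (psum_0 (fun k => z ^ S k * e (S k))%C).
      - simpl. ring.
      - intros k _. simpl. ring. }
    assert (Hrem : forall N, Cmod (psum (fun k => z ^ k * (I k - f z * e k))%C N)
      <= (2 * PI - 0) * (B / (1 - q) * q ^ N)).
    { intros N.
      pose proof (isI_minus _ _ _ _ _ _ (cauchy_quot f z r Hf Hz ltac:(lra)) (Hk N)) as H.
      replace (psum (fun k => z ^ k * (I k - f z * e k))%C N) with
        (- (0 - psum (fun k => z ^ k * (I k - f z * e k)) N))%C by ring.
      rewrite Cmod_opp. refine (isI_bound _ _ _ _ _ _ _ H); [lra|].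
      intros t Ht. set (w := polar r t).
      assert (Hw : Cmod w = r) by (apply Cmod_polar; lra).
      assert (Hw0 : w <> 0%C) by (apply Cmod_gt_0; lra).
      assert (Hwz : (w - z)%C <> 0%C).
      { apply Cminus_eq_contra. intros E. rewrite E in Hw. lra. }
      set (x := (z / w)%C).
      assert (Hx : Cmod x = q) by (unfold x; rewrite Cmod_div, Hw by assumption; reflexivity).
      assert (Hx1 : (1 - x)%C <> 0%C).
      { apply Cminus_eq_contra. intros E. rewrite <- E, Cmod_1 in Hx. lra. }
      replace (w * ((f w - f z) / (w - z)) - psum (fun k => z ^ k * (f w * / w ^ k - f z * / w ^ k)) N)%C
        with ((f w - f z) * (/ (1 - x) * x ^ N))%C.
      - rewrite !Cmod_mult, Cmod_inv, Cmod_pow, Hx by assumption.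
        unfold Rdiv. rewrite !Rmult_assoc. apply Rmult_le_compat.
        + apply Cmod_ge_0.
        + apply Rmult_le_pos; [left; apply Rinv_0_lt_compat, Cmod_gt_0, Hx1|apply pow_le; lra].
        + eapply Rle_trans; [apply Cmod_triangle_minus|]. unfold B.
          apply Rplus_le_compat_r. apply HM, Ht.
        + apply Rmult_le_compat_r; [apply pow_le; lra|].
          pose proof (Cmod_triangle_rev 1%C x) as T. rewrite Cmod_1, Hx in T.
          apply Rinv_le_contravar; lra.
      - rewrite (psum_ext _ (fun k => (f w - f z) * x ^ k)%C).
        + rewrite psum_scal.
          pose proof (geom_identity x N) as G.
          change (((1 - x) * psum (Cpow x) N)%C = (1 - x ^ N)%C) in G.
          replace (x ^ N)%C with (1 - (1 - x) * psum (Cpow x) N)%C by (rewrite G; ring).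
          replace (w * ((f w - f z) / (w - z)))%C with ((f w - f z) * / (1 - x))%C.
          * change (psum (fun k => x ^ k)%C N) with (psum (Cpow x) N). field. exact Hx1.
          * unfold x. field. split; assumption.
        + intros k _. unfold x, Cdiv. rewrite Cpow_mult_l, Cpow_inv by exact Hw0. ring. }
    apply (sums_of_rate _ _ (B / (1 - q) + Cmod (f z)) q Hq). intros N.
    assert (PqN : 0 <= q ^ N) by (apply pow_le; lra).
    assert (PB : 0 <= B / (1 - q)).
    { apply Rmult_le_pos; [exact HB|]. left. apply Rinv_0_lt_compat. lra. }
    destruct N as [|N].
    + simpl. replace (0 - f z)%C with (- f z)%C by ring. rewrite Cmod_opp. lra.
    + specialize (Hrem (S N)). rewrite He in Hrem.
      replace (psum (fun k => / RtoC (2 * PI) * I k * z ^ k)%C (S N) - f z)%C with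
        (/ RtoC (2 * PI) * (psum (fun k => z ^ k * I k) (S N) - f z * RtoC (2 * PI)))%C.
      * rewrite Cmod_mult, Cmod_inv, Cmod_R, Rabs_pos_eq by (lra || assumption).
        apply Rle_trans with (/ (2 * PI) * ((2 * PI - 0) * (B / (1 - q) * q ^ S N))).
        { apply Rmult_le_compat_l; [left; apply Rinv_0_lt_compat, Hpi|exact Hrem]. }
        replace (/ (2 * PI) * ((2 * PI - 0) * (B / (1 - q) * q ^ S N))) with (B / (1 - q) * q ^ S N)
          by (field; lra).
        pose proof (Cmod_ge_0 (f z)). nra.
      * rewrite (psum_ext (fun k => / RtoC (2 * PI) * I k * z ^ k)%C
          (fun k => / RtoC (2 * PI) * (z ^ k * I k))%C) by (intros; ring).
        rewrite psum_scal. field. exact Hpi0.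
Qed.

(** The expansion at each radius converges only up to that radius; local uniqueness identifies all
    of them with the one at radius 1/2. *)
Theorem holD_ps (f : C -> C) : holD f -> exists a, ps a f.
Proof.
  intros Hf. destruct (cauchy_expansion f (1 / 2) Hf) as [a [_ [[M HM] Ha]]]; [lra|].
  assert (Hall : forall r, 0 < r < 1 -> (exists M, forall k, Cmod (a k) * r ^ k <= M) /\
    forall z, Cmod z < r -> sums (fun k => a k * z ^ k)%C (f z)).
  { intros r Hr. destruct (cauchy_expansion f r Hf Hr) as [b [_ [[M' HM'] Hb]]].
    assert (E : forall k, a k = b k).
    { set (rho := Rmin (1 / 2) r).
      assert (R1 : rho <= 1 / 2) by apply Rmin_l. assert (R2 : rho <= r) by apply Rmin_r.
      assert (R0 : 0 < rho) by (apply Rmin_pos; lra).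
      apply (ps_unique_local a b rho (Rmax M M')); [lra| | |].
      - intros k. eapply Rle_trans; [|eapply Rle_trans; [apply (HM k)|apply Rmax_l]].
        apply Rmult_le_compat_l; [apply Cmod_ge_0|]. apply pow_incr. lra.
      - intros k. eapply Rle_trans; [|eapply Rle_trans; [apply (HM' k)|apply Rmax_r]].
        apply Rmult_le_compat_l; [apply Cmod_ge_0|]. apply pow_incr. lra.
      - intros z Hz. exists (f z). split; [apply Ha|apply Hb]; lra. }
    split.
    - exists M'. intros k. rewrite E. apply HM'.
    - intros z Hz. apply (sums_ext (fun k => b k * z ^ k)%C); [intros k; rewrite E; reflexivity|].
      apply Hb, Hz. }
  exists a. split.
  - intros r Hr. apply Hall, Hr.
  - intros z Hz. unfold inD in Hz. pose proof (Cmod_ge_0 z).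
    apply (Hall ((1 + Cmod z) / 2)); lra.
Qed.

Lemma cauchy_estimate (a : nat -> C) (f : C -> C) (r M : R) : ps a f -> 0 < r < 1 ->
  (forall z, Cmod z = r -> Cmod (f z) <= M) -> forall k, Cmod (a k) * r ^ k <= M.
Proof.
  intros Hf Hr HM k. pose proof (ps_holD a f Hf) as Hh.
  destruct (cauchy_expansion f r Hh Hr) as [b [Hb1 [[M' HM'] Hb]]].
  destruct (proj1 Hf r Hr) as [M2 HM2].
  assert (E : forall k, a k = b k).
  { apply (ps_unique_local a b r (Rmax M2 M')); [lra| | |].
    - intros j. eapply Rle_trans; [apply HM2|apply Rmax_l].
    - intros j. eapply Rle_trans; [apply HM'|apply Rmax_r].
    - intros z Hz. exists (f z). split; [apply Hf; unfold inD; lra|apply Hb, Hz]. }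
  rewrite E. apply Hb1, HM.
Qed.

Lemma ps_disc_bounded (a : nat -> C) (f : C -> C) (r : R) : ps a f -> 0 < r < 1 ->
  exists M, forall z, Cmod z <= r -> Cmod (f z) <= M.
Proof.
  intros Hf Hr. destruct (proj1 Hf ((1 + r) / 2)) as [M HM]; [lra|].
  exists (M / (1 - r / ((1 + r) / 2))). intros z Hz.
  apply (ps_bound a f M r ((1 + r) / 2) z Hf); auto; lra.
Qed.

(** * Closure properties of holomorphic functions *)

Lemma holD_plus (f g : C -> C) : holD f -> holD g -> holD (fun z => f z + g z)%C.
Proof.
  intros Hf Hg. apply Cder_holD. intros z Hz.
  destruct (holD_Cder f z Hf Hz) as [l Hl]. destruct (holD_Cder g z Hg Hz) as [l' Hl'].
  exists (l + l')%C. apply Cder_plus; assumption.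
Qed.

Lemma holD_mult (f g : C -> C) : holD f -> holD g -> holD (fun z => f z * g z)%C.
Proof.
  intros Hf Hg. apply Cder_holD. intros z Hz.
  destruct (holD_Cder f z Hf Hz) as [l Hl]. destruct (holD_Cder g z Hg Hz) as [l' Hl'].
  eexists. apply Cder_mult; eassumption.
Qed.

Lemma holD_const (c : C) : holD (fun _ => c).
Proof. apply Cder_holD. intros z _. exists 0%C. apply Cder_const. Qed.

Lemma holD_id : holD (fun z => z).
Proof. apply Cder_holD. intros z _. exists 1%C. apply Cder_id. Qed.

Lemma holD_div (f g : C -> C) : holD f -> holD g -> (forall z, inD z -> g z <> 0%C) ->
  holD (fun z => f z / g z)%C.
Proof.
  intros Hf Hg H0. apply Cder_holD. intros z Hz.
  destruct (holD_Cder f z Hf Hz) as [l Hl]. destruct (holD_Cder g z Hg Hz) as [l' Hl'].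
  apply (Cder_div f g z l l' Hl Hl' (H0 z Hz)).
Qed.

Lemma holD_comp (f g : C -> C) : holD f -> holD g -> (forall z, inD z -> inD (g z)) ->
  holD (fun z => f (g z)).
Proof.
  intros Hf Hg H. apply Cder_holD. intros z Hz.
  destruct (holD_Cder g z Hg Hz) as [l' Hl'].
  destruct (holD_Cder f (g z) Hf (H z Hz)) as [l Hl].
  eexists. apply Cder_comp; eassumption.
Qed.

Lemma holD_psum (g : nat -> C -> C) (N : nat) : (forall k, (k < N)%nat -> holD (g k)) ->
  holD (fun z => psum (fun k => g k z) N).
Proof.
  intros H. induction N as [|N IH]; [exact (holD_const 0%C)|].
  apply (holD_plus (fun z => psum (fun k => g k z) N) (g N)); [|apply H; lia].
  apply IH. intros k Hk. apply H. lia.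
Qed.

(** Each of the k + 1 products is at most Ma Mb R^-k; passing from R to the smaller r absorbs the
    factor k + 1. *)
Lemma growth_conv (a b : nat -> C) : growth a -> growth b -> growth (conv a b).
Proof.
  intros Ha Hb r Hr. set (R := (1 + r) / 2).
  destruct (Ha R) as [Ma HMa]; [unfold R; lra|].
  destruct (Hb R) as [Mb HMb]; [unfold R; lra|].
  assert (HR : 0 < R) by (unfold R; lra).
  assert (Pa : 0 <= Ma) by exact (growth_const_nonneg _ _ _ HMa).
  assert (Pb : 0 <= Mb) by exact (growth_const_nonneg _ _ _ HMb).
  assert (Hq : 0 <= r / R < 1) by (apply ratio_lt_1; unfold R; lra).
  exists (Ma * Mb * (/ (1 - r / R) + 1)). intros k.
  assert (P : 0 < R ^ k) by (apply pow_lt; lra).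
  assert (B : Cmod (conv a b k) * R ^ k <= (INR k + 1) * (Ma * Mb)).
  { unfold conv. rewrite <- S_INR.
    assert (G : forall n, (n <= S k)%nat ->
      Cmod (psum (fun j => a j * b (k - j)%nat)%C n) * R ^ k <= INR n * (Ma * Mb)).
    { induction n as [|n IH]; intros Hn.
      - simpl psum. rewrite Cmod_0. simpl. lra.
      - cbn [psum]. rewrite S_INR, Rmult_plus_distr_r, Rmult_1_l.
        apply Rle_trans with ((Cmod (psum (fun j => a j * b (k - j)%nat)%C n) +
          Cmod (a n * b (k - n)%nat)%C) * R ^ k).
        { apply Rmult_le_compat_r; [lra|apply Cmod_triangle]. }
        rewrite Rmult_plus_distr_r. apply Rplus_le_compat; [apply IH; lia|].
        rewrite Cmod_mult. replace (R ^ k) with (R ^ n * R ^ (k - n)).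
        + replace (Cmod (a n) * Cmod (b (k - n)%nat) * (R ^ n * R ^ (k - n))) with
            ((Cmod (a n) * R ^ n) * (Cmod (b (k - n)%nat) * R ^ (k - n))) by ring.
          apply Rmult_le_compat; [| |apply HMa|apply HMb];
            (apply Rmult_le_pos; [apply Cmod_ge_0|apply pow_le; lra]).
        + rewrite <- pow_add. f_equal. lia. }
    apply G, Nat.le_refl. }
  assert (Q : 0 <= (r / R) ^ k) by (apply pow_le; lra).
  assert (L : (INR k + 1) * (r / R) ^ k <= / (1 - r / R) + 1).
  { pose proof (pow_linear_bound (r / R) k Hq).
    assert ((r / R) ^ k <= 1) by (rewrite <- (pow1 k); apply pow_incr; lra). lra. }
  replace (Cmod (conv a b k) * r ^ k) with (Cmod (conv a b k) * R ^ k * (r / R) ^ k)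
    by (unfold Rdiv; rewrite Rpow_mult_distr, pow_inv; field; lra).
  apply Rle_trans with ((INR k + 1) * (Ma * Mb) * (r / R) ^ k).
  - apply Rmult_le_compat_r; assumption.
  - replace ((INR k + 1) * (Ma * Mb) * (r / R) ^ k) with (Ma * Mb * ((INR k + 1) * (r / R) ^ k)) by ring.
    apply Rmult_le_compat_l; [apply Rmult_le_pos|]; assumption.
Qed.

Lemma ps_mult (a b : nat -> C) (f g : C -> C) : ps a f -> ps b g ->
  ps (conv a b) (fun z => f z * g z)%C.
Proof.
  intros [Ha Hf] [Hb Hg]. split; [apply growth_conv; assumption|].
  intros z Hz. apply sums_conv_ps; auto.
Qed.

(** * Weighted rotations on Taylor coefficients *)

(* The weighted composition operator f |-> m f(b .) acting on Taylor coefficients *)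
Definition Sop (m : nat -> C) (b : C) (f : nat -> C) : nat -> C :=
  conv (fun j => b ^ j * f j)%C m.

(** The pencil s - w S: the resolvent equation at s = mu, w = 1, and the Neumann form 1 - w S at s =
    1. No growth of [f] is demanded. *)
Definition sol (m : nat -> C) (b s w : C) (f g : nat -> C) : Prop :=
  forall k, (s * f k - w * Sop m b f k)%C = g k.

Lemma Sop_last (m : nat -> C) (b : C) (f : nat -> C) (k : nat) :
  Sop m b f k = (psum (fun j => b ^ j * f j * m (k - j)%nat) k + m 0%nat * b ^ k * f k)%C.
Proof. unfold Sop, conv. cbn [psum]. rewrite Nat.sub_diag. ring. Qed.

Lemma Sop_ext (m : nat -> C) (b : C) (f g : nat -> C) (k : nat) :
  (forall j, (j <= k)%nat -> f j = g j) -> Sop m b f k = Sop m b g k.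
Proof.
  intros H. unfold Sop, conv. apply psum_ext. intros j Hj. rewrite H by lia. reflexivity.
Qed.

Lemma Sop_scal (m : nat -> C) (b c : C) (f : nat -> C) (k : nat) :
  Sop m b (fun j => c * f j)%C k = (c * Sop m b f k)%C.
Proof. unfold Sop, conv. rewrite <- psum_scal. apply psum_ext. intros. ring. Qed.

Lemma sol_unique (m : nat -> C) (b s w : C) (f f' g : nat -> C) :
  (forall k, s <> (w * (m 0%nat * b ^ k))%C) ->
  sol m b s w f g -> sol m b s w f' g -> forall k, f k = f' k.
Proof.
  intros Hs Hf Hf' k. induction k as [k IH] using (well_founded_induction Nat.lt_wf_0).
  pose proof (Hf k) as E. rewrite <- (Hf' k), !Sop_last in E.
  rewrite (psum_ext (fun j => b ^ j * f j * m (k - j)%nat)%C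
    (fun j => b ^ j * f' j * m (k - j)%nat)%C) in E.
  2: { intros j Hj. rewrite IH by exact Hj. reflexivity. }
  set (P := psum _ k) in E.
  assert (H0 : (s - w * (m 0%nat * b ^ k))%C <> 0%C) by (apply Cminus_eq_contra, Hs).
  assert (E2 : ((s - w * (m 0%nat * b ^ k)) * f k)%C = ((s - w * (m 0%nat * b ^ k)) * f' k)%C).
  { replace ((s - w * (m 0%nat * b ^ k)) * f k)%C with
      (s * f k - w * (P + m 0%nat * b ^ k * f k) + w * P)%C by ring. rewrite E. ring. }
  replace (f k) with (/ (s - w * (m 0%nat * b ^ k)) * ((s - w * (m 0%nat * b ^ k)) * f k))%C
    by (field; exact H0).
  rewrite E2. field. exact H0.
Qed.

(* Triangularity: the k-th coordinate of the solution only involves the previous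
   ones, so iterating the recursion from 0 stabilizes at stage k + 1. *)
Lemma sol_holo (m g : nat -> C) (b : C) (s w : C -> C) : holD s -> holD w ->
  (forall t k, inD t -> s t <> (w t * (m 0%nat * b ^ k))%C) ->
  exists F : nat -> C -> C, (forall k, holD (F k)) /\
    forall t, inD t -> sol m b (s t) (w t) (fun k => F k t) g.
Proof.
  intros Hs Hw Hne.
  set (X := fix X (n k : nat) (t : C) : C := match n with
    | O => 0%C
    | S n => ((g k + w t * psum (fun j => b ^ j * X n j t * m (k - j)%nat) k)
        / (s t - w t * (m 0%nat * b ^ k)))%C end).
  assert (HX : forall n k, holD (X n k)).
  { induction n as [|n IH]; intros k.
    - exact (holD_const 0%C).
    - simpl X. apply holD_div.
      + apply holD_plus; [apply holD_const|]. apply holD_mult; [exact Hw|].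
        apply (holD_psum (fun j t => b ^ j * X n j t * m (k - j)%nat)%C). intros j _.
        apply holD_mult; [|apply holD_const]. apply holD_mult; [apply holD_const|apply IH].
      + apply Cder_holD. intros z Hz.
        destruct (holD_Cder s z Hs Hz) as [l Hl]. destruct (holD_Cder w z Hw Hz) as [l' Hl'].
        eexists. apply Cder_minus; [exact Hl|].
        apply Cder_mult; [exact Hl'|apply Cder_const].
      + intros z Hz. apply Cminus_eq_contra, Hne, Hz. }
  assert (Hst : forall k n p t, (k < n)%nat -> (k < p)%nat -> X n k t = X p k t).
  { intros k. induction k as [k IH] using (well_founded_induction Nat.lt_wf_0).
    intros n p t Hn Hp. destruct n as [|n]; [lia|]. destruct p as [|p]; [lia|].
    simpl X. f_equal. f_equal. f_equal. apply psum_ext. intros j Hj.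
    rewrite (IH j Hj n p t) by lia. reflexivity. }
  exists (fun k => X (S k) k). split; [intros k; apply HX|].
  intros t Ht k. rewrite Sop_last.
  assert (H0 : (s t - w t * (m 0%nat * b ^ k))%C <> 0%C) by (apply Cminus_eq_contra, Hne, Ht).
  assert (E : ((s t - w t * (m 0%nat * b ^ k)) * X (S k) k t)%C =
    (g k + w t * psum (fun j => b ^ j * X (S j) j t * m (k - j)%nat) k)%C).
  { simpl X at 1.
    rewrite (psum_ext (fun j => b ^ j * X k j t * m (k - j)%nat)%C
      (fun j => b ^ j * X (S j) j t * m (k - j)%nat)%C).
    - field. exact H0.
    - intros j Hj. rewrite (Hst j k (S j) t) by lia. reflexivity. }
  set (P := psum _ k) in *.
  replace (s t * X (S k) k t - w t * (P + m 0%nat * b ^ k * X (S k) k t))%C with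
    ((s t - w t * (m 0%nat * b ^ k)) * X (S k) k t - w t * P)%C by ring.
  rewrite E. ring.
Qed.

Lemma sol_ex (m g : nat -> C) (b s w : C) :
  (forall k, s <> (w * (m 0%nat * b ^ k))%C) -> exists f, sol m b s w f g.
Proof.
  intros H. destruct (sol_holo m g b (fun _ => s) (fun _ => w)) as [F [_ HF]].
  - apply holD_const.
  - apply holD_const.
  - intros t k _. apply H.
  - exists (fun k => F k 0%C). apply (HF 0%C). unfold inD. rewrite Cmod_0. lra.
Qed.

(** * Operations on coefficient sequences *)

Lemma growth_scal (c : C) (a : nat -> C) : growth a -> growth (fun k => c * a k)%C.
Proof.
  intros Ha r Hr. destruct (Ha r Hr) as [M HM]. exists (Cmod c * M). intros k.
  rewrite Cmod_mult, Rmult_assoc. apply Rmult_le_compat_l; [apply Cmod_ge_0|apply HM].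
Qed.

Lemma growth_plus (a b : nat -> C) : growth a -> growth b -> growth (fun k => a k + b k)%C.
Proof.
  intros Ha Hb r Hr. destruct (Ha r Hr) as [M HM]. destruct (Hb r Hr) as [M' HM'].
  exists (M + M'). intros k. specialize (HM k). specialize (HM' k).
  pose proof (Cmod_triangle (a k) (b k)). assert (0 <= r ^ k) by (apply pow_le; lra).
  apply Rle_trans with ((Cmod (a k) + Cmod (b k)) * r ^ k); [apply Rmult_le_compat_r; assumption|lra].
Qed.

Lemma ps_plus (a b : nat -> C) (f g : C -> C) : ps a f -> ps b g ->
  ps (fun k => a k + b k)%C (fun z => f z + g z)%C.
Proof.
  intros [Ha Hf] [Hb Hg]. split; [apply growth_plus; assumption|]. intros z Hz.
  apply (sums_ext (fun k => a k * z ^ k + b k * z ^ k)%C); [intros; ring|].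
  apply sums_plus; auto.
Qed.

Lemma ps_scal (c : C) (a : nat -> C) (f : C -> C) : ps a f ->
  ps (fun k => c * a k)%C (fun z => c * f z)%C.
Proof.
  intros [Ha Hf]. split; [apply growth_scal, Ha|]. intros z Hz.
  apply (sums_ext (fun k => c * (a k * z ^ k))%C); [intros; ring|]. apply sums_scal, Hf, Hz.
Qed.

Lemma ps_psum (a : nat -> nat -> C) (f : nat -> C -> C) (N : nat) :
  (forall j, (j < N)%nat -> ps (a j) (f j)) ->
  ps (fun k => psum (fun j => a j k) N) (fun z => psum (fun j => f j z) N).
Proof.
  intros H. induction N as [|N IH].
  - split.
    + intros r Hr. exists 0. intros k. simpl. rewrite Cmod_0. lra.
    + intros z Hz eps He. exists O. intros n _. rewrite psum_0; [|intros; simpl; ring].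
      simpl. replace (0 - 0)%C with (RtoC 0) by ring. rewrite Cmod_0. lra.
  - apply (ps_plus (fun k => psum (fun j => a j k) N) (a N) (fun z => psum (fun j => f j z) N) (f N)).
    + apply IH. intros j Hj. apply H. lia.
    + apply H. lia.
Qed.

(** Multiplication by the variable, on coefficients. *)
Definition delay (a : nat -> C) (k : nat) : C := match k with O => 0%C | S k => a k end.

Lemma growth_delay (a : nat -> C) : growth a -> growth (delay a).
Proof.
  intros Ha r Hr. destruct (Ha r Hr) as [M HM].
  assert (HM0 : 0 <= M) by exact (growth_const_nonneg _ _ _ HM).
  exists M. intros [|k]; simpl.
  - rewrite Cmod_0. lra.
  - specialize (HM k). assert (0 <= r ^ k) by (apply pow_le; lra).
    pose proof (Cmod_ge_0 (a k)). assert (0 <= Cmod (a k) * r ^ k) by (apply Rmult_le_pos; assumption).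
    nra.
Qed.

Lemma ps_delay (a : nat -> C) (f : C -> C) : ps a f -> ps (delay a) (fun z => z * f z)%C.
Proof.
  intros [Ha Hf]. split; [apply growth_delay, Ha|]. intros z Hz.
  replace (z * f z)%C with (delay a 0 * z ^ 0 + z * f z)%C by (simpl; ring).
  apply (sums_shift (fun k => delay a k * z ^ k)%C).
  apply (sums_ext (fun k => z * (a k * z ^ k))%C); [intros k; rewrite Cpow_S; simpl; ring|].
  apply sums_scal, Hf, Hz.
Qed.

Definition delta0 (c : C) (k : nat) : C := match k with O => c | _ => 0%C end.

Lemma growth_delta0 (c : C) : growth (delta0 c).
Proof.
  intros r Hr. exists (Cmod c). intros [|k]; simpl.
  - lra.
  - rewrite Cmod_0, Rmult_0_l. apply Cmod_ge_0.
Qed.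

Lemma ps_const (c : C) : ps (delta0 c) (fun _ => c).
Proof.
  split; [apply growth_delta0|]. intros z Hz eps He. exists 1%nat. intros n Hn.
  destruct n as [|n]; [lia|]. rewrite psum_shift, psum_0; [|intros; simpl; ring].
  simpl. replace (c * 1 + 0 - c)%C with (RtoC 0) by ring. rewrite Cmod_0. lra.
Qed.

Lemma ps_at_0 (a : nat -> C) (f : C -> C) : ps a f -> f 0%C = a 0%nat.
Proof.
  intros [_ Hf]. assert (H0 : inD 0%C) by (unfold inD; rewrite Cmod_0; lra).
  apply (sums_unique _ _ _ (Hf 0%C H0)).
  intros eps He. exists 1%nat. intros n Hn. destruct n as [|n]; [lia|].
  rewrite psum_shift, psum_0.
  - simpl. replace (a 0%nat * 1 + 0 - a 0%nat)%C with (RtoC 0) by ring. rewrite Cmod_0. lra.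
  - intros k _. rewrite Cpow_S. ring.
Qed.

(* Expansion at t = 0 of the resolvent (1 - c t S)^-1 g *)
Lemma sol_expansion (m g : nat -> C) (b c : C) (F : nat -> C -> C) :
  (forall k, holD (F k)) ->
  (forall t, inD t -> sol m b 1 (c * t) (fun k => F k t) g) ->
  forall k, ps (fun n => c ^ n * Nat.iter n (Sop m b) g k)%C (F k).
Proof.
  intros HF Hsol.
  assert (HA : forall k, exists a, ps a (F k)) by (intros k; apply holD_ps, HF).
  set (A := fun k => proj1_sig (constructive_indefinite_description _ (HA k))).
  assert (HAk : forall k, ps (A k) (F k))
    by (intros k; exact (proj2_sig (constructive_indefinite_description _ (HA k)))).
  (* Compares the coefficients of t^n in the identity F_k = g_k + c t (S F)_k. *)
  assert (Hrec : forall k n, A k n =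
    (delta0 (g k) n + c * delay (fun n => Sop m b (fun j => A j n) k) n)%C).
  { intros k. refine (ps_unique _ _ _ _ (HAk k) _ _).
    - apply ps_plus; [apply ps_const|]. apply ps_scal, ps_delay.
      refine (ps_psum (fun j n => b ^ j * A j n * m (k - j)%nat)%C
        (fun j t => b ^ j * F j t * m (k - j)%nat)%C (S k) _).
      intros j _. apply (ps_ext (fun n => (b ^ j * m (k - j)%nat) * A j n)%C _
        (fun t => (b ^ j * m (k - j)%nat) * F j t)%C).
      + intros n. ring.
      + intros z _. ring.
      + apply ps_scal, HAk.
    - intros t Ht. pose proof (Hsol t Ht k) as E. unfold Sop, conv in E.
      rewrite <- E. ring. }
  assert (Hn : forall n k, A k n = (c ^ n * Nat.iter n (Sop m b) g k)%C).
  { induction n as [|n IH]; intros k; rewrite Hrec; simpl delta0; simpl delay.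
    - simpl. ring.
    - rewrite (Sop_ext m b (fun j => A j n) (fun j => c ^ n * Nat.iter n (Sop m b) g j)%C)
        by (intros; apply IH).
      rewrite Sop_scal, Cpow_S. simpl Nat.iter. ring. }
  intros k. apply (ps_ext (A k) _ (F k) (F k)); [intros n; apply Hn|intros z _; reflexivity|apply HAk].
Qed.

(** * Power bounds and resolvent bounds *)

Definition power_bounded (m : nat -> C) (b : C) (q : R) : Prop :=
  forall g, growth g -> forall r, 0 < r < 1 -> exists M, forall n k,
    Cmod (Nat.iter n (Sop m b) g k) * r ^ k <= M * q ^ n.

(** [f] ranges over all formal solutions, so the bounds for all r are also what places the formal
    solution in Hol(D). *)
Definition resolvent_bounded (m : nat -> C) (b : C) (E : C -> Prop) : Prop :=
  forall g, growth g -> forall r, 0 < r < 1 -> exists M, forall mu, E mu ->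
    forall f, sol m b mu 1 f g -> forall k, Cmod (f k) * r ^ k <= M.

Lemma Cmod_pow_1 (b : C) (k : nat) : Cmod b = 1 -> Cmod (b ^ k)%C = 1.
Proof. intros H. rewrite Cmod_pow, H. apply pow1. Qed.

Lemma sol_1_ne (m : nat -> C) (b w : C) (k : nat) : Cmod b = 1 ->
  Cmod w * Cmod (m 0%nat) < 1 -> RtoC 1 <> (w * (m 0%nat * b ^ k))%C.
Proof.
  intros Hb H E. pose proof Cmod_1 as H1. rewrite E, !Cmod_mult, Cmod_pow_1 in H1 by exact Hb. lra.
Qed.

(** Taylor expansion is available on the unit disc only. The scaling [c] carries that disc of [t]
    into the region |w| |m_0| < 1, where the diagonal of 1 - w S does not vanish. *)
Lemma sol_expansion_ex (m g : nat -> C) (b c : C) : Cmod b = 1 ->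
  Cmod c * Cmod (m 0%nat) <= 1 ->
  exists F : nat -> C -> C,
    (forall t, inD t -> sol m b 1 (c * t) (fun k => F k t) g) /\
    (forall k, ps (fun n => c ^ n * Nat.iter n (Sop m b) g k)%C (F k)).
Proof.
  intros Hb Hc.
  destruct (sol_holo m g b (fun _ => 1%C) (fun t => c * t)%C) as [F [HF Hs]].
  - apply holD_const.
  - apply holD_mult; [apply holD_const|apply holD_id].
  - intros t k Ht. apply sol_1_ne; [exact Hb|]. unfold inD in Ht. rewrite Cmod_mult.
    pose proof (Cmod_ge_0 t). pose proof (Cmod_ge_0 c). pose proof (Cmod_ge_0 (m 0%nat)).
    assert (0 <= Cmod c * Cmod (m 0%nat)) by (apply Rmult_le_pos; assumption). nra.
  - exists F. split; [exact Hs|]. apply sol_expansion; assumption.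
Qed.

(** Cauchy's estimate for the n-th coefficient in t = p w, with p between |m_0| and rho. The circle
    |t| = p / rho lies inside the unit disc and corresponds, under w = 1 / mu, to |mu| = rho. *)
Lemma power_bounded_of_circle (m : nat -> C) (b : C) (rho : R) : Cmod b = 1 ->
  Cmod (m 0%nat) < rho -> resolvent_bounded m b (fun mu => Cmod mu = rho) ->
  power_bounded m b rho.
Proof.
  intros Hb Hm HR g Hg r Hr. pose proof (Cmod_ge_0 (m 0%nat)) as Pm.
  set (p := (Cmod (m 0%nat) + rho) / 2). assert (Hp : Cmod (m 0%nat) < p < rho) by (unfold p; lra).
  set (c := (/ RtoC p)%C).
  assert (Hp0 : RtoC p <> 0%C) by (intros E; apply RtoC_inj in E; lra).
  assert (Hc : Cmod c = / p) by (unfold c; rewrite Cmod_inv, Cmod_R, Rabs_pos_eq by (assumption || lra); reflexivity).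
  destruct (sol_expansion_ex m g b c Hb) as [F [Hs HF]].
  { rewrite Hc. apply Rmult_le_reg_l with p; [lra|]. rewrite <- Rmult_assoc, Rinv_r by lra. lra. }
  destruct (HR g Hg r Hr) as [M HM]. exists (M * rho). intros n k.
  assert (Prk : 0 < r ^ k) by (apply pow_lt; lra).
  assert (Hq : 0 < p / rho < 1).
  { split; [apply Rdiv_lt_0_compat; lra|]. apply ratio_lt_1; lra. }
  assert (Hcirc : forall t, Cmod t = p / rho -> Cmod (F k t) <= M * rho * / r ^ k).
  { intros t Ht. assert (Ht0 : t <> 0%C) by (apply Cmod_gt_0; lra).
    assert (HtD : inD t) by (unfold inD; lra).
    set (w := (c * t)%C).
    assert (Hw : Cmod w = / rho) by (unfold w; rewrite Cmod_mult, Hc, Ht; field; lra).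
    assert (Hw0 : w <> 0%C) by (apply Cmod_gt_0; rewrite Hw; apply Rinv_0_lt_compat; lra).
    assert (HE : Cmod (/ w)%C = rho) by (rewrite Cmod_inv, Hw by exact Hw0; apply Rinv_inv).
    assert (Hsol : sol m b (/ w) 1 (fun k => w * F k t)%C g).
    { intros j. rewrite Sop_scal, <- (Hs t HtD j). fold w. field. exact Hw0. }
    specialize (HM (/ w)%C HE _ Hsol k). cbv beta in HM. rewrite Cmod_mult, Hw in HM.
    apply Rmult_le_reg_r with (r ^ k); [exact Prk|].
    apply Rmult_le_reg_l with (/ rho); [apply Rinv_0_lt_compat; lra|].
    replace (/ rho * (M * rho * / r ^ k * r ^ k)) with M by (field; lra). lra. }
  pose proof (cauchy_estimate _ _ _ _ (HF k) Hq Hcirc n) as B.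
  cbv beta in B. rewrite Cmod_mult, Cmod_pow, Hc in B.
  assert (Pn : 0 < rho ^ n) by (apply pow_lt; lra).
  assert (Pp : 0 < p ^ n) by (apply pow_lt; lra).
  replace ((/ p) ^ n * Cmod (Nat.iter n (Sop m b) g k) * (p / rho) ^ n) with
    (Cmod (Nat.iter n (Sop m b) g k) * / rho ^ n) in B.
  2: { unfold Rdiv. rewrite Rpow_mult_distr, !pow_inv. field. lra. }
  apply Rmult_le_reg_r with (/ rho ^ n); [apply Rinv_0_lt_compat, Pn|].
  apply Rmult_le_reg_r with (/ r ^ k); [apply Rinv_0_lt_compat, Prk|].
  replace (Cmod (Nat.iter n (Sop m b) g k) * r ^ k * / rho ^ n * / r ^ k) with
    (Cmod (Nat.iter n (Sop m b) g k) * / rho ^ n) by (field; lra).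
  replace (M * rho * rho ^ n * / rho ^ n * / r ^ k) with (M * rho * / r ^ k) by (field; lra).
  exact B.
Qed.

(** By uniqueness the formal solution is the sum of w^n S^n g, a series dominated by a geometric one
    of ratio omega q. *)
Lemma neumann_bounded (m : nat -> C) (b : C) (q omega : R) : Cmod b = 1 ->
  Cmod (m 0%nat) <= q -> 0 <= omega -> omega * q < 1 -> power_bounded m b q ->
  forall g, growth g -> forall r, 0 < r < 1 -> exists M, forall w, Cmod w <= omega ->
    forall f, sol m b 1 w f g -> forall k, Cmod (f k) * r ^ k <= M.
Proof.
  intros Hb Hq Ho Hoq HP g Hg r Hr. pose proof (Cmod_ge_0 (m 0%nat)) as Pm.
  (* A scale strictly above omega puts w / o' inside the unit disc, while o' q <= 1 keeps the
     diagonal nonzero there. If q = 0 then m_0 = 0 and any larger scale will do. *)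
  assert (Hom : exists o', omega < o' /\ o' * q <= 1 /\ 0 < o').
  { destruct (Rle_lt_or_eq_dec 0 q) as [L|E]; [lra| |].
    - exists (/ q). split; [|split].
      + apply Rmult_lt_reg_r with q; [exact L|]. rewrite Rinv_l; lra.
      + rewrite Rinv_l; lra.
      + apply Rinv_0_lt_compat, L.
    - exists (omega + 1). subst q. lra. }
  destruct Hom as [o' [O1 [O2 O3]]].
  assert (Ho0 : RtoC o' <> 0%C) by (intros E; apply RtoC_inj in E; lra).
  destruct (sol_expansion_ex m g b (RtoC o') Hb) as [F [Hs HF]].
  { rewrite Cmod_R, Rabs_pos_eq by lra.
    apply Rle_trans with (o' * q); [apply Rmult_le_compat_l; lra|exact O2]. }
  destruct (HP g Hg r Hr) as [M HM].
  exists (M / (1 - omega * q)). intros w Hw f Hf k.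
  assert (Prk : 0 < r ^ k) by (apply pow_lt; lra).
  set (t := (w / RtoC o')%C).
  assert (Ht : Cmod t = Cmod w / o').
  { unfold t. rewrite Cmod_div, Cmod_R, Rabs_pos_eq by (assumption || lra). reflexivity. }
  pose proof (Cmod_ge_0 w) as Pw.
  assert (HtD : inD t) by (unfold inD; rewrite Ht; apply ratio_lt_1; lra).
  assert (Ew : (RtoC o' * t)%C = w) by (unfold t; field; exact Ho0).
  assert (Ef : f k = F k t).
  { apply (sol_unique m b 1 w f (fun k => F k t) g).
    - intros j. apply sol_1_ne; [exact Hb|].
      apply Rle_lt_trans with (omega * q); [apply Rmult_le_compat; lra|exact Hoq].
    - exact Hf.
    - rewrite <- Ew. apply Hs, HtD. }
  rewrite Ef.
  assert (Hoq0 : 0 <= omega * q) by (apply Rmult_le_pos; lra).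
  apply Rmult_le_reg_r with (/ r ^ k); [apply Rinv_0_lt_compat, Prk|].
  replace (Cmod (F k t) * r ^ k * / r ^ k) with (Cmod (F k t)) by (field; lra).
  replace (M / (1 - omega * q) * / r ^ k) with (M * / r ^ k / (1 - omega * q)) by (field; lra).
  apply (sums_bound (fun n => RtoC o' ^ n * Nat.iter n (Sop m b) g k * t ^ n)%C _ _ (omega * q)).
  - lra.
  - intros n.
    replace (RtoC o' ^ n * Nat.iter n (Sop m b) g k * t ^ n)%C with
      (w ^ n * Nat.iter n (Sop m b) g k)%C by (rewrite <- Ew, Cpow_mult_l; ring).
    rewrite Cmod_mult, Cmod_pow, Rpow_mult_distr. specialize (HM n k).
    apply Rmult_le_reg_r with (r ^ k); [exact Prk|].
    replace (M * / r ^ k * (omega ^ n * q ^ n) * r ^ k) with (omega ^ n * (M * q ^ n)) by (field; lra).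
    rewrite Rmult_assoc. apply Rmult_le_compat.
    + apply pow_le; lra.
    + apply Rmult_le_pos; [apply Cmod_ge_0|lra].
    + apply pow_incr. lra.
    + exact HM.
  - apply (HF k), HtD.
Qed.

Lemma resolvent_bounded_outside (m : nat -> C) (b : C) (q rho : R) : Cmod b = 1 ->
  Cmod (m 0%nat) <= q -> q < rho -> power_bounded m b q ->
  resolvent_bounded m b (fun mu => rho <= Cmod mu).
Proof.
  intros Hb Hq Hrho HP g Hg r Hr. pose proof (Cmod_ge_0 (m 0%nat)) as Pm.
  assert (Pr : 0 < / rho) by (apply Rinv_0_lt_compat; lra).
  destruct (neumann_bounded m b q (/ rho) Hb Hq) with (g := g) (r := r) as [M HM]; auto; try lra.
  { apply Rmult_lt_reg_l with rho; [lra|]. rewrite <- Rmult_assoc, Rinv_r by lra. lra. }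
  exists (M * / rho). intros mu Hmu f Hf k.
  assert (Hmu0 : mu <> 0%C) by (apply Cmod_gt_0; lra).
  specialize (HM (/ mu)%C). rewrite Cmod_inv in HM by exact Hmu0.
  specialize (HM ltac:(apply Rinv_le_contravar; lra) (fun k => mu * f k)%C).
  assert (Hsol : sol m b 1 (/ mu) (fun k => mu * f k)%C g).
  { intros j. rewrite Sop_scal, <- (Hf j). field. exact Hmu0. }
  specialize (HM Hsol k). cbv beta in HM. rewrite Cmod_mult in HM.
  assert (P0 : 0 <= Cmod (f k) * r ^ k) by (apply Rmult_le_pos; [apply Cmod_ge_0|apply pow_le; lra]).
  apply Rmult_le_reg_l with rho; [lra|].
  replace (rho * (M * / rho)) with M by (field; lra).
  apply Rle_trans with (Cmod mu * (Cmod (f k) * r ^ k)); [apply Rmult_le_compat_r; assumption|lra].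
Qed.

(* By the mean value property in the spectral parameter, bounds on |mu| = rho pass to mu = 0. *)
Lemma solvable_at_0 (m : nat -> C) (b : C) (rho : R) : Cmod b = 1 ->
  0 < rho < Cmod (m 0%nat) -> resolvent_bounded m b (fun mu => Cmod mu = rho) ->
  forall g, growth g -> exists f, growth f /\ sol m b 0 1 f g.
Proof.
  intros Hb Hrho HR g Hg.
  (* For |t| < 1 the parameter p t has modulus below |m_0|, so the diagonal does not vanish; the
     circle |t| = rho / p is mapped onto |mu| = rho. *)
  set (p := (rho + Cmod (m 0%nat)) / 2). assert (Hp : rho < p < Cmod (m 0%nat)) by (unfold p; lra).
  destruct (sol_holo m g b (fun t => RtoC p * t)%C (fun _ => 1%C)) as [F [HF Hs]].
  - apply holD_mult; [apply holD_const|apply holD_id].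
  - apply holD_const.
  - intros t k Ht E. unfold inD in Ht.
    assert (E2 : Cmod (RtoC p * t)%C = Cmod (m 0%nat)).
    { rewrite E, !Cmod_mult, Cmod_1, Cmod_pow_1 by exact Hb. ring. }
    rewrite Cmod_mult, Cmod_R, Rabs_pos_eq in E2 by lra. pose proof (Cmod_ge_0 t). nra.
  - assert (HD0 : inD 0%C) by (unfold inD; rewrite Cmod_0; lra).
    exists (fun k => F k 0%C). split.
    + intros r Hr. destruct (HR g Hg r Hr) as [M HM]. exists M. intros k.
      assert (Prk : 0 < r ^ k) by (apply pow_lt; lra).
      destruct (holD_ps (F k) (HF k)) as [a Ha]. rewrite (ps_at_0 a _ Ha).
      assert (Hq : 0 < rho / p < 1).
      { split; [apply Rdiv_lt_0_compat; lra|]. apply ratio_lt_1; lra. }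
      pose proof (cauchy_estimate a (F k) (rho / p) (M * / r ^ k) Ha Hq) as B.
      assert (B0 : Cmod (a 0%nat) <= M * / r ^ k).
      { rewrite <- (Rmult_1_r (Cmod (a 0%nat))). apply (B ltac:(
          intros t Ht; apply Rmult_le_reg_r with (r ^ k); [exact Prk|];
          rewrite Rmult_assoc, Rinv_l, Rmult_1_r by lra;
          apply (HM (RtoC p * t)%C) with (f := fun k => F k t);
          [rewrite Cmod_mult, Cmod_R, Rabs_pos_eq, Ht by lra; field; lra
          |apply (Hs t); unfold inD; lra]) 0%nat). }
      apply Rmult_le_reg_r with (/ r ^ k); [apply Rinv_0_lt_compat, Prk|].
      rewrite Rmult_assoc, Rinv_r, Rmult_1_r by lra. exact B0.
    + pose proof (Hs 0%C HD0) as H. rewrite Cmult_0_r in H. exact H.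
Qed.

(** * The Waelbroeck spectrum of weighted rotations *)

Lemma ps_rot (a : nat -> C) (f : C -> C) (b : C) : Cmod b = 1 -> ps a f ->
  ps (fun j => b ^ j * a j)%C (fun z => f (rot b z)).
Proof.
  intros Hb [Ha Hf]. split.
  - intros r Hr. destruct (Ha r Hr) as [M HM]. exists M. intros k.
    rewrite Cmod_mult, Cmod_pow_1, Rmult_1_l by exact Hb. apply HM.
  - intros z Hz. apply (sums_ext (fun k => a k * (rot b z) ^ k)%C).
    + intros k. unfold rot. rewrite Cpow_mult_l. ring.
    + apply Hf. unfold inD, rot in *. rewrite Cmod_mult, Hb. lra.
Qed.

Lemma ps_wcomp (m f : nat -> C) (mf F : C -> C) (b : C) : Cmod b = 1 ->
  ps m mf -> ps f F -> ps (Sop m b f) (wcomp mf (rot b) F).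
Proof.
  intros Hb Hm Hf.
  apply (ps_ext (Sop m b f) _ (fun z => F (rot b z) * mf z)%C); [reflexivity| |].
  - intros z _. unfold wcomp. ring.
  - apply ps_mult; [apply ps_rot; assumption|exact Hm].
Qed.

Lemma ps_pencil (m f : nat -> C) (mf F : C -> C) (b s w : C) : Cmod b = 1 ->
  ps m mf -> ps f F ->
  ps (fun k => s * f k - w * Sop m b f k)%C (fun z => s * F z - w * wcomp mf (rot b) F z)%C.
Proof.
  intros Hb Hm Hf.
  apply (ps_ext (fun k => s * f k + (- w) * Sop m b f k)%C _
    (fun z => s * F z + (- w) * wcomp mf (rot b) F z)%C).
  - intros k. ring.
  - intros z _. ring.
  - apply ps_plus; apply ps_scal; [exact Hf|apply ps_wcomp; assumption].
Qed.

Lemma sol_pencil_iff (m f g : nat -> C) (mf F G : C -> C) (b s w : C) : Cmod b = 1 ->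
  ps m mf -> ps f F -> ps g G ->
  (sol m b s w f g <-> eqD (fun z => s * F z - w * wcomp mf (rot b) F z)%C G).
Proof.
  intros Hb Hm Hf Hg. pose proof (ps_pencil m f mf F b s w Hb Hm Hf) as Hs. split.
  - intros H. apply (ps_eqD g); [|exact Hg].
    apply (ps_ext _ g _ _ H (fun z _ => eq_refl) Hs).
  - intros H k. apply (ps_unique _ _ _ _ Hs Hg H).
Qed.

Lemma sol_iff (m f g : nat -> C) (mf F G : C -> C) (b l : C) : Cmod b = 1 ->
  ps m mf -> ps f F -> ps g G ->
  (sol m b l 1 f g <-> eqD (shiftop (wcomp mf (rot b)) l F) G).
Proof.
  intros Hb Hm Hf Hg. rewrite (sol_pencil_iff m f g mf F G b l 1 Hb Hm Hf Hg).
  unfold eqD, shiftop. split; intros H z Hz; rewrite <- (H z Hz); ring.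
Qed.

(** Injectivity follows from triangularity alone; only surjectivity asks for growth of the formal
    solution. *)
Lemma in_rho_intro (m : nat -> C) (mf : C -> C) (b l : C) : Cmod b = 1 -> ps m mf ->
  (forall k, l <> (1 * (m 0%nat * b ^ k))%C) ->
  (forall g, growth g -> exists f, growth f /\ sol m b l 1 f g) ->
  in_rho (wcomp mf (rot b)) l.
Proof.
  intros Hb Hm Hl H. split.
  - intros G HG. destruct (holD_ps G HG) as [g Hg].
    destruct (H g (proj1 Hg)) as [f [Hf Hs]]. destruct (ps_ex f Hf) as [F HF].
    exists F. split; [apply (ps_holD f F HF)|]. apply (sol_iff m f g mf F G); assumption.
  - intros F1 F2 H1 H2 E.
    destruct (holD_ps F1 H1) as [f1 Hf1]. destruct (holD_ps F2 H2) as [f2 Hf2].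
    set (g := fun k => (l * f2 k - 1 * Sop m b f2 k)%C).
    assert (Hg : ps g (shiftop (wcomp mf (rot b)) l F2)).
    { refine (ps_ext _ g _ _ (fun k => eq_refl) _ (ps_pencil m f2 mf F2 b l 1 Hb Hm Hf2)).
      intros z _. unfold shiftop. ring. }
    apply (ps_eqD f2); [|exact Hf2].
    apply (ps_ext f1 f2 F1 F1); [|intros z _; reflexivity|exact Hf1].
    apply (sol_unique m b l 1 f1 f2 g Hl).
    + exact (proj2 (sol_iff m f1 g mf F1 _ b l Hb Hm Hf1 Hg) E).
    + intros k. reflexivity.
Qed.

Lemma in_rho_elim (m : nat -> C) (mf : C -> C) (b l : C) : Cmod b = 1 -> ps m mf ->
  in_rho (wcomp mf (rot b)) l ->
  forall g, growth g -> exists f, growth f /\ sol m b l 1 f g.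
Proof.
  intros Hb Hm [H _] g Hg. destruct (ps_ex g Hg) as [G HG].
  destruct (H G (ps_holD g G HG)) as [F [HF E]].
  destruct (holD_ps F HF) as [f Hf]. exists f. split; [apply Hf|].
  apply (sol_iff m f g mf F G b l Hb Hm Hf HG). exact E.
Qed.

Lemma in_rhoW_intro (m : nat -> C) (mf : C -> C) (b l : C) (d : R) : Cmod b = 1 -> ps m mf ->
  0 < d -> (forall mu, Cmod (mu - l)%C <= d -> Cmod mu <> Cmod (m 0%nat)) ->
  resolvent_bounded m b (fun mu => Cmod (mu - l)%C <= d) ->
  in_rhoW (wcomp mf (rot b)) l.
Proof.
  intros Hb Hm Hd Hne HR.
  assert (Hne2 : forall mu, Cmod (mu - l)%C <= d -> forall k, mu <> (1 * (m 0%nat * b ^ k))%C).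
  { intros mu Hmu k E. apply (Hne mu Hmu).
    rewrite E, !Cmod_mult, Cmod_1, Cmod_pow_1 by exact Hb. ring. }
  assert (Hrho : forall mu, Cmod (mu - l)%C <= d -> in_rho (wcomp mf (rot b)) mu).
  { intros mu Hmu. apply (in_rho_intro m mf b mu Hb Hm (Hne2 mu Hmu)).
    intros g Hg. destruct (sol_ex m g b mu 1 (Hne2 mu Hmu)) as [f Hf].
    exists f. split; [|exact Hf]. intros r Hr. destruct (HR g Hg r Hr) as [M HM].
    exists M. apply (HM mu Hmu f Hf). }
  split.
  - apply Hrho. replace (l - l)%C with (RtoC 0) by ring. rewrite Cmod_0. lra.
  - exists d. split; [exact Hd|]. split; [exact Hrho|].
    intros G HG r Hr. destruct (holD_ps G HG) as [g Hg].
    (* A coefficient bound at the larger radius R gives a uniform bound on the disc of radius r. *)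
    set (R := (1 + r) / 2). destruct (HR g (proj1 Hg) R) as [M HM]; [unfold R; lra|].
    exists (M / (1 - r / R)). intros mu Hmu F HF E z Hz.
    destruct (holD_ps F HF) as [f Hf].
    apply (ps_bound f F M r R z Hf); try (unfold R; lra).
    apply (HM mu Hmu). apply (sol_iff m f g mf F G b mu Hb Hm Hf Hg). exact E.
Qed.

(** Here [growth f] must be assumed, because the Waelbroeck condition only bounds holomorphic
    solutions; it is removed later through existence and uniqueness. *)
Lemma in_rhoW_elim (m : nat -> C) (mf : C -> C) (b l : C) : Cmod b = 1 -> ps m mf ->
  in_rhoW (wcomp mf (rot b)) l ->
  exists d, 0 < d /\
    (forall mu, Cmod (mu - l)%C <= d -> in_rho (wcomp mf (rot b)) mu) /\
    forall g, growth g -> forall r, 0 < r < 1 -> exists M,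
      forall mu, Cmod (mu - l)%C <= d -> forall f, growth f -> sol m b mu 1 f g ->
        forall k, Cmod (f k) * r ^ k <= M.
Proof.
  intros Hb Hm [_ [d [Hd [Hrho HB]]]]. exists d. split; [exact Hd|]. split; [exact Hrho|].
  intros g Hg r Hr. destruct (ps_ex g Hg) as [G HG].
  destruct (HB G (ps_holD g G HG) r Hr) as [M HM]. exists M.
  intros mu Hmu f Hf Hs. destruct (ps_ex f Hf) as [F HF].
  apply (cauchy_estimate f F r M HF Hr). intros z Hz.
  apply (HM mu Hmu F (ps_holD f F HF)); [|lra].
  apply (sol_iff m f g mf F G b mu Hb Hm HF HG). exact Hs.
Qed.

(* mu = m_0 b^k is an eigenvalue of the action on Taylor polynomials of degree k. *)
Lemma not_in_rho_eigen (m : nat -> C) (mf : C -> C) (b : C) (k : nat) : Cmod b = 1 -> ps m mf ->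
  (forall n, (1 <= n)%nat -> (b ^ n)%C <> 1%C) -> m 0%nat <> 0%C \/ k = 0%nat ->
  ~ in_rho (wcomp mf (rot b)) (m 0%nat * b ^ k)%C.
Proof.
  intros Hb Hm Hap Hm0 H.
  (* The monomial z^k is not in the range: the lower coordinates of a preimage are forced to vanish,
     and the k-th equation then reads 0 = 1. *)
  set (g := fun j => if Nat.eq_dec j k then RtoC 1 else RtoC 0).
  assert (Hg : growth g).
  { intros r Hr. exists 1. intros j. unfold g.
    assert (0 <= r ^ j <= 1).
    { split; [apply pow_le; lra|]. rewrite <- (pow1 j). apply pow_incr. lra. }
    destruct (Nat.eq_dec j k); rewrite ?Cmod_1, ?Cmod_0; lra. }
  destruct (in_rho_elim m mf b _ Hb Hm H g Hg) as [f [_ Hf]].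
  assert (Hb0 : b <> 0%C) by (apply Cmod_gt_0; lra).
  assert (Hz : forall i, (i < k)%nat -> f i = 0%C).
  { intros i. induction i as [i IH] using (well_founded_induction Nat.lt_wf_0). intros Hi.
    pose proof (Hf i) as E. rewrite Sop_last, psum_0 in E.
    2: { intros j Hj. rewrite IH by lia. ring. }
    unfold g in E. destruct (Nat.eq_dec i k); [lia|].
    destruct Hm0 as [Hm0|Hk]; [|lia].
    assert (Hdiff : (m 0%nat * b ^ k - m 0%nat * b ^ i)%C <> 0%C).
    { replace (m 0%nat * b ^ k - m 0%nat * b ^ i)%C with
        (m 0%nat * (b ^ i * (b ^ (k - i) - 1)))%C.
      - apply Cmult_neq_0; [exact Hm0|]. apply Cmult_neq_0; [apply Cpow_nz, Hb0|].
        apply Cminus_eq_contra, Hap. lia.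
      - replace (b ^ k)%C with (b ^ i * b ^ (k - i))%C; [ring|].
        rewrite <- Cpow_add_r. f_equal. lia. }
    replace (f i) with (/ (m 0%nat * b ^ k - m 0%nat * b ^ i) *
      (m 0%nat * b ^ k * f i - 1 * (0 + m 0%nat * b ^ i * f i)))%C by (field; exact Hdiff).
    rewrite E. ring. }
  pose proof (Hf k) as E. rewrite Sop_last, psum_0 in E.
  2: { intros j Hj. rewrite Hz by exact Hj. ring. }
  unfold g in E. destruct (Nat.eq_dec k k); [|tauto].
  apply C1_nz. rewrite <- E. ring.
Qed.

(** * Density of the orbit of an irrational rotation *)

Lemma unit_angle (u : C) : Cmod u = 1 -> exists t, 0 <= t <= 2 * PI /\ u = cis t.
Proof.
  intros Hu. pose proof PI_RGT_0.
  assert (H2 : fst u * fst u + snd u * snd u = 1).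
  { unfold Cmod in Hu. simpl in Hu. rewrite !Rmult_1_r in Hu.
    rewrite <- (sqrt_sqrt (fst u * fst u + snd u * snd u)) by nra. rewrite Hu. ring. }
  assert (Hx : -1 <= fst u <= 1) by nra.
  pose proof (acos_bound (fst u)) as Hb.
  assert (Hc : cos (acos (fst u)) = fst u) by (apply cos_acos; exact Hx).
  assert (Hs : 0 <= sin (acos (fst u))) by (apply sin_ge_0; lra).
  assert (Hs2 : sin (acos (fst u)) * sin (acos (fst u)) = snd u * snd u).
  { pose proof (sin2_cos2 (acos (fst u))) as S. unfold Rsqr in S. rewrite Hc in S. lra. }
  destruct (Rle_or_lt 0 (snd u)) as [L|L].
  - exists (acos (fst u)). split; [lra|]. destruct u as [x y]; unfold cis; simpl in *.
    rewrite Hc. f_equal. nra.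
  - exists (2 * PI - acos (fst u)). split; [lra|].
    destruct u as [x y]; unfold cis; simpl in *.
    replace (2 * PI - acos x) with (- acos x + 2 * PI) by ring.
    rewrite cos_plus, sin_plus, cos_2PI, sin_2PI, cos_neg, sin_neg, Hc. f_equal; nra.
Qed.

Lemma cis_lip (s t : R) : Cmod (cis s - cis t)%C <= 2 * Rabs (s - t).
Proof.
  pose proof (polar_lip 1 1 t s ltac:(lra)) as H.
  replace (polar 1 s - polar 1 t)%C with (cis s - cis t)%C in H by (unfold polar; ring).
  rewrite Rminus_diag, Rabs_R0 in H. lra.
Qed.

(** The angles of the powers of b have a cluster point. Two powers with angles close to it differ by
    a small rotation, which is not trivial because b is not a root of unity. *)
Lemma small_rotation (b : C) (eps : R) : Cmod b = 1 -> 0 < eps ->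
  (forall n, (1 <= n)%nat -> (b ^ n)%C <> 1%C) ->
  exists (p : nat) (th : R), th <> 0 /\ Rabs th < eps /\ (b ^ p)%C = cis th.
Proof.
  intros Hb He Hap.
  assert (Ha : forall j : nat, exists t, 0 <= t <= 2 * PI /\ (b ^ j)%C = cis t)
    by (intros j; apply unit_angle, Cmod_pow_1, Hb).
  set (u := fun j => proj1_sig (constructive_indefinite_description _ (Ha j))).
  assert (Hu : forall j, 0 <= u j <= 2 * PI /\ (b ^ j)%C = cis (u j))
    by (intros j; exact (proj2_sig (constructive_indefinite_description _ (Ha j)))).
  destruct (Bolzano_Weierstrass u (fun t => 0 <= t <= 2 * PI) (compact_P3 0 (2 * PI))
    (fun j => proj1 (Hu j))) as [l Hl].
  assert (He2 : 0 < eps / 2) by lra.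
  set (V := disc l (mkposreal _ He2)).
  assert (HV : neighbourhood V l) by (exists (mkposreal _ He2); intros y Hy; exact Hy).
  (* The second visit is sought from index i + 1 on, so that j - i is at least 1. *)
  destruct (Hl V 0%nat HV) as [i [_ Hi]]. destruct (Hl V (S i) HV) as [j [Hj Hj']].
  unfold V, disc in Hi, Hj'. simpl in Hi, Hj'.
  assert (E : (b ^ (j - i))%C = cis (u j - u i)).
  { destruct (Hu i) as [_ Ei]. destruct (Hu j) as [_ Ej].
    replace j with (i + (j - i))%nat in Ej at 1 by lia. rewrite Cpow_add_r, Ei in Ej.
    unfold Rminus. rewrite cis_plus, <- cis_inv, <- Ej. field. apply cis_neq_0. }
  exists (j - i)%nat, (u j - u i). split; [|split; [|exact E]].
  - intros Hz. apply (Hap (j - i)%nat ltac:(lia)). rewrite E, Hz. apply cis_0.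
  - replace (u j - u i) with ((u j - l) - (u i - l)) by ring.
    eapply Rle_lt_trans; [apply Rabs_triang|]. rewrite Rabs_Ropp. lra.
Qed.

(** Multiples of a small angle come near every point of the circle within one turn. The bound [J] is
    uniform in [u]: only finitely many powers of b are ever needed. *)
Lemma orbit_dense (b : C) (eps : R) : Cmod b = 1 -> 0 < eps ->
  (forall n, (1 <= n)%nat -> (b ^ n)%C <> 1%C) ->
  exists J : nat, forall u, Cmod u = 1 -> exists j, (j <= J)%nat /\ Cmod (b ^ j - u)%C <= eps.
Proof.
  intros Hb He Hap. pose proof PI_RGT_0 as Hpi.
  destruct (small_rotation b (eps / 2) Hb ltac:(lra) Hap) as [p [th [Hth0 [Hth Hp]]]].
  assert (Hath : 0 < Rabs th) by (apply Rabs_pos_lt, Hth0).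
  destruct (INR_unbounded (2 * PI / Rabs th)) as [N HN].
  exists (p * N)%nat. intros u Hu.
  (* The angle of u is taken with the sign of th, so that t / th is nonnegative and its integer part
     counts the steps. *)
  assert (Ht : exists t, Rabs t <= 2 * PI /\ 0 <= t * th /\ u = cis t).
  { destruct (unit_angle u Hu) as [t [Ht Et]].
    destruct (Rle_or_lt 0 th) as [L|L].
    - exists t. split; [rewrite Rabs_pos_eq; lra|]. split; [apply Rmult_le_pos; lra|exact Et].
    - exists (t - 2 * PI). split; [rewrite Rabs_left1; lra|]. split; [nra|].
      rewrite Et. replace t with ((t - 2 * PI) + 2 * PI) at 1 by ring.
      rewrite cis_plus, cis_2PI. ring. }
  destruct Ht as [t [Ht [Hsg Et]]].
  set (x := t / th).
  assert (Hx0 : 0 <= x).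
  { unfold x. replace (t / th) with (t * th / (th * th)) by (field; exact Hth0).
    apply Rmult_le_pos; [exact Hsg|]. left. apply Rinv_0_lt_compat. nra. }
  assert (HxN : x < INR N).
  { eapply Rle_lt_trans; [|exact HN]. unfold x. rewrite <- (Rabs_pos_eq (t / th)) by exact Hx0.
    unfold Rdiv. rewrite Rabs_mult, Rabs_inv. apply Rmult_le_compat_r; [|exact Ht].
    left. apply Rinv_0_lt_compat, Hath. }
  destruct (nfloor_ex x Hx0) as [k [Hk1 Hk2]].
  exists (p * k)%nat. split.
  - apply Nat.mul_le_mono_l. apply INR_le. lra.
  - rewrite Cpow_mult_r, Hp, cis_pow, Et. eapply Rle_trans; [apply cis_lip|].
    replace (INR k * th - t) with ((INR k - x) * th) by (unfold x; field; exact Hth0).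
    rewrite Rabs_mult.
    assert (Rabs (INR k - x) <= 1) by (apply Rabs_le; lra).
    assert (Rabs (INR k - x) * Rabs th <= 1 * Rabs th) by (apply Rmult_le_compat_r; lra).
    lra.
Qed.

Lemma sigmaW_critical_circle (m : nat -> C) (mf : C -> C) (b l : C) : Cmod b = 1 -> ps m mf ->
  (forall n, (1 <= n)%nat -> (b ^ n)%C <> 1%C) -> Cmod l = Cmod (m 0%nat) ->
  in_sigmaW (wcomp mf (rot b)) l.
Proof.
  intros Hb Hm Hap Hl [Hrho [d [Hd [Hd2 _]]]].
  (* If m_0 = 0 the circle degenerates to l = 0, where constants already fail to be in the range. *)
  destruct (Ceq_dec (m 0%nat) 0%C) as [E|E].
  - rewrite E, Cmod_0 in Hl. apply Cmod_eq_0 in Hl. subst l.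
    apply (not_in_rho_eigen m mf b 0 Hb Hm Hap (or_intror eq_refl)).
    replace (m 0%nat * b ^ 0)%C with (RtoC 0) by (rewrite E; ring). exact Hrho.
  - assert (Pm : 0 < Cmod (m 0%nat)) by (apply Cmod_gt_0, E).
    destruct (orbit_dense b (d / Cmod (m 0%nat)) Hb) as [J HJ]; [apply Rdiv_lt_0_compat; lra|exact Hap|].
    destruct (HJ (l / m 0%nat)%C) as [j [_ Hj]].
    { rewrite Cmod_div, Hl by exact E. field. lra. }
    apply (not_in_rho_eigen m mf b j Hb Hm Hap (or_introl E)). apply Hd2.
    replace (m 0%nat * b ^ j - l)%C with (m 0%nat * (b ^ j - l / m 0%nat))%C by (field; exact E).
    rewrite Cmod_mult. apply Rle_trans with (Cmod (m 0%nat) * (d / Cmod (m 0%nat))).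
    + apply Rmult_le_compat_l; lra.
    + right. field. lra.
Qed.

(** * Multiplication by z^j and rotation of the spectral parameter *)

Fixpoint delays (j : nat) (a : nat -> C) : nat -> C :=
  match j with O => a | S j => delay (delays j a) end.

Lemma growth_delays (j : nat) (a : nat -> C) : growth a -> growth (delays j a).
Proof. intros Ha. induction j as [|j IH]; [exact Ha|apply growth_delay, IH]. Qed.

Lemma delays_add (j : nat) (a : nat -> C) (k : nat) : delays j a (j + k)%nat = a k.
Proof. induction j as [|j IH]; [reflexivity|exact IH]. Qed.

(* S (z f) = b z S f *)
Lemma Sop_delay (m : nat -> C) (b : C) (f : nat -> C) (k : nat) :
  Sop m b (delay f) k = (b * delay (Sop m b f) k)%C.
Proof.
  destruct k as [|k]; unfold Sop, conv.
  - simpl. ring.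
  - rewrite psum_shift.
    change (delay _ (S k)) with (psum (fun j => b ^ j * f j * m (k - j)%nat)%C (S k)).
    rewrite <- psum_scal, (psum_ext _ (fun j => b * (b ^ j * f j * m (k - j)%nat))%C).
    + simpl delay. ring.
    + intros j _. rewrite Cpow_S. simpl. ring.
Qed.

Lemma sol_delays (m : nat -> C) (b mu : C) (f g : nat -> C) (j : nat) :
  sol m b mu 1 f g -> sol m b (mu * b ^ j) 1 (delays j f) (fun k => b ^ j * delays j g k)%C.
Proof.
  intros H. induction j as [|j IH].
  - intros k. simpl. rewrite <- (H k). ring.
  - intros k. simpl delays. rewrite Sop_delay, Cpow_S. destruct k as [|k].
    + simpl. ring.
    + simpl delay. pose proof (IH k) as E.
      replace (b * b ^ j * delays j g k)%C with (b * (b ^ j * delays j g k))%C by ring.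
      rewrite <- E. ring.
Qed.

Lemma finite_max (P : nat -> R -> Prop) (J : nat) :
  (forall j M M', P j M -> M <= M' -> P j M') ->
  (forall j, exists M, P j M) -> exists M, forall j, (j <= J)%nat -> P j M.
Proof.
  intros Hmon H. induction J as [|J [M HM]].
  - destruct (H 0%nat) as [M HM]. exists M. intros j Hj. replace j with 0%nat by lia. exact HM.
  - destruct (H (S J)) as [M' HM']. exists (Rmax M M'). intros j Hj.
    destruct (Nat.eq_dec j (S J)) as [->|n].
    + apply (Hmon _ M'); [exact HM'|apply Rmax_r].
    + apply (Hmon _ M); [apply HM; lia|apply Rmax_l].
Qed.

(* Multiplication by z^j intertwines the equations with parameters mu and mu b^j. *)
Lemma resolvent_bounded_annulus (m : nat -> C) (mf : C -> C) (b l : C) : Cmod b = 1 -> ps m mf ->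
  (forall n, (1 <= n)%nat -> (b ^ n)%C <> 1%C) -> l <> 0%C -> Cmod l <> Cmod (m 0%nat) ->
  in_rhoW (wcomp mf (rot b)) l ->
  exists d, 0 < d /\ resolvent_bounded m b (fun mu => Rabs (Cmod mu - Cmod l) <= d).
Proof.
  intros Hb Hm Hap Hl0 Hlm HW.
  destruct (in_rhoW_elim m mf b l Hb Hm HW) as [d0 [Hd0 [Hrho HB]]].
  assert (Pl : 0 < Cmod l) by (apply Cmod_gt_0, Hl0).
  assert (Pd : 0 < Rabs (Cmod l - Cmod (m 0%nat))) by (apply Rabs_pos_lt; lra).
  (* The three bounds keep the rotated parameter in the given disc, keep mu away from 0, and keep
     |mu| different from |m_0|. *)
  set (d := Rmin (d0 / 2) (Rmin (Cmod l / 2) (Rabs (Cmod l - Cmod (m 0%nat)) / 2))).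
  assert (D1 : d <= d0 / 2) by apply Rmin_l.
  assert (D2 : d <= Cmod l / 2) by (eapply Rle_trans; [apply Rmin_r|apply Rmin_l]).
  assert (D3 : d <= Rabs (Cmod l - Cmod (m 0%nat)) / 2)
    by (eapply Rle_trans; [apply Rmin_r|apply Rmin_r]).
  assert (Hd : 0 < d) by (repeat apply Rmin_pos; lra).
  exists d. split; [exact Hd|].
  (* As |mu| <= |l| + d, approximating a unit number to this precision moves the rotated parameter
     by at most d. *)
  assert (He : 0 < d / (Cmod l + d)) by (apply Rdiv_lt_0_compat; lra).
  destruct (orbit_dense b _ Hb He Hap) as [J HJ].
  intros g Hg r Hr.
  destruct (finite_max (fun j M => forall mu, Cmod (mu - l)%C <= d0 -> forall f, growth f ->
    sol m b mu 1 f (fun k => b ^ j * delays j g k)%C -> forall k, Cmod (f k) * r ^ k <= M) J) as [M HM].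
  { intros j M M' H HMM mu Hmu f Hf Hs k. eapply Rle_trans; [apply (H mu Hmu f Hf Hs)|exact HMM]. }
  { intros j. destruct (HB (fun k => b ^ j * delays j g k)%C) with (r := r) as [M HM]; [|exact Hr|].
    - apply growth_scal, growth_delays, Hg.
    - exists M. exact HM. }
  exists (M / r ^ J). intros mu Hmu f Hf k.
  apply Rabs_le_between in Hmu.
  assert (Pmu : 0 < Cmod mu) by lra.
  assert (Hmu0 : mu <> 0%C) by (apply Cmod_gt_0, Pmu).
  assert (Hl0' : RtoC (Cmod l) <> 0%C) by (intros E; apply RtoC_inj in E; lra).
  (* The exact rotation that brings mu onto the ray through l: mu u = l |mu| / |l|. *)
  set (u := (l * RtoC (Cmod mu) / (RtoC (Cmod l) * mu))%C).
  assert (Hu : Cmod u = 1).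
  { unfold u. rewrite Cmod_div by (apply Cmult_neq_0; assumption).
    rewrite !Cmod_mult, !Cmod_R, !Rabs_pos_eq by lra. field. lra. }
  destruct (HJ u Hu) as [j [HjJ Hj]].
  assert (Hdisc : Cmod (mu * b ^ j - l)%C <= d0).
  { replace (mu * b ^ j - l)%C with (mu * (b ^ j - u) + (mu * u - l))%C by ring.
    eapply Rle_trans; [apply Cmod_triangle|]. rewrite Cmod_mult.
    assert (A1 : Cmod mu * Cmod (b ^ j - u)%C <= (Cmod l + d) * (d / (Cmod l + d))).
    { apply Rmult_le_compat; try apply Cmod_ge_0; [lra|exact Hj]. }
    replace ((Cmod l + d) * (d / (Cmod l + d))) with d in A1 by (field; lra).
    assert (A2 : Cmod (mu * u - l)%C <= d).
    { replace (mu * u - l)%C with (l / RtoC (Cmod l) * RtoC (Cmod mu - Cmod l))%C.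
      - rewrite Cmod_mult, Cmod_div, !Cmod_R, (Rabs_pos_eq (Cmod l)) by (assumption || lra).
        unfold Rdiv. rewrite Rinv_r, Rmult_1_l by lra. apply Rabs_le. lra.
      - unfold u. rewrite RtoC_minus. field. split; assumption. }
    lra. }
  destruct (in_rho_elim m mf b _ Hb Hm (Hrho _ Hdisc) (fun k => b ^ j * delays j g k)%C) as [h [Hh Hhs]].
  { apply growth_scal, growth_delays, Hg. }
  (* [f] is only a formal solution; uniqueness identifies z^j f with the holomorphic solution [h],
     to which the bound applies. *)
  assert (Eh : forall k, delays j f k = h k).
  { apply (sol_unique m b (mu * b ^ j) 1 _ _ (fun k => b ^ j * delays j g k)%C).
    - intros i E. assert (E2 : Cmod mu = Cmod (m 0%nat)).
      { rewrite <- (Rmult_1_r (Cmod mu)), <- (Cmod_pow_1 b j Hb), <- Cmod_mult, E.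
        rewrite !Cmod_mult, Cmod_1, Cmod_pow_1 by exact Hb. ring. }
      assert (Rabs (Cmod l - Cmod (m 0%nat)) <= d) by (apply Rabs_le; lra). lra.
    - apply sol_delays, Hf.
    - exact Hhs. }
  pose proof (HM j HjJ _ Hdisc h Hh Hhs (j + k)%nat) as B.
  rewrite <- Eh, delays_add in B.
  assert (PJ : 0 < r ^ J) by (apply pow_lt; lra).
  apply Rmult_le_reg_r with (r ^ J); [exact PJ|].
  replace (M / r ^ J * r ^ J) with M by (field; lra).
  (* Coordinate j + k of z^j f is f_k, so the loss is r^j, which is at least r^J. *)
  eapply Rle_trans; [|exact B]. rewrite pow_add.
  replace (Cmod (f k) * r ^ k * r ^ J) with (Cmod (f k) * (r ^ J * r ^ k)) by ring.
  apply Rmult_le_compat_l; [apply Cmod_ge_0|]. apply Rmult_le_compat_r; [apply pow_le; lra|].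
  replace J with (j + (J - j))%nat by lia. rewrite pow_add.
  assert (r ^ (J - j) <= 1) by (rewrite <- (pow1 (J - j)); apply pow_incr; lra).
  assert (0 <= r ^ j) by (apply pow_le; lra). nra.
Qed.

(** Because the resolvent is bounded on an annulus around |mu| = |l|, the circle can be taken
    strictly inside it. The gain q < |l| is what makes the lemma reversible. *)
Lemma power_bounded_of_rhoW (m : nat -> C) (mf : C -> C) (b l : C) : Cmod b = 1 -> ps m mf ->
  (forall n, (1 <= n)%nat -> (b ^ n)%C <> 1%C) -> Cmod (m 0%nat) < Cmod l ->
  in_rhoW (wcomp mf (rot b)) l ->
  exists q, Cmod (m 0%nat) < q < Cmod l /\ power_bounded m b q.
Proof.
  intros Hb Hm Hap Hl HW. pose proof (Cmod_ge_0 (m 0%nat)) as Pm.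
  assert (Hl0 : l <> 0%C) by (apply Cmod_gt_0; lra).
  destruct (resolvent_bounded_annulus m mf b l Hb Hm Hap Hl0 ltac:(lra) HW) as [d [Hd HR]].
  (* The maximum keeps q both in the annulus and above |m_0|. *)
  set (q := Rmax (Cmod l - d) ((Cmod l + Cmod (m 0%nat)) / 2)).
  assert (Q1 : Cmod l - d <= q) by apply Rmax_l.
  assert (Q2 : (Cmod l + Cmod (m 0%nat)) / 2 <= q) by apply Rmax_r.
  assert (Q3 : q < Cmod l) by (apply Rmax_lub_lt; lra).
  exists q. split; [lra|]. apply power_bounded_of_circle; [exact Hb|lra|].
  intros g Hg r Hr. destruct (HR g Hg r Hr) as [M HM]. exists M. intros mu Hmu.
  apply HM. rewrite Hmu. apply Rabs_le. lra.
Qed.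

Lemma rhoW_of_power_bounded (m : nat -> C) (mf : C -> C) (b l : C) (q : R) : Cmod b = 1 ->
  ps m mf -> Cmod (m 0%nat) <= q -> q < Cmod l -> power_bounded m b q ->
  in_rhoW (wcomp mf (rot b)) l.
Proof.
  intros Hb Hm Hq Hl HP.
  set (d := (Cmod l - q) / 2). assert (Hd : 0 < d) by (unfold d; lra).
  assert (Hdisc : forall mu, Cmod (mu - l)%C <= d -> q + d <= Cmod mu).
  { intros mu Hmu. pose proof (Cmod_triangle_rev l mu) as T. rewrite Cmod_minus_sym in T.
    unfold d in *. lra. }
  apply (in_rhoW_intro m mf b l d Hb Hm Hd).
  - intros mu Hmu. specialize (Hdisc mu Hmu). lra.
  - intros g Hg r Hr.
    destruct (resolvent_bounded_outside m b q (q + d) Hb Hq ltac:(lra) HP g Hg r Hr) as [M HM].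
    exists M. intros mu Hmu. apply HM, Hdisc, Hmu.
Qed.

Lemma rhoW_upward (m : nat -> C) (mf : C -> C) (b l l' : C) : Cmod b = 1 -> ps m mf ->
  (forall n, (1 <= n)%nat -> (b ^ n)%C <> 1%C) -> Cmod (m 0%nat) < Cmod l ->
  in_rhoW (wcomp mf (rot b)) l -> Cmod l <= Cmod l' -> in_rhoW (wcomp mf (rot b)) l'.
Proof.
  intros Hb Hm Hap Hl HW Hl'.
  destruct (power_bounded_of_rhoW m mf b l Hb Hm Hap Hl HW) as [q [Hq HP]].
  apply (rhoW_of_power_bounded m mf b l' q Hb Hm); auto; lra.
Qed.

(** * Weights with a zero *)

Lemma zero_not_in_range (m : nat -> C) (mf : C -> C) (b z0 : C) : Cmod b = 1 -> ps m mf ->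
  inD z0 -> mf z0 = 0%C -> ~ (exists f, growth f /\ sol m b 0 1 f (delta0 1)).
Proof.
  intros Hb Hm Hz0 H0 [f [Hf Hs]]. destruct (ps_ex f Hf) as [F HF].
  pose proof (proj1 (sol_iff m f _ mf F _ b 0 Hb Hm HF (ps_const 1)) Hs z0 Hz0) as E.
  unfold shiftop, wcomp in E. rewrite H0 in E. apply C1_nz. rewrite <- E. ring.
Qed.

Lemma sigmaW_low (m : nat -> C) (mf : C -> C) (b l z0 : C) : Cmod b = 1 -> ps m mf ->
  (forall n, (1 <= n)%nat -> (b ^ n)%C <> 1%C) -> inD z0 -> mf z0 = 0%C ->
  Cmod l <= Cmod (m 0%nat) -> in_sigmaW (wcomp mf (rot b)) l.
Proof.
  intros Hb Hm Hap Hz0 H0 Hl.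
  destruct (Rle_lt_or_eq_dec _ _ Hl) as [L|E]; [|apply (sigmaW_critical_circle m); assumption].
  intros HW. apply (zero_not_in_range m mf b z0 Hb Hm Hz0 H0).
  destruct (Ceq_dec l 0%C) as [->|n].
  - apply (in_rho_elim m mf b 0 Hb Hm (proj1 HW)). apply growth_delta0.
  - destruct (resolvent_bounded_annulus m mf b l Hb Hm Hap n ltac:(lra) HW) as [d [Hd HR]].
    apply (solvable_at_0 m b (Cmod l) Hb); [split; [apply Cmod_gt_0, n|exact L]| |apply growth_delta0].
    intros g Hg r Hr. destruct (HR g Hg r Hr) as [M HM]. exists M. intros mu Hmu.
    apply HM. rewrite Hmu, Rminus_diag, Rabs_R0. lra.
Qed.

(** If S^n 1 begins at degree nN, one more application multiplies its leading term by b^(nN) m_N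
    z^N. *)
Lemma Sop_iter_leading (m : nat -> C) (b : C) (N : nat) : Cmod b = 1 ->
  (forall j, (j < N)%nat -> m j = 0%C) -> forall n,
  (forall j, (j < n * N)%nat -> Nat.iter n (Sop m b) (delta0 1) j = 0%C) /\
  Cmod (Nat.iter n (Sop m b) (delta0 1) (n * N)%nat) = Cmod (m N) ^ n.
Proof.
  intros Hb HN. induction n as [|n [IH1 IH2]].
  - split; [intros j Hj; lia|]. simpl. apply Cmod_1.
  - set (f := Nat.iter n (Sop m b) (delta0 1)) in *.
    change (Nat.iter (S n) (Sop m b) (delta0 1)) with (Sop m b f).
    assert (Hz : forall k j, (j <= k)%nat -> (k <= n * N + N)%nat -> (j <> n * N)%nat \/ (k < n * N + N)%nat ->
      (b ^ j * f j * m (k - j)%nat)%C = 0%C).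
    { intros k j Hjk Hk Hor. destruct (Nat.lt_ge_cases j (n * N)) as [L|L].
      - rewrite IH1 by exact L. ring.
      - rewrite (HN (k - j)%nat) by lia. ring. }
    split.
    + intros j Hj. unfold Sop, conv. apply psum_0. intros i Hi. apply Hz; simpl in Hj; lia.
    + assert (E : Sop m b f (S n * N)%nat = (b ^ (n * N) * f (n * N)%nat * m N)%C).
      { replace (S n * N)%nat with (n * N + N)%nat by (simpl; lia).
        unfold Sop, conv.
        (* The partial sums of the convolution are 0 up to index nN, where the only surviving term
           enters, and constant afterwards. *)
        assert (Hs : forall p, (p <= n * N + N)%nat ->
          psum (fun j => b ^ j * f j * m (n * N + N - j)%nat)%C (S p) =
          if le_dec (n * N) p then (b ^ (n * N) * f (n * N)%nat * m N)%C else 0%C).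
        { induction p as [|p IHp]; intros Hp.
          - cbn [psum]. destruct (Compare_dec.le_dec (n * N) 0) as [L|L].
            + replace (n * N)%nat with 0%nat by lia. simpl Nat.sub. rewrite Nat.sub_0_r. simpl. ring.
            + rewrite Hz by lia. ring.
          - change (psum (fun j => b ^ j * f j * m (n * N + N - j)%nat)%C (S (S p))) with
              (psum (fun j => b ^ j * f j * m (n * N + N - j)%nat)%C (S p) +
                b ^ S p * f (S p) * m (n * N + N - S p)%nat)%C.
            rewrite IHp by lia.
            destruct (Nat.eq_dec (S p) (n * N)) as [E|E].
            + rewrite E. destruct (Compare_dec.le_dec (n * N) p); [lia|]. destruct (Compare_dec.le_dec (n * N) (n * N)); [|lia].
              replace (n * N + N - n * N)%nat with N by lia. ring.
            + rewrite Hz by lia. destruct (Compare_dec.le_dec (n * N) p); destruct (Compare_dec.le_dec (n * N) (S p)); try lia; ring. }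
        rewrite Hs by lia. destruct (Compare_dec.le_dec (n * N) (n * N + N)); [reflexivity|lia]. }
      rewrite E, !Cmod_mult, IH2, Cmod_pow_1 by exact Hb. simpl. ring.
Qed.

(** At r = 1/2 the leading coefficient of S^n 1 gives |m_N|^n 2^(-nN) <= M q^n for all n; the
    constant M is harmless as n grows. *)
Lemma power_bounded_lower (m : nat -> C) (b : C) (N : nat) (q : R) : Cmod b = 1 ->
  (forall j, (j < N)%nat -> m j = 0%C) -> 0 < q -> power_bounded m b q ->
  Cmod (m N) <= q * 2 ^ N.
Proof.
  intros Hb HN Hq HP.
  destruct (HP (delta0 1) (growth_delta0 1) (1 / 2) ltac:(lra)) as [M HM].
  apply Rnot_lt_le. intros Hlt.
  assert (P2 : 0 < 2 ^ N) by (apply pow_lt; lra).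
  assert (Pm : 0 < Cmod (m N)) by nra.
  assert (Hx : 0 <= q * 2 ^ N / Cmod (m N) < 1) by (apply ratio_lt_1; nra).
  destruct (pow_small _ M (1 / 2) Hx ltac:(lra)) as [n Hn]. specialize (Hn n (Nat.le_refl n)).
  specialize (HM n (n * N)%nat). destruct (Sop_iter_leading m b N Hb HN n) as [_ E].
  rewrite E, Nat.mul_comm, pow_mult in HM.
  assert (Pn : 0 < Cmod (m N) ^ n) by (apply pow_lt, Pm).
  assert (P2n : 0 < (2 ^ N) ^ n) by (apply pow_lt, P2).
  replace ((1 / 2) ^ N) with (/ 2 ^ N) in HM by (unfold Rdiv; rewrite Rmult_1_l, pow_inv; reflexivity).
  rewrite pow_inv in HM. unfold Rdiv in Hn. rewrite !Rpow_mult_distr, pow_inv in Hn.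
  assert (Cmod (m N) ^ n <= M * q ^ n * (2 ^ N) ^ n).
  { apply Rmult_le_reg_r with (/ (2 ^ N) ^ n); [apply Rinv_0_lt_compat, P2n|].
    rewrite (Rmult_assoc (M * q ^ n)), Rinv_r by lra. lra. }
  assert (M * (q ^ n * (2 ^ N) ^ n * / Cmod (m N) ^ n) * Cmod (m N) ^ n <= 1 / 2 * Cmod (m N) ^ n)
    by (apply Rmult_le_compat_r; lra).
  replace (M * (q ^ n * (2 ^ N) ^ n * / Cmod (m N) ^ n) * Cmod (m N) ^ n) with
    (M * q ^ n * (2 ^ N) ^ n) in H0 by (field; lra).
  lra.
Qed.

Theorem sigmaW_with_zero (m : nat -> C) (mf : C -> C) (b z0 : C) : Cmod b = 1 -> ps m mf ->
  (forall n, (1 <= n)%nat -> (b ^ n)%C <> 1%C) -> (exists k, m k <> 0%C) ->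
  inD z0 -> mf z0 = 0%C ->
  (exists R : R, 0 < R /\ forall l, in_sigmaW (wcomp mf (rot b)) l <-> Cmod l <= R)
  \/ (forall l, in_sigmaW (wcomp mf (rot b)) l).
Proof.
  intros Hb Hm Hap Hnz Hz0 H0. set (T := wcomp mf (rot b)).
  pose proof (Cmod_ge_0 (m 0%nat)) as Pm.
  assert (Hdown : forall l l', in_sigmaW T l -> Cmod l' <= Cmod l -> in_sigmaW T l').
  { intros l l' Hs Hle HW. destruct (Rle_or_lt (Cmod l') (Cmod (m 0%nat))) as [L|L].
    - apply (sigmaW_low m mf b l' z0 Hb Hm Hap Hz0 H0 L HW).
    - apply Hs. apply (rhoW_upward m mf b l' l Hb Hm Hap L HW Hle). }
  destruct (classic (forall l, in_sigmaW T l)) as [Hall|Hnot]; [right; exact Hall|left].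
  apply not_all_ex_not in Hnot. destruct Hnot as [l1 Hl1].
  (* R is the supremum of the moduli of the spectrum; it is attained only after the boundary circle
     has been examined at the end. *)
  set (E := fun x : R => exists l, in_sigmaW T l /\ x = Cmod l).
  assert (HEb : bound E).
  { exists (Cmod l1). intros x [l [Hl ->]]. apply Rnot_lt_le. intros Hlt. apply Hl1.
    apply (Hdown l); [exact Hl|lra]. }
  assert (HE0 : E (Cmod (m 0%nat))).
  { exists (m 0%nat). split; [|reflexivity]. apply (sigmaW_low m mf b _ z0); auto. lra. }
  destruct (completeness E HEb (ex_intro _ _ HE0)) as [R [HR1 HR2]].
  assert (HmR : Cmod (m 0%nat) <= R) by (apply HR1, HE0).
  assert (Habove : forall l, R < Cmod l -> in_rhoW T l).
  { intros l Hl. apply NNPP. intros Hn. assert (Cmod l <= R); [|lra].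
    apply HR1. exists l. auto. }
  assert (Hbelow : forall l, Cmod l < R -> in_sigmaW T l).
  { intros l Hl. apply NNPP. intros Hn.
    assert (R <= Cmod l); [|lra]. apply HR2. intros x [l' [Hl' ->]].
    apply Rnot_lt_le. intros Hlt. apply Hn. apply (Hdown l'); [exact Hl'|lra]. }
  assert (HRpos : 0 < R).
  { destruct (Rle_lt_or_eq_dec _ _ Pm) as [L|Em]; [lra|].
    assert (HN : exists N, m N <> 0%C /\ forall j, (j < N)%nat -> m j = 0%C).
    { destruct Hnz as [k Hk]. induction k as [k IH] using (well_founded_induction Nat.lt_wf_0).
      destruct (classic (exists j, (j < k)%nat /\ m j <> 0%C)) as [[j [Hj Hmj]]|Hno].
      - apply (IH j Hj Hmj).
      - exists k. split; [exact Hk|]. intros j Hj. apply NNPP. intros Hn. apply Hno. exists j. auto. }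
    destruct HN as [N [HN1 HN2]].
    assert (PN : 0 < Cmod (m N)) by (apply Cmod_gt_0, HN1).
    assert (P2 : 0 < 2 ^ N) by (apply pow_lt; lra).
    apply Rnot_le_lt. intros HR0.
    (* If R <= 0, this x lies in the resolvent set and yields a power bound with q < x, so |m_N| <=
       q 2^N would be at most |m_N| / 2. *)
    set (x := Cmod (m N) / (2 * 2 ^ N)).
    assert (Hx : 0 < x) by (apply Rdiv_lt_0_compat; lra).
    assert (Hxm : Cmod (RtoC x) = x) by (rewrite Cmod_R, Rabs_pos_eq; lra).
    destruct (power_bounded_of_rhoW m mf b (RtoC x) Hb Hm Hap) as [q [Hq HP]].
    - rewrite Hxm. lra.
    - apply Habove. rewrite Hxm. lra.
    - pose proof (power_bounded_lower m b N q Hb HN2 ltac:(lra) HP) as B.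
      rewrite Hxm in Hq.
      assert (q * 2 ^ N <= x * 2 ^ N) by (apply Rmult_le_compat_r; lra).
      replace (x * 2 ^ N) with (Cmod (m N) / 2) in H by (unfold x; field; lra). lra. }
  exists R. split; [exact HRpos|]. intros l. split.
  - intros Hl. apply HR1. exists l. auto.
  - intros Hl. destruct (Rle_lt_or_eq_dec _ _ Hl) as [L|Er]; [apply Hbelow, L|].
    destruct (Rle_lt_or_eq_dec _ _ HmR) as [Lm|Em].
    (* A resolvent point on the circle |l| = R would give a power bound with q < R, hence resolvent
       points of modulus below R. *)
    + intros HW. destruct (power_bounded_of_rhoW m mf b l Hb Hm Hap ltac:(lra) HW) as [q [Hq HP]].
      set (x := (q + R) / 2).
      assert (Hxm : Cmod (RtoC x) = x) by (rewrite Cmod_R, Rabs_pos_eq; unfold x; lra).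
      apply (Hbelow (RtoC x)); [rewrite Hxm; unfold x; lra|].
      apply (rhoW_of_power_bounded m mf b (RtoC x) q Hb Hm); [lra|rewrite Hxm; unfold x; lra|exact HP].
    + apply (sigmaW_low m mf b l z0); auto. lra.
Qed.

(** * Weights without zeros *)

Lemma Cmod_sq (z : C) : Cmod z * Cmod z = fst z * fst z + snd z * snd z.
Proof. unfold Cmod. simpl. rewrite !Rmult_1_r. apply sqrt_sqrt. nra. Qed.

Lemma ray_derivable (f : C -> C) (z l : C) (t : R) : Cder f (RtoC t * z)%C l ->
  derivable_pt_lim (fun s => fst (f (RtoC s * z)%C)) t (fst (z * l)%C) /\
  derivable_pt_lim (fun s => snd (f (RtoC s * z)%C)) t (snd (z * l)%C).
Proof.
  intros H. pose proof (Cmod_ge_0 z) as Pz.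
  assert (Hest : forall eps, 0 < eps -> exists d, 0 < d /\ forall h, h <> 0 -> Rabs h < d ->
    Cmod ((f (RtoC (t + h) * z) - f (RtoC t * z)) / RtoC h - z * l)%C < eps).
  { intros eps He. destruct (H (eps / (2 * (Cmod z + 1)))) as [d [Hd Hy]]; [apply Rdiv_lt_0_compat; lra|].
    exists (d / (Cmod z + 1)). split; [apply Rdiv_lt_0_compat; lra|]. intros h Hh Hhd.
    assert (Hh0 : RtoC h <> 0%C) by (intros E; apply RtoC_inj in E; tauto).
    assert (Ph : 0 < Rabs h) by (apply Rabs_pos_lt, Hh).
    assert (Ed : (RtoC (t + h) * z - RtoC t * z)%C = (RtoC h * z)%C) by (rewrite RtoC_plus; ring).
    specialize (Hy (RtoC (t + h) * z)%C). rewrite Ed, Cmod_mult, Cmod_R in Hy.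
    assert (Hlt : Rabs h * Cmod z < d).
    { apply Rle_lt_trans with (Rabs h * (Cmod z + 1)); [apply Rmult_le_compat_l; lra|].
      apply Rlt_le_trans with (d / (Cmod z + 1) * (Cmod z + 1)); [apply Rmult_lt_compat_r; lra|].
      right. field. lra. }
    specialize (Hy Hlt).
    replace ((f (RtoC (t + h) * z) - f (RtoC t * z)) / RtoC h - z * l)%C with
      ((f (RtoC (t + h) * z) - f (RtoC t * z) - l * (RtoC h * z)) / RtoC h)%C by (field; exact Hh0).
    rewrite Cmod_div, Cmod_R by exact Hh0.
    apply Rmult_lt_reg_r with (Rabs h); [exact Ph|].
    unfold Rdiv at 1. rewrite Rmult_assoc, Rinv_l, Rmult_1_r by lra.
    eapply Rle_lt_trans; [exact Hy|].
    apply Rle_lt_trans with (eps / 2 * Rabs h); [|nra].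
    replace (eps / (2 * (Cmod z + 1)) * (Rabs h * Cmod z)) with
      (eps / 2 * Rabs h * (Cmod z / (Cmod z + 1))) by (field; lra).
    assert (Cmod z / (Cmod z + 1) <= 1).
    { apply Rmult_le_reg_r with (Cmod z + 1); [lra|]. unfold Rdiv.
      rewrite Rmult_assoc, Rinv_l by lra. lra. }
    rewrite <- (Rmult_1_r (eps / 2 * Rabs h)) at 2. apply Rmult_le_compat_l; [nra|assumption]. }
  assert (Hcomp : forall h, h <> 0 -> forall u : C,
    fst (u / RtoC h)%C = fst u / h /\ snd (u / RtoC h)%C = snd u / h).
  { intros h Hh u. unfold Cdiv, Cmult, Cinv, RtoC; simpl. split; field; exact Hh. }
  split; intros eps He; destruct (Hest eps He) as [d [Hd Hh]];
    exists (mkposreal d Hd); intros h Hh0 Hhd; specialize (Hh h Hh0 Hhd).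
  - eapply Rle_lt_trans; [|exact Hh]. eapply Rle_trans; [|apply Rabs_fst_le].
    right. f_equal.
    change (fst ((f (RtoC (t + h) * z) - f (RtoC t * z)) / RtoC h - z * l)%C) with
      (fst ((f (RtoC (t + h) * z) - f (RtoC t * z)) / RtoC h)%C - fst (z * l)%C).
    rewrite (proj1 (Hcomp h Hh0 _)). reflexivity.
  - eapply Rle_lt_trans; [|exact Hh]. eapply Rle_trans; [|apply Rabs_snd_le].
    right. f_equal.
    change (snd ((f (RtoC (t + h) * z) - f (RtoC t * z)) / RtoC h - z * l)%C) with
      (snd ((f (RtoC (t + h) * z) - f (RtoC t * z)) / RtoC h)%C - snd (z * l)%C).
    rewrite (proj2 (Hcomp h Hh0 _)). reflexivity.
Qed.

(* [g] is the logarithmic derivative of [f]; integrate Re(z g(tz)) along the ray to z. *)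
Lemma log_derivative_bound (f g : C -> C) (r B : R) (z : C) : 0 <= r < 1 ->
  (forall y, inD y -> Cder f y (f y * g y)%C) -> (forall y, inD y -> f y <> 0%C) ->
  (forall y, Cmod y <= r -> Cmod (g y) <= B) -> Cmod z <= r ->
  Cmod (f z) <= Cmod (f 0%C) * exp B.
Proof.
  intros Hr Hf Hf0 Hg Hz. pose proof (Cmod_ge_0 z) as Pz.
  set (p := fun s => fst (f (RtoC s * z)%C)). set (q := fun s => snd (f (RtoC s * z)%C)).
  assert (Hin : forall t, 0 <= t <= 1 -> Cmod (RtoC t * z)%C <= r).
  { intros t Ht. rewrite Cmod_mult, Cmod_R, Rabs_pos_eq by lra. nra. }
  assert (HinD : forall t, 0 <= t <= 1 -> inD (RtoC t * z)%C).
  { intros t Ht. specialize (Hin t Ht). unfold inD. lra. }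
  assert (Hpos : forall t, 0 <= t <= 1 -> 0 < p t * p t + q t * q t).
  { intros t Ht. unfold p, q. rewrite <- Cmod_sq.
    assert (0 < Cmod (f (RtoC t * z)%C)) by (apply Cmod_gt_0, Hf0, HinD, Ht). nra. }
  (* [v] is 2 log |f(t z)|: the modulus suffices, so no branch of the complex logarithm has to be
     chosen. *)
  set (v := fun t => ln (p t * p t + q t * q t)).
  assert (Hv : forall t, 0 <= t <= 1 ->
    derivable_pt_lim v t (2 * Re (z * g (RtoC t * z)%C)%C)).
  { intros t Ht. destruct (ray_derivable f z _ t (Hf _ (HinD t Ht))) as [Hp Hq].
    specialize (Hpos t Ht).
    apply is_derive_Reals in Hp. apply is_derive_Reals in Hq. apply is_derive_Reals.
    fold p in Hp. fold q in Hq.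
    set (dp := fst _) in Hp. set (dq := snd (_ * _)%C) in Hq.
    assert (Hs : is_derive (fun t => p t * p t + q t * q t) t
      (dp * p t + p t * dp + (dq * q t + q t * dq))).
    { apply (is_derive_plus (V := R_NormedModule)).
      - apply (is_derive_mult p p t dp dp Hp Hp). intros; apply Rmult_comm.
      - apply (is_derive_mult q q t dq dq Hq Hq). intros; apply Rmult_comm. }
    assert (Hl : is_derive ln (p t * p t + q t * q t) (/ (p t * p t + q t * q t))).
    { apply is_derive_Reals, derivable_pt_lim_ln, Hpos. }
    pose proof (is_derive_comp ln _ t _ _ Hl Hs) as Hc.
    replace (2 * Re (z * g (RtoC t * z)%C)%C) with
      (scal (dp * p t + p t * dp + (dq * q t + q t * dq)) (/ (p t * p t + q t * q t))).
    - exact Hc.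
    - unfold scal; simpl; unfold mult; simpl.
      unfold dp, dq, p, q, Re in *.
      destruct (f (RtoC t * z)%C) as [f1 f2]. destruct (g (RtoC t * z)%C) as [g1 g2].
      destruct z as [z1 z2]. simpl in *. field. lra. }
  destruct (MVT_gen v 0 1 (fun t => 2 * Re (z * g (RtoC t * z)%C)%C)) as [c [Hc E]].
  - intros t. rewrite Rmin_left, Rmax_right by lra. intros Ht. apply is_derive_Reals, Hv. lra.
  - intros t. rewrite Rmin_left, Rmax_right by lra. intros Ht. apply derivable_continuous_pt.
    eexists. apply (Hv t Ht).
  - rewrite Rmin_left, Rmax_right in Hc by lra.
    assert (HB : Re (z * g (RtoC c * z)%C)%C <= B).
    { eapply Rle_trans; [apply Rle_abs|]. eapply Rle_trans; [apply re_le_Cmod|].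
      rewrite Cmod_mult. specialize (Hg _ (Hin c Hc)). pose proof (Cmod_ge_0 (g (RtoC c * z)%C)). nra. }
    assert (Ev : v 1 <= v 0 + 2 * B) by lra.
    assert (E1 : p 1 * p 1 + q 1 * q 1 = Cmod (f z) * Cmod (f z)).
    { unfold p, q. rewrite <- Cmod_sq, Cmult_1_l. reflexivity. }
    assert (E0 : p 0 * p 0 + q 0 * q 0 = Cmod (f 0%C) * Cmod (f 0%C)).
    { unfold p, q. rewrite <- Cmod_sq, Cmult_0_l. reflexivity. }
    pose proof (Hpos 1 ltac:(lra)) as P1. pose proof (Hpos 0 ltac:(lra)) as P0.
    assert (Hsq : Cmod (f z) * Cmod (f z) <= (Cmod (f 0%C) * exp B) * (Cmod (f 0%C) * exp B)).
    { rewrite <- E1, <- (exp_ln _ P1).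
      replace (Cmod (f 0%C) * exp B * (Cmod (f 0%C) * exp B)) with
        (Cmod (f 0%C) * Cmod (f 0%C) * (exp B * exp B)) by ring.
      rewrite <- E0, <- (exp_ln _ P0), <- !exp_plus.
      destruct Ev as [Ev|Ev].
      - left. apply exp_increasing. unfold v in Ev. lra.
      - right. f_equal. unfold v in Ev. lra. }
    apply Rsqr_incr_0_var; [exact Hsq|].
    apply Rmult_le_pos; [apply Cmod_ge_0|left; apply exp_pos].
Qed.

(* Since b is not a root of unity, the Birkhoff sums of every nonconstant monomial stay bounded. *)
Lemma birkhoff_polynomial (b : C) (l : nat -> C) (K : nat) : Cmod b = 1 ->
  (forall n, (1 <= n)%nat -> (b ^ n)%C <> 1%C) ->
  exists A, forall n z, Cmod z <= 1 ->
    Cmod (psum (fun j => b ^ j * psum (fun k => l k * (b ^ j * z) ^ k) K)%C n) <= A.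
Proof.
  intros Hb Hap. induction K as [|K [A IH]].
  - exists 0. intros n z _. rewrite psum_0; [rewrite Cmod_0; lra|]. intros k _. simpl. ring.
  - set (x := (b ^ S K)%C).
    assert (Hx : (1 - x)%C <> 0%C).
    { apply Cminus_eq_contra. intros E. apply (Hap (S K) ltac:(lia)). symmetry. exact E. }
    assert (Px : 0 < Cmod (1 - x)%C) by (apply Cmod_gt_0, Hx).
    exists (A + Cmod (l K) * (2 / Cmod (1 - x)%C)). intros n z Hz.
    rewrite (psum_ext _ (fun j => b ^ j * psum (fun k => l k * (b ^ j * z) ^ k) K +
      (l K * z ^ K) * x ^ j)%C).
    + rewrite psum_plus, psum_scal. eapply Rle_trans; [apply Cmod_triangle|].
      apply Rplus_le_compat; [apply IH, Hz|].
      rewrite !Cmod_mult, Cmod_pow, Rmult_assoc. apply Rmult_le_compat_l; [apply Cmod_ge_0|].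
      pose proof (geom_identity x n) as G.
      assert (HS : Cmod (psum (fun k => x ^ k)%C n) <= 2 / Cmod (1 - x)%C).
      { apply Rmult_le_reg_l with (Cmod (1 - x)%C); [exact Px|].
        rewrite <- Cmod_mult, G.
        replace (Cmod (1 - x)%C * (2 / Cmod (1 - x)%C)) with (1 + 1) by (field; lra).
        eapply Rle_trans; [apply Cmod_triangle_minus|].
        rewrite Cmod_1, Cmod_pow_1; [lra|]. apply Cmod_pow_1, Hb. }
      assert (Cmod z ^ K <= 1) by (rewrite <- (pow1 K); apply pow_incr; split; [apply Cmod_ge_0|exact Hz]).
      assert (0 <= Cmod z ^ K) by (apply pow_le, Cmod_ge_0).
      pose proof (Cmod_ge_0 (psum (fun k => x ^ k)%C n)). 
      change (Cmod z ^ K * Cmod (psum (fun k => x ^ k)%C n) <= 2 / Cmod (1 - x)%C). nra.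
    + intros j _. cbn [psum]. rewrite Cpow_mult_l.
      unfold x. rewrite <- !Cpow_mult_r.
      replace (S K * j)%nat with (j + j * K)%nat by lia. rewrite Cpow_add_r. ring.
Qed.

(** A Taylor polynomial of L has bounded sums; its degree is chosen so that the remaining tail is at
    most eps on |z| <= r, which costs eps at each of the n steps. *)
Lemma birkhoff_bound (b : C) (l : nat -> C) (L : C -> C) (r eps : R) : Cmod b = 1 ->
  (forall n, (1 <= n)%nat -> (b ^ n)%C <> 1%C) -> ps l L -> 0 < r < 1 -> 0 < eps ->
  exists A, forall n z, Cmod z <= r ->
    Cmod (psum (fun j => b ^ j * L (b ^ j * z)%C)%C n) <= A + INR n * eps.
Proof.
  intros Hb Hap HL Hr He. set (R := (1 + r) / 2).
  destruct (proj1 HL R) as [M HM]; [unfold R; lra|].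
  assert (Hq : 0 <= r / R < 1) by (apply ratio_lt_1; unfold R; lra).
  destruct (pow_small (r / R) (M / (1 - r / R)) eps Hq He) as [K HK].
  specialize (HK K (Nat.le_refl K)).
  destruct (birkhoff_polynomial b l K Hb Hap) as [A HA]. exists A. intros n z Hz.
  assert (Htail : forall j, Cmod (psum (fun k => l k * (b ^ j * z) ^ k)%C K - L (b ^ j * z)%C)%C <= eps).
  { intros j. assert (Hj : Cmod (b ^ j * z)%C <= r) by (rewrite Cmod_mult, Cmod_pow_1; lra).
    eapply Rle_trans; [apply (sums_tail _ _ M (r / R))|].
    - exact Hq.
    - apply geom_term; [unfold R; lra|exact Hj|exact HM].
    - apply HL. unfold inD. lra.
    - eapply Rle_trans; [|exact HK]. right. field. split; unfold R in *; lra. }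
  assert (Hdiff : Cmod (psum (fun j => b ^ j * psum (fun k => l k * (b ^ j * z) ^ k) K)%C n -
    psum (fun j => b ^ j * L (b ^ j * z)%C)%C n)%C <= INR n * eps).
  { rewrite <- psum_minus. induction n as [|n IH].
    - simpl. rewrite Cmod_0. lra.
    - cbn [psum]. rewrite S_INR, Rmult_plus_distr_r, Rmult_1_l.
      eapply Rle_trans; [apply Cmod_triangle|]. apply Rplus_le_compat; [exact IH|].
      match goal with |- Cmod ?X <= _ => replace X with
        (b ^ n * (psum (fun k => l k * (b ^ n * z) ^ k) K - L (b ^ n * z)%C))%C by ring end.
      rewrite Cmod_mult, Cmod_pow_1, Rmult_1_l by exact Hb. apply Htail. }
  specialize (HA n z ltac:(lra)).
  match type of Hdiff with Cmod (?X - ?Y)%C <= _ => 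
    replace Y with (X - (X - Y))%C by ring end.
  eapply Rle_trans; [apply Cmod_triangle_minus|]. lra.
Qed.

Fixpoint cocycle (m : C -> C) (b : C) (n : nat) (z : C) : C :=
  match n with O => 1%C | S n => (cocycle m b n z * m (b ^ n * z))%C end.

Lemma iter_wcomp (m F : C -> C) (b : C) (n : nat) (z : C) :
  Nat.iter n (wcomp m (rot b)) F z = (cocycle m b n z * F (b ^ n * z))%C.
Proof.
  revert F. induction n as [|n IH]; intros F.
  - simpl. rewrite !Cmult_1_l. reflexivity.
  - rewrite Nat.iter_succ_r, IH. simpl cocycle. unfold wcomp, rot.
    replace (b ^ S n * z)%C with (b * (b ^ n * z))%C by (rewrite Cpow_S; ring). ring.
Qed.

(** The factors b^j come from the chain rule: z times this logarithmic derivative is the Birkhoff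
    sum of z L(z) along the rotation. *)
Lemma cocycle_Cder (m L : C -> C) (b : C) (n : nat) (z : C) : Cmod b = 1 ->
  (forall y, inD y -> Cder m y (m y * L y)%C) -> inD z ->
  Cder (cocycle m b n) z (cocycle m b n z * psum (fun j => b ^ j * L (b ^ j * z)) n)%C.
Proof.
  intros Hb Hm Hz. induction n as [|n IH].
  - simpl psum. rewrite Cmult_0_r. exact (Cder_const 1%C z).
  - simpl psum. simpl cocycle.
    assert (Hin : inD (b ^ n * z)%C).
    { unfold inD in *. rewrite Cmod_mult, Cmod_pow_1; lra. }
    assert (Hl : Cder (fun y => b ^ n * y)%C z (b ^ n)%C).
    { pose proof (Cder_mult _ _ z _ _ (Cder_const (b ^ n)%C z) (Cder_id z)) as H.
      cbv beta in H. replace (0 * z + b ^ n * 1)%C with (b ^ n)%C in H by ring. exact H. }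
    pose proof (Cder_mult _ _ z _ _ IH (Cder_comp m _ z _ _ (Hm _ Hin) Hl)) as H.
    match goal with |- Cder _ _ ?X => match type of H with Cder _ _ ?Y =>
      replace X with Y by ring end end.
    exact H.
Qed.

Lemma cocycle_nz (m : C -> C) (b : C) (n : nat) (z : C) : Cmod b = 1 ->
  (forall y, inD y -> m y <> 0%C) -> inD z -> cocycle m b n z <> 0%C.
Proof.
  intros Hb Hm Hz. induction n as [|n IH]; [exact C1_nz|].
  simpl. apply Cmult_neq_0; [exact IH|]. apply Hm. unfold inD in *. rewrite Cmod_mult, Cmod_pow_1; lra.
Qed.

Lemma cocycle_at_0 (m : C -> C) (b : C) (n : nat) : cocycle m b n 0 = (m 0 ^ n)%C.
Proof.
  induction n as [|n IH]; [reflexivity|]. simpl cocycle. rewrite IH, Cmult_0_r, Cpow_S. ring.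
Qed.

Lemma ps_iter (m g : nat -> C) (mf G : C -> C) (b : C) (n : nat) : Cmod b = 1 ->
  ps m mf -> ps g G -> ps (Nat.iter n (Sop m b) g) (Nat.iter n (wcomp mf (rot b)) G).
Proof.
  intros Hb Hm Hg. induction n as [|n IH]; [exact Hg|]. simpl. apply ps_wcomp; assumption.
Qed.

Lemma power_bounded_zero_free (m : nat -> C) (mf : C -> C) (b : C) (q : R) : Cmod b = 1 ->
  ps m mf -> (forall n, (1 <= n)%nat -> (b ^ n)%C <> 1%C) ->
  (forall z, inD z -> mf z <> 0%C) -> Cmod (m 0%nat) < q -> power_bounded m b q.
Proof.
  intros Hb Hm Hap Hnz Hq.
  destruct (ps_ex (shift_deriv m)) as [mf' Hm']; [apply growth_shift_deriv, Hm|].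
  set (L := fun z => (mf' z / mf z)%C).
  assert (HL : holD L).
  { apply holD_div; [apply (ps_holD _ _ Hm')|apply (ps_holD _ _ Hm)|exact Hnz]. }
  destruct (holD_ps L HL) as [l Hl].
  assert (Hder : forall y, inD y -> Cder mf y (mf y * L y)%C).
  { intros y Hy. replace (mf y * L y)%C with (mf' y).
    - apply (ps_Cder m mf mf' y Hm Hm' Hy).
    - unfold L. field. apply Hnz, Hy. }
  assert (HD0 : inD 0%C) by (unfold inD; rewrite Cmod_0; lra).
  assert (P0 : 0 < Cmod (m 0%nat)) by (rewrite <- (ps_at_0 m mf Hm); apply Cmod_gt_0, Hnz, HD0).
  (* With this value q = |m_0| exp(eps). The cocycle is m_0^n at the centre, so an exponent A + n
     eps yields exp(A) q^n. *)
  set (eps := ln (q / Cmod (m 0%nat))).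
  assert (Hr1 : 1 < q / Cmod (m 0%nat)).
  { apply Rmult_lt_reg_r with (Cmod (m 0%nat)); [exact P0|].
    unfold Rdiv. rewrite Rmult_assoc, Rinv_l by lra. lra. }
  assert (He : 0 < eps) by (unfold eps; rewrite <- ln_1; apply ln_increasing; lra).
  assert (Heps : Cmod (m 0%nat) * exp eps = q).
  { unfold eps. rewrite exp_ln by lra. field. lra. }
  intros g Hg r Hr. destruct (ps_ex g Hg) as [G HG].
  destruct (ps_disc_bounded g G r HG Hr) as [B HB].
  destruct (birkhoff_bound b l L r eps Hb Hap Hl Hr He) as [A HA].
  exists (exp A * B). intros n k.
  apply (cauchy_estimate _ _ r _ (ps_iter m g mf G b n Hb Hm HG) Hr).
  intros z Hz. rewrite iter_wcomp, Cmod_mult.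
  assert (HG1 : Cmod (G (b ^ n * z)%C) <= B) by (apply HB; rewrite Cmod_mult, Cmod_pow_1; lra).
  assert (Hc : Cmod (cocycle mf b n z) <= exp A * q ^ n).
  { eapply Rle_trans.
    - apply (log_derivative_bound (cocycle mf b n)
        (fun z => psum (fun j => b ^ j * L (b ^ j * z)) n)%C r (A + INR n * eps) z).
      + lra.
      + intros y Hy. apply cocycle_Cder; assumption.
      + intros y Hy. apply cocycle_nz; assumption.
      + intros y Hy. apply HA, Hy.
      + lra.
    - rewrite cocycle_at_0, Cmod_pow, (ps_at_0 m mf Hm), exp_plus, <- Heps, Rpow_mult_distr.
      right. replace (exp (INR n * eps)) with (exp eps ^ n); [ring|].
      clear. induction n as [|n IH].
      + simpl. rewrite Rmult_0_l, exp_0. reflexivity.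
      + rewrite S_INR, Rmult_plus_distr_r, Rmult_1_l, exp_plus, <- IH. simpl. ring. }
  replace (exp A * B * q ^ n) with ((exp A * q ^ n) * B) by ring.
  apply Rmult_le_compat; try apply Cmod_ge_0; assumption.
Qed.

(* T is invertible, with T^-1 f = f(b^-1 z) / m(b^-1 z); apply T^-1 to (mu - T) h = g. *)
Lemma inverse_equation (m G H : C -> C) (b mu : C) : Cmod b = 1 ->
  (forall z, inD z -> m z <> 0%C) ->
  let T' := wcomp (fun z => 1 / m (rot (/ b) z))%C (rot (/ b)) in
  eqD (shiftop (wcomp m (rot b)) mu H) G <->
  eqD (fun z => 1 * H z - mu * T' H z)%C (fun z => - (1) * T' G z)%C.
Proof.
  intros Hb Hm T'. assert (Hb0 : b <> 0%C) by (apply Cmod_gt_0; lra).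
  assert (Hib : Cmod (/ b)%C = 1) by (rewrite Cmod_inv, Hb by exact Hb0; apply Rinv_1).
  assert (R1 : forall z, rot b (rot (/ b) z) = z) by (intros z; unfold rot; field; exact Hb0).
  assert (R2 : forall z, rot (/ b) (rot b z) = z) by (intros z; unfold rot; field; exact Hb0).
  unfold T', shiftop, wcomp. split; intros E z Hz.
  - assert (Hz' : inD (rot (/ b) z)) by (unfold inD, rot in *; rewrite Cmod_mult, Hib; lra).
    rewrite <- (E _ Hz'), R1. field. apply Hm, Hz'.
  - assert (Hz' : inD (rot b z)) by (unfold inD, rot in *; rewrite Cmod_mult, Hb; lra).
    pose proof (E _ Hz') as E1. cbv beta in E1. rewrite !R2 in E1.
    replace (G z) with (- (m z) * (- (1) * (1 / m z * G z)))%C by (field; apply Hm, Hz).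
    rewrite <- E1. field. apply Hm, Hz.
Qed.

(** The inverse operator has a zero-free weight with value 1 / m_0 at 0, so its powers grow at most
    at a rate slightly above 1 / |m_0|. Writing the equation with 1 - mu T^-1 covers mu = 0 along
    with the rest. *)
Lemma rhoW_inside (m : nat -> C) (mf : C -> C) (b l : C) : Cmod b = 1 -> ps m mf ->
  (forall n, (1 <= n)%nat -> (b ^ n)%C <> 1%C) -> (forall z, inD z -> mf z <> 0%C) ->
  Cmod l < Cmod (m 0%nat) -> in_rhoW (wcomp mf (rot b)) l.
Proof.
  intros Hb Hm Hap Hnz Hl. pose proof (Cmod_ge_0 l) as Pl.
  assert (Hb0 : b <> 0%C) by (apply Cmod_gt_0; lra).
  assert (Hib : Cmod (/ b)%C = 1) by (rewrite Cmod_inv, Hb by exact Hb0; apply Rinv_1).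
  assert (HD0 : inD 0%C) by (unfold inD; rewrite Cmod_0; lra).
  set (mi := fun z => (1 / mf (rot (/ b) z))%C). set (T' := wcomp mi (rot (/ b))).
  assert (Hrot : forall z, inD z -> inD (rot (/ b) z)).
  { intros z Hz. unfold inD, rot in *. rewrite Cmod_mult, Hib. lra. }
  assert (Hrh : holD (rot (/ b))) by (apply holD_mult; [apply holD_const|apply holD_id]).
  assert (Hmi : holD mi).
  { apply holD_div; [apply holD_const| |intros z Hz; apply Hnz, Hrot, Hz].
    apply holD_comp; [apply (ps_holD m mf Hm)|exact Hrh|exact Hrot]. }
  destruct (holD_ps mi Hmi) as [n Hn].
  assert (Hmi0 : forall z, inD z -> mi z <> 0%C).
  { intros z Hz E. apply C1_nz. replace (RtoC 1) with (mi z * mf (rot (/ b) z))%C.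
    - rewrite E. ring.
    - unfold mi. field. apply Hnz, Hrot, Hz. }
  assert (Hn0 : Cmod (n 0%nat) = / Cmod (m 0%nat)).
  { rewrite <- (ps_at_0 n mi Hn), <- (ps_at_0 m mf Hm). unfold mi, rot. rewrite Cmult_0_r.
    unfold Cdiv. rewrite Cmult_1_l. apply Cmod_inv, Hnz, HD0. }
  assert (Hap' : forall k, (1 <= k)%nat -> ((/ b) ^ k)%C <> 1%C).
  { intros k Hk E. apply (Hap k Hk).
    replace (b ^ k)%C with (b ^ k * (/ b) ^ k)%C by (rewrite E; ring).
    rewrite <- Cpow_mult_l, Cinv_r by exact Hb0. apply Cpow_1_l. }
  (* om lies between |l| and |m_0|, and q is the reciprocal of the midpoint of om and |m_0|, so that
     1 / |m_0| < q < 1 / om. *)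
  set (om := (Cmod l + Cmod (m 0%nat)) / 2). set (q := 2 / (om + Cmod (m 0%nat))).
  assert (Hom : Cmod l < om < Cmod (m 0%nat)) by (unfold om; lra).
  assert (Hq1 : / Cmod (m 0%nat) < q).
  { unfold q. apply Rmult_lt_reg_r with (Cmod (m 0%nat) * (om + Cmod (m 0%nat))).
    - apply Rmult_lt_0_compat; lra.
    - replace (/ Cmod (m 0%nat) * (Cmod (m 0%nat) * (om + Cmod (m 0%nat)))) with (om + Cmod (m 0%nat))
        by (field; lra).
      replace (2 / (om + Cmod (m 0%nat)) * (Cmod (m 0%nat) * (om + Cmod (m 0%nat)))) with
        (2 * Cmod (m 0%nat)) by (field; lra). lra. }
  assert (Hq2 : om * q < 1).
  { unfold q. apply Rmult_lt_reg_r with (om + Cmod (m 0%nat)); [lra|].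
    replace (om * (2 / (om + Cmod (m 0%nat))) * (om + Cmod (m 0%nat))) with (2 * om) by (field; lra). lra. }
  pose proof (power_bounded_zero_free n mi (/ b) q Hib Hn Hap' Hmi0 ltac:(lra)) as HP.
  pose proof (neumann_bounded n (/ b) q om Hib ltac:(lra) ltac:(lra) Hq2 HP) as HN.
  set (d := om - Cmod l).
  assert (Hdisc : forall mu, Cmod (mu - l)%C <= d -> Cmod mu <= om).
  { intros mu Hmu. pose proof (Cmod_triangle_rev mu l). unfold d in Hmu. lra. }
  assert (Hne : forall mu, Cmod mu <= om -> forall k, RtoC 1 <> (mu * (n 0%nat * (/ b) ^ k))%C).
  { intros mu Hmu k. apply sol_1_ne; [exact Hib|]. rewrite Hn0. pose proof (Cmod_ge_0 mu).
    apply Rmult_lt_reg_r with (Cmod (m 0%nat)); [lra|].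
    rewrite Rmult_assoc, Rinv_l by lra. lra. }
  assert (HT' : forall G g, ps g G -> ps (fun k => - (1) * Sop n (/ b) g k)%C (fun z => - (1) * T' G z)%C).
  { intros G g Hg. apply ps_scal, ps_wcomp; assumption. }
  assert (Hrho : forall mu, Cmod mu <= om -> in_rho (wcomp mf (rot b)) mu).
  { intros mu Hmu. split.
    - intros G HG. destruct (holD_ps G HG) as [g Hg]. pose proof (HT' G g Hg) as Hg'.
      destruct (sol_ex n (fun k => - (1) * Sop n (/ b) g k)%C (/ b) 1 mu (Hne mu Hmu)) as [f Hf].
      assert (Hfg : growth f).
      { intros r Hr. destruct (HN _ (proj1 Hg') r Hr) as [M HM]. exists M. apply (HM mu Hmu f Hf). }
      destruct (ps_ex f Hfg) as [F HF]. exists F. split; [apply (ps_holD f F HF)|].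
      apply (inverse_equation mf G F b mu Hb Hnz).
      apply (sol_pencil_iff n f _ mi F _ (/ b) 1 mu Hib Hn HF Hg'). exact Hf.
    - intros F1 F2 H1 H2 E.
      destruct (holD_ps F1 H1) as [f1 Hf1]. destruct (holD_ps F2 H2) as [f2 Hf2].
      assert (HG : holD (shiftop (wcomp mf (rot b)) mu F2)).
      { apply (ps_holD (fun k => mu * f2 k - 1 * Sop m b f2 k)%C).
        refine (ps_ext _ _ _ _ (fun k => eq_refl) _ (ps_pencil m f2 mf F2 b mu 1 Hb Hm Hf2)).
        intros z _. unfold shiftop. ring. }
      destruct (holD_ps _ HG) as [g Hg]. pose proof (HT' _ g Hg) as Hg'.
      apply (ps_eqD f2); [|exact Hf2].
      apply (ps_ext f1 f2 F1 F1); [|intros z _; reflexivity|exact Hf1].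
      apply (sol_unique n (/ b) 1 mu f1 f2 _ (Hne mu Hmu)
        (proj2 (sol_pencil_iff n f1 _ mi F1 _ (/ b) 1 mu Hib Hn Hf1 Hg')
          (proj1 (inverse_equation mf _ F1 b mu Hb Hnz) E))).
      apply (sol_pencil_iff n f2 _ mi F2 _ (/ b) 1 mu Hib Hn Hf2 Hg').
      apply (inverse_equation mf _ F2 b mu Hb Hnz). intros z _. reflexivity. }
  split; [apply Hrho; lra|]. exists d. split; [unfold d; lra|]. split.
  - intros mu Hmu. apply Hrho, Hdisc, Hmu.
  - intros G HG r Hr. destruct (holD_ps G HG) as [g Hg]. pose proof (HT' G g Hg) as Hg'.
    set (R := (1 + r) / 2). destruct (HN _ (proj1 Hg') R) as [M HM]; [unfold R; lra|].
    exists (M / (1 - r / R)). intros mu Hmu F HF E z Hz.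
    destruct (holD_ps F HF) as [f Hf].
    apply (ps_bound f F M r R z Hf); try (unfold R; lra).
    apply (HM mu (Hdisc mu Hmu)).
    apply (sol_pencil_iff n f _ mi F _ (/ b) 1 mu Hib Hn Hf Hg').
    apply (inverse_equation mf G F b mu Hb Hnz). exact E.
Qed.

Theorem sigmaW_zero_free (m : nat -> C) (mf : C -> C) (b l : C) : Cmod b = 1 -> ps m mf ->
  (forall n, (1 <= n)%nat -> (b ^ n)%C <> 1%C) -> (forall z, inD z -> mf z <> 0%C) ->
  (in_sigmaW (wcomp mf (rot b)) l <-> Cmod l = Cmod (m 0%nat)).
Proof.
  intros Hb Hm Hap Hnz. split.
  - intros Hs. destruct (Rtotal_order (Cmod l) (Cmod (m 0%nat))) as [L|[E|L]]; [|exact E|].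
    + exfalso. apply Hs. apply (rhoW_inside m); assumption.
    + exfalso. apply Hs. set (q := (Cmod l + Cmod (m 0%nat)) / 2).
      apply (rhoW_of_power_bounded m mf b l q Hb Hm); try (unfold q; lra).
      apply (power_bounded_zero_free m mf b q Hb Hm Hap Hnz). unfold q. lra.
  - apply sigmaW_critical_circle; assumption.
Qed.

(** * Conjugation to a rotation about 0 *)

Lemma Cmod_lt_1_ne (x : C) : Cmod x < 1 -> (1 - x)%C <> 0%C.
Proof. intros H. apply Cminus_eq_contra. intros E. rewrite <- E, Cmod_1 in H. lra. Qed.

Lemma Psi_den (a z : C) : inD a -> inD z -> (1 - Cconj a * z)%C <> 0%C.
Proof.
  intros Ha Hz. apply Cmod_lt_1_ne. unfold inD in *. rewrite Cmod_mult, Cmod_conj.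
  pose proof (Cmod_ge_0 a). pose proof (Cmod_ge_0 z). nra.
Qed.

Lemma Psi_invol (a z : C) : inD a -> inD z -> Psi a (Psi a z) = z.
Proof.
  intros Ha Hz. pose proof (Psi_den a z Ha Hz) as H1. pose proof (Psi_den a a Ha Ha) as H2.
  assert (H3 : (1 - Cconj a * ((a - z) / (1 - Cconj a * z)))%C <> 0%C).
  { replace (1 - Cconj a * ((a - z) / (1 - Cconj a * z)))%C with
      ((1 - Cconj a * a) * / (1 - Cconj a * z))%C by (field; exact H1).
    apply Cmult_neq_0; [exact H2|]. intros E. apply C1_nz.
    rewrite <- (Cinv_r _ H1), E. ring. }
  unfold Psi. field. split; [exact H1|].
  replace (1 - Cconj a * z - Cconj a * (a - z))%C with (1 - Cconj a * a)%C by ring. exact H2.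
Qed.

Lemma Psi_holD (a : C) : inD a -> holD (Psi a).
Proof.
  intros Ha. apply Cder_holD. intros z Hz. unfold Psi. eapply Cder_div.
  - apply Cder_minus; [apply Cder_const|apply Cder_id].
  - apply Cder_minus; [apply Cder_const|].
    apply Cder_mult; [apply Cder_const|apply Cder_id].
  - apply Psi_den; assumption.
Qed.

(** Rests on the identity |1 - conj(a) z|^2 - |a - z|^2 = (1 - |a|^2)(1 - |z|^2). *)
Lemma Psi_disc (a : C) (r : R) : inD a -> 0 <= r < 1 ->
  exists r', 0 < r' < 1 /\ forall z, Cmod z <= r -> Cmod (Psi a z) <= r'.
Proof.
  intros Ha Hr. unfold inD in Ha. pose proof (Cmod_ge_0 a) as Pa.
  (* The denominator D satisfies D^2 <= 4, so the identity gives N^2 <= D^2 (1 - ka), and 1 - ka <=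
     (1 - ka / 2)^2. *)
  set (ka := (1 - Cmod a * Cmod a) * (1 - r * r) / 4).
  assert (Hka : 0 < ka <= 1 / 4).
  { assert (0 < 1 - Cmod a * Cmod a <= 1) by nra. assert (0 < 1 - r * r <= 1) by nra.
    unfold ka. nra. }
  exists (1 - ka / 2). split; [lra|]. intros z Hz. pose proof (Cmod_ge_0 z) as Pz.
  assert (Hz1 : inD z) by (unfold inD; lra).
  pose proof (Psi_den a z Ha Hz1) as Hden.
  set (D := Cmod (1 - Cconj a * z)%C). assert (PD : 0 < D) by (apply Cmod_gt_0, Hden).
  assert (D2 : D <= 2).
  { unfold D. eapply Rle_trans; [apply Cmod_triangle_minus|]. rewrite Cmod_1, Cmod_mult, Cmod_conj. nra. }
  set (N := Cmod (a - z)%C). assert (PN : 0 <= N) by apply Cmod_ge_0.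
  assert (Hid : D * D - N * N = (1 - Cmod a * Cmod a) * (1 - Cmod z * Cmod z)).
  { unfold D, N. rewrite !Cmod_sq. destruct a as [a1 a2]. destruct z as [z1 z2]. simpl. ring. }
  unfold Psi. rewrite Cmod_div by exact Hden. fold N D.
  apply Rmult_le_reg_r with D; [exact PD|].
  unfold Rdiv at 1. rewrite Rmult_assoc, Rinv_l, Rmult_1_r by lra.
  apply Rsqr_incr_0_var; [|apply Rmult_le_pos; lra]. unfold Rsqr.
  assert (H1 : 4 * ka <= D * D - N * N).
  { rewrite Hid. unfold ka. replace (4 * ((1 - Cmod a * Cmod a) * (1 - r * r) / 4)) with
      ((1 - Cmod a * Cmod a) * (1 - r * r)) by field.
    apply Rmult_le_compat_l; nra. }
  assert (H2 : D * D * ka <= 4 * ka) by (apply Rmult_le_compat_r; nra).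
  assert (0 <= D * D * (ka * ka)) by (apply Rmult_le_pos; nra).
  replace ((1 - ka / 2) * D * ((1 - ka / 2) * D)) with (D * D - D * D * ka + D * D * (ka * ka) / 4)
    by field.
  lra.
Qed.

Lemma Psi_inD (a z : C) : inD a -> inD z -> inD (Psi a z).
Proof.
  intros Ha Hz. unfold inD in Hz. pose proof (Cmod_ge_0 z).
  destruct (Psi_disc a (Cmod z) Ha) as [r' [Hr' H']]; [lra|].
  unfold inD. specialize (H' z (Rle_refl _)). lra.
Qed.

(** Composition with the involution P is its own inverse and exchanges T1 and T2. The condition on
    radii is its continuity for the seminorms, which transports the resolvent bounds. *)
Lemma rhoW_conjugate (T1 T2 : (C -> C) -> (C -> C)) (P : C -> C) (l : C) :
  holD P -> (forall z, inD z -> inD (P z)) -> (forall z, inD z -> P (P z) = z) ->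
  (forall r, 0 < r < 1 -> exists r', 0 < r' < 1 /\ forall z, Cmod z <= r -> Cmod (P z) <= r') ->
  (forall f z, inD z -> T2 (fun y => f (P y)) z = T1 f (P z)) ->
  (forall f z, inD z -> T1 (fun y => f (P y)) z = T2 f (P z)) ->
  in_rhoW T1 l -> in_rhoW T2 l.
Proof.
  intros HP HPD HPP HPr H21 H12 [Hl [d [Hd [Hrho HB]]]].
  assert (Hc : forall f, holD f -> holD (fun y => f (P y))) by (intros f Hf; apply holD_comp; assumption).
  assert (Htr : forall mu f g, eqD (shiftop T2 mu f) g ->
    eqD (shiftop T1 mu (fun y => f (P y))) (fun y => g (P y))).
  { intros mu f g E z Hz. unfold shiftop. rewrite H12 by exact Hz. apply (E (P z)), HPD, Hz. }
  assert (Hin : forall mu, in_rho T1 mu -> in_rho T2 mu).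
  { intros mu [Hs Hi]. split.
    - intros g Hg. destruct (Hs _ (Hc g Hg)) as [f [Hf E]].
      exists (fun y => f (P y)). split; [apply Hc, Hf|]. intros z Hz.
      unfold shiftop. rewrite H21 by exact Hz. rewrite <- (HPP z Hz) at 3. apply (E (P z)), HPD, Hz.
    - intros f1 f2 Hf1 Hf2 E z Hz. rewrite <- (HPP z Hz).
      apply (Hi (fun y => f1 (P y)) (fun y => f2 (P y))); [apply Hc, Hf1|apply Hc, Hf2| |apply HPD, Hz].
      intros y Hy. rewrite (Htr mu f1 _ E y Hy).
      symmetry. apply (Htr mu f2 (shiftop T2 mu f2)); [intros w _; reflexivity|exact Hy]. }
  split; [apply Hin, Hl|]. exists d. split; [exact Hd|]. split; [intros mu Hmu; apply Hin, Hrho, Hmu|].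
  intros g Hg r Hr. destruct (HPr r Hr) as [r' [Hr' Hrr]].
  destruct (HB _ (Hc g Hg) r' Hr') as [M HM]. exists M. intros mu Hmu h Hh E z Hz.
  assert (HzD : inD z) by (unfold inD; lra).
  rewrite <- (HPP z HzD). apply (HM mu Hmu _ (Hc h Hh) (Htr mu h g E)). apply Hrr, Hz.
Qed.

Lemma rhoW_rotation_model (a b l : C) (m : C -> C) : inD a -> Cmod b = 1 ->
  in_rhoW (wcomp m (phi a b)) l <-> in_rhoW (wcomp (fun z => m (Psi a z)) (rot b)) l.
Proof.
  intros Ha Hb.
  assert (HPr : forall r, 0 < r < 1 -> exists r', 0 < r' < 1 /\ forall z, Cmod z <= r -> Cmod (Psi a z) <= r')
    by (intros r Hr; apply Psi_disc; [exact Ha|lra]).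
  assert (Hrot : forall z, inD z -> inD (rot b z)) by (intros z Hz; unfold inD, rot in *; rewrite Cmod_mult, Hb; lra).
  assert (H1 : forall f z, inD z -> wcomp m (phi a b) (fun y => f (Psi a y)) z =
    wcomp (fun z => m (Psi a z)) (rot b) f (Psi a z)).
  { intros f z Hz. unfold wcomp, phi. rewrite !Psi_invol; auto. apply Hrot, Psi_inD; assumption. }
  assert (H2 : forall f z, inD z -> wcomp (fun z => m (Psi a z)) (rot b) (fun y => f (Psi a y)) z =
    wcomp m (phi a b) f (Psi a z)).
  { intros f z Hz. unfold wcomp, phi. rewrite Psi_invol by assumption. reflexivity. }
  split; apply (rhoW_conjugate _ _ (Psi a)); auto using Psi_holD, Psi_inD, Psi_invol.
Qed.

(** The iterate phi_n is the conjugate by Psi_a of the rotation by b^n, hence the identity on the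
    disc when b^n = 1. *)
Lemma aperiodic_not_root (a b : C) : inD a -> Cmod b = 1 -> aperiodic (phi a b) ->
  forall n, (1 <= n)%nat -> (b ^ n)%C <> 1%C.
Proof.
  intros Ha Hb Hap n Hn E. destruct (Hap n Hn) as [z [Hz Hne]]. apply Hne.
  assert (H : forall k, Nat.iter k (phi a b) z = Psi a (b ^ k * Psi a z)%C).
  { induction k as [|k IH].
    - simpl. rewrite Cmult_1_l, Psi_invol by assumption. reflexivity.
    - simpl Nat.iter. rewrite IH. unfold phi at 1. rewrite Psi_invol.
      + unfold rot. f_equal. rewrite Cpow_S. ring.
      + exact Ha.
      + pose proof (Psi_inD a z Ha Hz) as Hp. unfold inD in *.
        rewrite Cmod_mult, Cmod_pow_1; lra. }
  rewrite H, E, Cmult_1_l. apply Psi_invol; assumption.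
Qed.

Theorem theorem8p1 (a b : C) (m : C -> C) :
  inD a -> Cmod b = 1 -> b <> 1%C ->
  aperiodic (phi a b) ->
  holD m -> (exists z, inD z /\ m z <> 0%C) ->
  ((forall z, inD z -> m z <> 0%C) ->
     forall l : C, in_sigmaW (wcomp m (phi a b)) l <-> Cmod l = Cmod (m a))
  /\
  ((exists z0, inD z0 /\ m z0 = 0%C) ->
     (exists R : R, 0 < R /\
        forall l : C, in_sigmaW (wcomp m (phi a b)) l <-> Cmod l <= R)
     \/ (forall l : C, in_sigmaW (wcomp m (phi a b)) l)).
Proof.
  intros Ha Hb _ Hper Hm [z1 [Hz1 Hmz1]].
  pose proof (aperiodic_not_root a b Ha Hb Hper) as Hap.
  set (mf := fun z => m (Psi a z)).
  assert (Hmf : holD mf) by exact (holD_comp m (Psi a) Hm (Psi_holD a Ha) (fun z => Psi_inD a z Ha)).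
  destruct (holD_ps mf Hmf) as [c Hc].
  assert (Hsig : forall l, in_sigmaW (wcomp m (phi a b)) l <-> in_sigmaW (wcomp mf (rot b)) l).
  { intros l. unfold in_sigmaW. rewrite (rhoW_rotation_model a b l m Ha Hb). reflexivity. }
  (* Psi_a(0) = alpha: the centre of the rotation corresponds to the fixed point of phi. *)
  assert (Hc0 : c 0%nat = m a).
  { rewrite <- (ps_at_0 c mf Hc). unfold mf, Psi. f_equal. field. }
  split.
  - intros Hnz l. rewrite Hsig, <- Hc0. apply sigmaW_zero_free; auto.
    intros z Hz. apply Hnz, Psi_inD; assumption.
  - intros [z0 [Hz0 Hm0]].
    destruct (sigmaW_with_zero c mf b (Psi a z0) Hb Hc Hap) as [[R [HR HRl]]|Hall].
    (* Were all Taylor coefficients of m o Psi_a zero, m would vanish at z1. *)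
    + apply NNPP. intros Hno. apply Hmz1.
      assert (Hzero : ps c (fun _ => 0%C)).
      { apply (ps_ext (delta0 0) c (fun _ => 0%C) (fun _ => 0%C)); [|intros z _; reflexivity|apply ps_const].
        intros k. transitivity (RtoC 0); [destruct k; reflexivity|].
        symmetry. apply NNPP. intros Hk. apply Hno. exists k. exact Hk. }
      rewrite <- (Psi_invol a z1 Ha Hz1).
      apply (ps_eqD c mf _ Hc Hzero (Psi a z1)). apply Psi_inD; assumption.
    + apply Psi_inD; assumption.
    + unfold mf. rewrite Psi_invol by assumption. exact Hm0.
    + left. exists R. split; [exact HR|]. intros l. rewrite Hsig. apply HRl.
    + right. intros l. apply Hsig, Hall.
Qed.
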